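(* Let $A=(a_{ij})_{i,j\in I}$ be a $2$-spherical generalised Cartan matrix. Fix a $\mathbb Q$-basis $\mathcal B$ of $\mathfrak n^+_{A,\mathbb Q}$ consisting of elements of the form $x=[e_{i_1},[e_{i_2},[\dots,e_{i_n}]]]$ (in which case set $n_x:=n$), and for each such $x\in\mathcal B$ and $\lambda\in\mathbb Q$ set accordingly $$u_x(\lambda):=[x_{\alpha_{i_1}}(\lambda),[x_{\alpha_{i_2}}(1),[\dots,x_{\alpha_{i_n}}(1)]]]\in\mathfrak U^+_A(\mathbb Q).$$ Fix a total order on $\mathcal B$ such that $n_x<n_y\implies x<y$. Then each $g\in\mathfrak U^+_A(\mathbb Q)$ can be uniquely written in the form $$g=\prod_{x\in\mathcal B}u_x(\lambda_x)\in\widehat{\mathfrak U}^+_A(\mathbb Q)\quad\text{for some }\lambda_x\in\mathbb Q$$ with $\prod_{n_x\ge n}u_x(\lambda_x)\in\gamma_n(\mathfrak U^+_A(\mathbb Q))$ for all integers $n\ge1$.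
   Context: Group commutators are $[g,h]=g^{-1}h^{-1}gh$; $\gamma_1(H)=H$, $\gamma_{n+1}(H)=[H,\gamma_n(H)]$; $\widehat H$ is the Hausdorff completion of $H$ with respect to $(\gamma_n(H))_n$, i.e. $\varprojlim_nH/\gamma_n(H)$. The group $\mathfrak U^+_A(\mathbb Q)$ below is residually nilpotent, hence is regarded as a subgroup of $\widehat{\mathfrak U}^+_A(\mathbb Q)$; infinite products are taken in the given order of $\mathcal B$ and converge in $\widehat{\mathfrak U}^+_A(\mathbb Q)$. A generalised Cartan matrix (GCM) is an integer matrix $A=(a_{ij})_{i,j\in I}$ ($I$ finite) with $a_{ii}=2$, $a_{ij}\le0$ for $i\ne j$, and $a_{ij}=0\Leftrightarrow a_{ji}=0$. Let $Q=\bigoplus_{i\in I}\mathbb Z\alpha_i$, $Q_+=\sum_i\mathbb N\alpha_i$, $\mathrm{ht}(\sum n_i\alpha_i)=\sum n_i$, and let $W_A\le\mathrm{GL}(Q)$ be generated by $s_i\colon\alpha_j\mapsto\alpha_j-a_{ij}\alpha_i$. $A$ is spherical if $W_A$ is finite, and $2$-spherical if each submatrix $(a_{ij})_{i,j\in J}$ with $|J|\le2$ is spherical. Real roots: $\Delta^{re}=W_A\{\alpha_i\mid i\in I\}$, $\Delta^{re+}=\Delta^{re}\cap Q_+$. $\mathfrak n^+_{A,\mathbb Q}$ is the $\mathbb Q$-Lie algebra with generators $e_i$ ($i\in I$) and relations $(\mathrm{ad}\,e_i)^{1-a_{ij}}e_j=0$ ($i\ne j$), $Q_+$-graded by $\deg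 e_i=\alpha_i$: $\mathfrak n^+_{A,\mathbb Q}=\bigoplus_\alpha\mathfrak g_\alpha$. $\mathfrak U^+_A(\mathbb Q)$ is the subgroup of the minimal Kac–Moody group $\mathfrak G_A(\mathbb Q)$ (constructive Tits functor of simply connected type $A$) generated by the root groups $\mathfrak U_\alpha(\mathbb Q)$, $\alpha\in\Delta^{re+}$. By a standard fact it is canonically identified (and this may be taken as its definition) with the subgroup generated by the subgroups $\exp(\mathfrak g_\alpha)$, $\alpha\in\Delta^{re+}$, of the multiplicative group of the completion of the universal enveloping algebra of $\mathfrak n^+_{A,\mathbb Q}$ with respect to its height grading; under this identification $x_{\alpha_i}(r)=\exp(re_i)$ for $i\in I$, $r\in\mathbb Q$. *)

(* Defs.v *)
From HB Require Import structures.
From mathcomp Require Import all_boot all_order all_algebra.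
From mathcomp Require Import boolp classical_sets cardinality.

Set Implicit Arguments.
Unset Strict Implicit.
Unset Printing Implicit Defensive.

Import Order.TTheory GRing.Theory Num.Theory.
Local Open Scope quotient_scope.
Local Open Scope ring_scope.

(* Right-normed iteration x1 * (x2 * (... * xn)) for the word x1 :: s.        *)
Fixpoint rnormed (X : Type) (op : X -> X -> X) (x : X) (s : seq X) : X :=
  if s is y :: s' then op x (rnormed op y s') else x.

HB.mixin Record Lmodule_isLieAlgebra (K : pzRingType) L of GRing.Lmodule K L := {
  lie : L -> L -> L;
  lieDl : forall x y z, lie (x + y) z = lie x z + lie y z;
  lieDr : forall x y z, lie x (y + z) = lie x y + lie x z;
  lieZl : forall a x y, lie (a *: x) y = a *: lie x y;
  lieZr : forall a x y, lie x (a *: y) = a *: lie x y;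
  liexx : forall x, lie x x = 0;
  jacobi : forall x y z, lie x (lie y z) + lie y (lie z x) + lie z (lie x y) = 0
}.

#[short(type="lieAlgType")]
HB.structure Definition LieAlgebra (K : pzRingType) :=
  {L of Lmodule_isLieAlgebra K L & GRing.Lmodule K L}.

Inductive lie_term (K X : Type) : Type :=
| LGen of X
| LZero
| LAdd of lie_term K X & lie_term K X
| LScale of K & lie_term K X
| LLie of lie_term K X & lie_term K X.

Arguments LZero {K X}.
Arguments LGen {K X}.

HB.instance Definition _ (K X : Type) := gen_eqMixin (lie_term K X).
HB.instance Definition _ (K X : Type) := gen_choiceMixin (lie_term K X).

Section PresentedLieAlgebra.
Variables (K : fieldType) (X : Type) (rel : set (lie_term K X)).
Implicit Types (a b : K) (s t u : lie_term K X).

(* The smallest congruence on terms which makes the quotient a Lie algebra in *)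
(* which every relator of rel vanishes.                                       *)
Inductive lie_eq : lie_term K X -> lie_term K X -> Prop :=
| lie_eq_rel t : rel t -> lie_eq t LZero
| lie_eq_refl t : lie_eq t t
| lie_eq_sym s t : lie_eq s t -> lie_eq t s
| lie_eq_trans s t u : lie_eq s t -> lie_eq t u -> lie_eq s u
| lie_eq_add s s' t t' :
    lie_eq s s' -> lie_eq t t' -> lie_eq (LAdd s t) (LAdd s' t')
| lie_eq_scale a t t' : lie_eq t t' -> lie_eq (LScale a t) (LScale a t')
| lie_eq_lie s s' t t' :
    lie_eq s s' -> lie_eq t t' -> lie_eq (LLie s t) (LLie s' t')
| lie_eq_addA s t u : lie_eq (LAdd s (LAdd t u)) (LAdd (LAdd s t) u)
| lie_eq_addC s t : lie_eq (LAdd s t) (LAdd t s)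
| lie_eq_add0 t : lie_eq (LAdd LZero t) t
| lie_eq_addN t : lie_eq (LAdd (LScale (-1) t) t) LZero
| lie_eq_scaleA a b t : lie_eq (LScale a (LScale b t)) (LScale (a * b) t)
| lie_eq_scale1 t : lie_eq (LScale 1 t) t
| lie_eq_scaleDr a s t :
    lie_eq (LScale a (LAdd s t)) (LAdd (LScale a s) (LScale a t))
| lie_eq_scaleDl a b t :
    lie_eq (LScale (a + b) t) (LAdd (LScale a t) (LScale b t))
| lie_eq_lieDl s t u : lie_eq (LLie (LAdd s t) u) (LAdd (LLie s u) (LLie t u))
| lie_eq_lieDr s t u : lie_eq (LLie s (LAdd t u)) (LAdd (LLie s t) (LLie s u))
| lie_eq_lieZl a s t : lie_eq (LLie (LScale a s) t) (LScale a (LLie s t))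
| lie_eq_lieZr a s t : lie_eq (LLie s (LScale a t)) (LScale a (LLie s t))
| lie_eq_liexx t : lie_eq (LLie t t) LZero
| lie_eq_jacobi s t u :
    lie_eq (LAdd (LAdd (LLie s (LLie t u)) (LLie t (LLie u s)))
                 (LLie u (LLie s t))) LZero.

Definition lie_eqb s t := `[< lie_eq s t >].

Fact lie_eqb_refl : reflexive lie_eqb.
Proof. by move=> t; apply/asboolP/lie_eq_refl. Qed.
Fact lie_eqb_sym : symmetric lie_eqb.
Proof. by move=> s t; apply/asboolP/asboolP => /lie_eq_sym. Qed.
Fact lie_eqb_trans : transitive lie_eqb.
Proof.
by move=> s t u /asboolP ts /asboolP su; apply/asboolP/(lie_eq_trans ts su).
Qed.

Canonical lie_equiv := EquivRel lie_eqb lie_eqb_refl lie_eqb_sym lie_eqb_trans.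

Definition lie_pres := {eq_quot lie_equiv}.
HB.instance Definition _ := Choice.on lie_pres.

Definition lie_pi (t : lie_term K X) : lie_pres := \pi_({eq_quot lie_equiv}) t.
Definition lie_repr (x : lie_pres) : lie_term K X := repr x.

Lemma lie_reprK : cancel lie_repr lie_pi.
Proof. exact: reprK. Qed.

Lemma lie_piP s t : (lie_pi s = lie_pi t) <-> lie_eq s t.
Proof.
by split=> [/eqmodP/asboolP|st] //; apply/eqmodP/asboolP.
Qed.

Lemma lie_repr_pi t : lie_eq (lie_repr (lie_pi t)) t.
Proof. by apply/lie_piP; rewrite lie_reprK. Qed.

Lemma lie_pi_surj (x : lie_pres) : exists t, x = lie_pi t.
Proof. by exists (lie_repr x); rewrite lie_reprK. Qed.

Definition lp_add (x y : lie_pres) := lie_pi (LAdd (lie_repr x) (lie_repr y)).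
Definition lp_scale a (x : lie_pres) := lie_pi (LScale a (lie_repr x)).
Definition lp_lie (x y : lie_pres) := lie_pi (LLie (lie_repr x) (lie_repr y)).

Lemma lp_addE s t : lp_add (lie_pi s) (lie_pi t) = lie_pi (LAdd s t).
Proof. by apply/lie_piP/lie_eq_add; apply: lie_repr_pi. Qed.
Lemma lp_scaleE a t : lp_scale a (lie_pi t) = lie_pi (LScale a t).
Proof. by apply/lie_piP/lie_eq_scale/lie_repr_pi. Qed.
Lemma lp_lieE s t : lp_lie (lie_pi s) (lie_pi t) = lie_pi (LLie s t).
Proof. by apply/lie_piP/lie_eq_lie; apply: lie_repr_pi. Qed.

Local Ltac lp_law :=
  repeat (let x := fresh "x" in
    move=> x; try (rewrite -[x]lie_reprK; generalize (lie_repr x); clear x));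
  rewrite ?(lp_addE, lp_scaleE, lp_lieE); apply/lie_piP; by constructor.

Fact lp_addA : associative lp_add. Proof. lp_law. Qed.
Fact lp_addC : commutative lp_add. Proof. lp_law. Qed.
Fact lp_add0 : left_id (lie_pi LZero) lp_add. Proof. lp_law. Qed.
Fact lp_addN : left_inverse (lie_pi LZero) (lp_scale (-1)) lp_add.
Proof. lp_law. Qed.

HB.instance Definition _ :=
  GRing.isZmodule.Build lie_pres lp_addA lp_addC lp_add0 lp_addN.

Fact lp_scaleA a b v : lp_scale a (lp_scale b v) = lp_scale (a * b) v.
Proof. move: v; lp_law. Qed.
Fact lp_scale1 : left_id 1 lp_scale. Proof. lp_law. Qed.
Fact lp_scaleDr : right_distributive lp_scale lp_add. Proof. lp_law. Qed.
Fact lp_scaleDl v : {morph lp_scale^~ v : a b / a + b >-> lp_add a b}.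
Proof. move: v; lp_law. Qed.

HB.instance Definition _ := GRing.Zmodule_isLmodule.Build K lie_pres
  lp_scaleA lp_scale1 lp_scaleDr lp_scaleDl.

Fact lp_lieDl x y z : lp_lie (lp_add x y) z = lp_add (lp_lie x z) (lp_lie y z).
Proof. move: x y z; lp_law. Qed.
Fact lp_lieDr x y z : lp_lie x (lp_add y z) = lp_add (lp_lie x y) (lp_lie x z).
Proof. move: x y z; lp_law. Qed.
Fact lp_lieZl a x y : lp_lie (lp_scale a x) y = lp_scale a (lp_lie x y).
Proof. move: x y; lp_law. Qed.
Fact lp_lieZr a x y : lp_lie x (lp_scale a y) = lp_scale a (lp_lie x y).
Proof. move: x y; lp_law. Qed.
Fact lp_liexx x : lp_lie x x = lie_pi LZero.
Proof. move: x; lp_law. Qed.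
Fact lp_jacobi x y z : lp_add (lp_add (lp_lie x (lp_lie y z))
  (lp_lie y (lp_lie z x))) (lp_lie z (lp_lie x y)) = lie_pi LZero.
Proof. move: x y z; lp_law. Qed.

HB.instance Definition _ := Lmodule_isLieAlgebra.Build K lie_pres
  lp_lieDl lp_lieDr lp_lieZl lp_lieZr lp_liexx lp_jacobi.

Definition lie_gen (i : X) : lie_pres := lie_pi (LGen i).

End PresentedLieAlgebra.

Inductive env_term (K L : Type) : Type :=
| EGen of L
| EZero
| EOne
| EAdd of env_term K L & env_term K L
| EScale of K & env_term K L
| EMul of env_term K L & env_term K L.

Arguments EZero {K L}.
Arguments EOne {K L}.
Arguments EGen {K L}.

HB.instance Definition _ (K L : Type) := gen_eqMixin (env_term K L).
HB.instance Definition _ (K L : Type) := gen_choiceMixin (env_term K L).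

Section EnvelopingAlgebra.
Variables (K : fieldType) (L : lieAlgType K).
Implicit Types (a b : K) (x y : L) (s t u : env_term K L).

(* The smallest congruence on terms which makes the quotient an associative   *)
(* unital K-algebra and EGen a K-linear map such that [x,y] = xy - yx.        *)
Inductive env_eq : env_term K L -> env_term K L -> Prop :=
| env_eq_genD x y : env_eq (EGen (x + y)) (EAdd (EGen x) (EGen y))
| env_eq_genZ a x : env_eq (EGen (a *: x)) (EScale a (EGen x))
| env_eq_lie x y : env_eq (EGen (lie x y))
    (EAdd (EMul (EGen x) (EGen y)) (EScale (-1) (EMul (EGen y) (EGen x))))
| env_eq_refl t : env_eq t t
| env_eq_sym s t : env_eq s t -> env_eq t s
| env_eq_trans s t u : env_eq s t -> env_eq t u -> env_eq s u
| env_eq_add s s' t t' :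
    env_eq s s' -> env_eq t t' -> env_eq (EAdd s t) (EAdd s' t')
| env_eq_scale a t t' : env_eq t t' -> env_eq (EScale a t) (EScale a t')
| env_eq_mul s s' t t' :
    env_eq s s' -> env_eq t t' -> env_eq (EMul s t) (EMul s' t')
| env_eq_addA s t u : env_eq (EAdd s (EAdd t u)) (EAdd (EAdd s t) u)
| env_eq_addC s t : env_eq (EAdd s t) (EAdd t s)
| env_eq_add0 t : env_eq (EAdd EZero t) t
| env_eq_addN t : env_eq (EAdd (EScale (-1) t) t) EZero
| env_eq_scaleA a b t : env_eq (EScale a (EScale b t)) (EScale (a * b) t)
| env_eq_scale1 t : env_eq (EScale 1 t) t
| env_eq_scaleDr a s t :
    env_eq (EScale a (EAdd s t)) (EAdd (EScale a s) (EScale a t))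
| env_eq_scaleDl a b t :
    env_eq (EScale (a + b) t) (EAdd (EScale a t) (EScale b t))
| env_eq_mulA s t u : env_eq (EMul s (EMul t u)) (EMul (EMul s t) u)
| env_eq_mul1t t : env_eq (EMul EOne t) t
| env_eq_mult1 t : env_eq (EMul t EOne) t
| env_eq_mulDl s t u : env_eq (EMul (EAdd s t) u) (EAdd (EMul s u) (EMul t u))
| env_eq_mulDr s t u : env_eq (EMul s (EAdd t u)) (EAdd (EMul s t) (EMul s u))
| env_eq_scaleAl a s t : env_eq (EScale a (EMul s t)) (EMul (EScale a s) t)
| env_eq_scaleAr a s t : env_eq (EScale a (EMul s t)) (EMul s (EScale a t)).

Definition env_eqb s t := `[< env_eq s t >].

Fact env_eqb_refl : reflexive env_eqb.
Proof. by move=> t; apply/asboolP/env_eq_refl. Qed.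
Fact env_eqb_sym : symmetric env_eqb.
Proof. by move=> s t; apply/asboolP/asboolP => /env_eq_sym. Qed.
Fact env_eqb_trans : transitive env_eqb.
Proof.
by move=> s t u /asboolP ts /asboolP su; apply/asboolP/(env_eq_trans ts su).
Qed.

Canonical env_equiv := EquivRel env_eqb env_eqb_refl env_eqb_sym env_eqb_trans.

Definition env := {eq_quot env_equiv}.
HB.instance Definition _ := Choice.on env.

Definition env_pi (t : env_term K L) : env := \pi_({eq_quot env_equiv}) t.
Definition env_repr (x : env) : env_term K L := repr x.

Lemma env_reprK : cancel env_repr env_pi.
Proof. exact: reprK. Qed.

Lemma env_piP s t : (env_pi s = env_pi t) <-> env_eq s t.
Proof.
by split=> [/eqmodP/asboolP|st] //; apply/eqmodP/asboolP.
Qed.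

Lemma env_repr_pi t : env_eq (env_repr (env_pi t)) t.
Proof. by apply/env_piP; rewrite env_reprK. Qed.

Lemma env_pi_surj (x : env) : exists t, x = env_pi t.
Proof. by exists (env_repr x); rewrite env_reprK. Qed.

Definition env_add (x y : env) := env_pi (EAdd (env_repr x) (env_repr y)).
Definition env_scale a (x : env) := env_pi (EScale a (env_repr x)).
Definition env_mul (x y : env) := env_pi (EMul (env_repr x) (env_repr y)).

Lemma env_addE s t : env_add (env_pi s) (env_pi t) = env_pi (EAdd s t).
Proof. by apply/env_piP/env_eq_add; apply: env_repr_pi. Qed.
Lemma env_scaleE a t : env_scale a (env_pi t) = env_pi (EScale a t).
Proof. by apply/env_piP/env_eq_scale/env_repr_pi. Qed.
Lemma env_mulE s t : env_mul (env_pi s) (env_pi t) = env_pi (EMul s t).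
Proof. by apply/env_piP/env_eq_mul; apply: env_repr_pi. Qed.

Local Ltac env_law :=
  repeat (let x := fresh "x" in
    move=> x; try (rewrite -[x]env_reprK; generalize (env_repr x); clear x));
  rewrite ?(env_addE, env_scaleE, env_mulE); apply/env_piP; by constructor.

Fact env_addA : associative env_add. Proof. env_law. Qed.
Fact env_addC : commutative env_add. Proof. env_law. Qed.
Fact env_add0 : left_id (env_pi EZero) env_add. Proof. env_law. Qed.
Fact env_addN : left_inverse (env_pi EZero) (env_scale (-1)) env_add.
Proof. env_law. Qed.

HB.instance Definition _ :=
  GRing.isZmodule.Build env env_addA env_addC env_add0 env_addN.

Fact env_scaleA a b v : env_scale a (env_scale b v) = env_scale (a * b) v.
Proof. move: v; env_law. Qed.
Fact env_scale1 : left_id 1 env_scale. Proof. env_law. Qed.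
Fact env_scaleDr : right_distributive env_scale env_add. Proof. env_law. Qed.
Fact env_scaleDl v : {morph env_scale^~ v : a b / a + b >-> env_add a b}.
Proof. move: v; env_law. Qed.

HB.instance Definition _ := GRing.Zmodule_isLmodule.Build K env
  env_scaleA env_scale1 env_scaleDr env_scaleDl.

Fact env_mulA : associative env_mul. Proof. env_law. Qed.
Fact env_mul1x : left_id (env_pi EOne) env_mul. Proof. env_law. Qed.
Fact env_mulx1 : right_id (env_pi EOne) env_mul. Proof. env_law. Qed.
Fact env_mulDl : left_distributive env_mul env_add. Proof. env_law. Qed.
Fact env_mulDr : right_distributive env_mul env_add. Proof. env_law. Qed.

Fixpoint env_aug t : K :=
  match t with
  | EGen _ => 0
  | EZero => 0
  | EOne => 1
  | EAdd s t => env_aug s + env_aug t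
  | EScale a t => a * env_aug t
  | EMul s t => env_aug s * env_aug t
  end.

Lemma env_eq_aug s t : env_eq s t -> env_aug s = env_aug t.
Proof.
elim=> {s t} //=.
- by rewrite addr0.
- by move=> a _; rewrite mulr0.
- by rewrite mulr0 mulr0 addr0.
- by move=> s t u _ -> _ ->.
- by move=> s s' t t' _ -> _ ->.
- by move=> a t t' _ ->.
- by move=> s s' t t' _ -> _ ->.
- by move=> s t u; rewrite addrA.
- by move=> s t; rewrite addrC.
- by move=> t; rewrite add0r.
- by move=> t; rewrite mulN1r addNr.
- by move=> a b t; rewrite mulrA.
- by move=> t; rewrite mul1r.
- by move=> a s t; rewrite mulrDr.
- by move=> a b t; rewrite mulrDl.
- by move=> s t u; rewrite mulrA.
- by move=> t; rewrite mul1r.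
- by move=> t; rewrite mulr1.
- by move=> s t u; rewrite mulrDl.
- by move=> s t u; rewrite mulrDr.
- by move=> a s t; rewrite mulrA.
- by move=> a s t; rewrite mulrCA.
Qed.

Fact env_1neq0 : env_pi EOne != env_pi EZero.
Proof.
by apply/eqP => /env_piP/env_eq_aug /=; apply/eqP/oner_neq0.
Qed.

HB.instance Definition _ := GRing.Zmodule_isNzRing.Build env
  env_mulA env_mul1x env_mulx1 env_mulDl env_mulDr env_1neq0.

Fact env_scaleAl a (x y : env) :
  env_scale a (env_mul x y) = env_mul (env_scale a x) y.
Proof. move: x y; env_law. Qed.
Fact env_scaleAr a (x y : env) :
  env_scale a (env_mul x y) = env_mul x (env_scale a y).
Proof. move: x y; env_law. Qed.

HB.instance Definition _ := GRing.Lmodule_isLalgebra.Build K env env_scaleAl.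
HB.instance Definition _ := GRing.Lalgebra_isAlgebra.Build K env env_scaleAr.

Definition env_in (x : L) : env := env_pi (EGen x).

End EnvelopingAlgebra.

(* The homogeneous pieces of a grading.  That their sum is direct and         *)
(* exhausts U is not needed to form the completion, hence not required.       *)
Record pieces (K : fieldType) (U : algType K) := Pieces {
  piece :> nat -> set U;
  piece0 : forall n, piece n 0;
  pieceD : forall n x y, piece n x -> piece n y -> piece n (x + y);
  pieceZ : forall n a x, piece n x -> piece n (a *: x);
  piece1 : piece 0 1;
  pieceM : forall m n x y, piece m x -> piece n y -> piece (m + n) (x * y)
}.

(* Elements of the completion are formal series of homogeneous elements, one  *)
(* in each degree, i.e. elements of the product of all pieces.                *)
Record completion (K : fieldType) (U : algType K) (G : pieces U) := Completion {
  hcomp :> nat -> U;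
  hcompP : forall n, G n (hcomp n)
}.

HB.instance Definition _ (K : fieldType) (U : algType K) (G : pieces U) :=
  gen_eqMixin (completion G).
HB.instance Definition _ (K : fieldType) (U : algType K) (G : pieces U) :=
  gen_choiceMixin (completion G).

Section CompletionTheory.
Variables (K : fieldType) (U : algType K) (G : pieces U).
Local Notation C := (completion G).
Implicit Types (f g h : C) (a b : K).

Lemma completion_eq f g : (forall n, f n = g n) -> f = g.
Proof.
case: f g => [f Pf] [g Pg] /= fg; have E : f = g by apply/funext.
by case: _ / E Pg => Pg; congr Completion; apply: Prop_irrelevance.
Qed.

Lemma piece_sum (I : Type) (r : seq I) (P : pred I) (F : I -> U) n :
  (forall i, P i -> G n (F i)) -> G n (\sum_(i <- r | P i) F i).
Proof.
by move=> GF; elim/big_ind: _ => //; [apply: piece0|move=> *; apply: pieceD].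
Qed.

Definition czero : C := Completion (piece0 G).
Definition cadd f g : C :=
  Completion (fun n => pieceD (hcompP f n) (hcompP g n)).
Definition cscale a f : C := Completion (fun n => pieceZ a (hcompP f n)).

Fact cmul_subproof f g n : G n (\sum_(i < n.+1) f i * g (n - i)%N).
Proof.
apply: piece_sum => i _; rewrite -{1}(subnKC (leq_ord i)).
by apply: pieceM; apply: hcompP.
Qed.
Definition cmul f g : C := Completion (cmul_subproof f g).

Fact cone_subproof n : G n (if n == 0%N then 1 else 0).
Proof. by case: n => [|n] /=; [apply: piece1|apply: piece0]. Qed.
Definition cone : C := Completion cone_subproof.

Fact caddA : associative cadd.
Proof. by move=> f g h; apply/completion_eq => n /=; rewrite addrA. Qed.
Fact caddC : commutative cadd.
Proof. by move=> f g; apply/completion_eq => n /=; rewrite addrC. Qed.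
Fact cadd0 : left_id czero cadd.
Proof. by move=> f; apply/completion_eq => n /=; rewrite add0r. Qed.
Fact caddN : left_inverse czero (cscale (-1)) cadd.
Proof. by move=> f; apply/completion_eq => n /=; rewrite scaleN1r addNr. Qed.

HB.instance Definition _ := GRing.isZmodule.Build C caddA caddC cadd0 caddN.

Fact cscaleA a b f : cscale a (cscale b f) = cscale (a * b) f.
Proof. by apply/completion_eq => n /=; rewrite scalerA. Qed.
Fact cscale1 : left_id 1 cscale.
Proof. by move=> f; apply/completion_eq => n /=; rewrite scale1r. Qed.
Fact cscaleDr : right_distributive cscale cadd.
Proof. by move=> a f g; apply/completion_eq => n /=; rewrite scalerDr. Qed.
Fact cscaleDl f : {morph cscale^~ f : a b / a + b >-> cadd a b}.
Proof. by move=> a b; apply/completion_eq => n /=; rewrite scalerDl. Qed.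

HB.instance Definition _ := GRing.Zmodule_isLmodule.Build K C
  cscaleA cscale1 cscaleDr cscaleDl.

Fact cmul_rev f g n : cmul f g n = \sum_(i < n.+1) f (n - i)%N * g i.
Proof.
rewrite /= (reindex_inj rev_ord_inj) /=.
by apply: eq_bigr => i _; rewrite (sub_ordK i).
Qed.

Fact cmulA : associative cmul.
Proof.
move=> f g h; apply/completion_eq => n; rewrite [RHS]cmul_rev.
change (cmul f (cmul g h) n) with (\sum_(j < n.+1) f j * cmul g h (n - j)%N).
pose coef3 j k := f j * (g (n - j - k)%N * h k).
transitivity (\sum_(j < n.+1) \sum_(k < n.+1 | (k <= n - j)%N) coef3 j k).
  apply: eq_bigr => j _; rewrite cmul_rev big_distrr /=.
  by rewrite (big_ord_narrow_leq (leq_subr _ _)).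
rewrite (exchange_big_dep predT) //=; apply: eq_bigr => k _.
transitivity (\sum_(j < n.+1 | (j <= n - k)%N) coef3 j k).
  apply: eq_bigl => j; rewrite -ltnS -(ltnS j) -!subSn ?leq_ord //.
  by rewrite -subn_gt0 -(subn_gt0 j) -!subnDA addnC.
rewrite (big_ord_narrow_leq (leq_subr _ _)) big_distrl /=.
by apply: eq_bigr => j _; rewrite /coef3 -!subnDA addnC mulrA.
Qed.
Fact cmul1x : left_id cone cmul.
Proof.
move=> f; apply/completion_eq => n /=; rewrite big_ord_recl /= mul1r subn0.
by rewrite big1 ?addr0 // => i _; rewrite mul0r.
Qed.
Fact cmulx1 : right_id cone cmul.
Proof.
move=> f; apply/completion_eq => n; rewrite cmul_rev /=.
rewrite big_ord_recl /= mulr1 subn0.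
by rewrite big1 ?addr0 // => i _; rewrite mulr0.
Qed.
Fact cmulDl : left_distributive cmul cadd.
Proof.
move=> f g h; apply/completion_eq => n /=; rewrite -big_split /=.
by apply: eq_bigr => i _; rewrite mulrDl.
Qed.
Fact cmulDr : right_distributive cmul cadd.
Proof.
move=> f g h; apply/completion_eq => n /=; rewrite -big_split /=.
by apply: eq_bigr => i _; rewrite mulrDr.
Qed.
Fact c1neq0 : cone != czero.
Proof.
apply/eqP => /(congr1 (fun f : C => f 0%N)) /= /eqP.
by rewrite (negPf (oner_neq0 U)).
Qed.

HB.instance Definition _ := GRing.Zmodule_isNzRing.Build C
  cmulA cmul1x cmulx1 cmulDl cmulDr c1neq0.

Fact cscaleAl a f g : cscale a (cmul f g) = cmul (cscale a f) g.
Proof.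
apply/completion_eq => n /=; rewrite scaler_sumr.
by apply: eq_bigr => i _; rewrite scalerAl.
Qed.
Fact cscaleAr a f g : cscale a (cmul f g) = cmul f (cscale a g).
Proof.
apply/completion_eq => n /=; rewrite scaler_sumr.
by apply: eq_bigr => i _; rewrite scalerAr.
Qed.

HB.instance Definition _ := GRing.Lmodule_isLalgebra.Build K C cscaleAl.
HB.instance Definition _ := GRing.Lalgebra_isAlgebra.Build K C cscaleAr.

Lemma hcompM f g n : (f * g) n = \sum_(i < n.+1) f i * g (n - i)%N.
Proof. by []. Qed.

Lemma hcomp_sum (I : Type) (r : seq I) (P : pred I) (F : I -> C) n :
  (\sum_(i <- r | P i) F i) n = \sum_(i <- r | P i) F i n.
Proof. exact: (big_morph (fun f : C => f n)). Qed.

Lemma hcompX_small f k n : f 0%N = 0 -> (n < k)%N -> (f ^+ k) n = 0.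
Proof.
move=> f0; elim: k n => // k IHk n ltnk; rewrite exprS hcompM.
rewrite big_ord_recl f0 mul0r add0r big1 // => i _; rewrite IHk ?mulr0 //.
by rewrite /= /bump /= add1n; have := ltn_ord i; case: n ltnk i => // n *;
   rewrite subSS (leq_ltn_trans (leq_subr _ _)).
Qed.

Fact homog_subproof d x : G d x -> forall n, G n (if n == d then x else 0).
Proof. by move=> Gx n; case: eqP => [->|_] //; apply: piece0. Qed.
Definition homog d x (Gx : G d x) : C := Completion (homog_subproof Gx).

End CompletionTheory.

Section Exponential.
Variables (K : numFieldType) (U : algType K) (G : pieces U).
Local Notation C := (completion G).
Implicit Types f g : C.

(* exp f, for f without constant term: f ^+ k has no component of degree < k, *)
(* so that the terms with k <= n determine the component of degree n.         *)
Fact cexp_subproof f n :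
  G n (\sum_(k < n.+1) (k`!%:R)^-1 *: (f ^+ k) n).
Proof. by apply: piece_sum => k _; apply/pieceZ/hcompP. Qed.
Definition cexp f : C := Completion (cexp_subproof f).

Let expp (N : nat) : {poly K} := \poly_(k < N) (k`!%:R)^-1.
Let exppN (N : nat) : {poly K} := \poly_(k < N) ((-1) ^+ k * (k`!%:R)^-1).

Let horner_alg_poly f N (E : nat -> K) :
  horner_alg f (\poly_(k < N) E k) = \sum_(k < N) E k *: f ^+ k.
Proof.
rewrite poly_def rmorph_sum /=; apply: eq_bigr => k _.
by rewrite linearZ rmorphXn /= horner_algX mulr_algl.
Qed.

Let cexp_expp f n N : f 0%N = 0 -> (n < N)%N ->
  cexp f n = (horner_alg f (expp N)) n.
Proof.
move=> f0 nN; rewrite /expp horner_alg_poly hcomp_sum.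
rewrite [RHS](bigID (fun k : 'I_N => (k < n.+1)%N)) /=.
rewrite [X in _ + X]big1 ?addr0; last first.
  by move=> k; rewrite -leqNgt => nk; rewrite hcompX_small ?scaler0.
by rewrite (big_ord_narrow nN).
Qed.

Let horner_alg_expN f N : horner_alg (- f) (expp N) = horner_alg f (exppN N).
Proof.
rewrite !horner_alg_poly; apply: eq_bigr => k _.
by rewrite -scaleN1r exprZn scalerA mulrC.
Qed.

Let expp_mulN N s : (s < N)%N -> (expp N * exppN N)`_s = (s == 0%N)%:R.
Proof.
move=> sN; rewrite coefMr.
have factN0 k : (k`!%:R : K) != 0 by rewrite pnatr_eq0 -lt0n fact_gt0.
apply: (mulfI (factN0 s)); rewrite mulr_sumr.
transitivity ((1 - 1 : K) ^+ s).
  rewrite exprBn; apply: eq_bigr => i _; rewrite !coef_poly.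
  rewrite (leq_ltn_trans (leq_ord i) sN) (leq_ltn_trans (leq_subr _ _) sN).
  rewrite !expr1n !mulr1 -(bin_fact (leq_ord i)) !natrM -mulr_natr.
  have := (factN0 i); have := (factN0 (s - i)%N); move: (_`!%:R) (_`!%:R).
  move=> a b b0 a0; rewrite mul1r -[RHS]mulr_natl -!mulrA; congr (_ * _).
  by rewrite mulVKf // mulrCA mulfV // mulr1.
by rewrite subrr expr0n; case: s {sN} => [|s]; rewrite ?fact0 ?mulr1 ?mulr0.
Qed.

Lemma cexpxN f : f 0%N = 0 -> cexp f * cexp (- f) = 1.
Proof.
move=> f0; apply/completion_eq => n.
have fN0 : (- f) 0%N = 0 by rewrite /= f0 scaler0.
transitivity ((horner_alg f (expp n.+1 * exppN n.+1)) n).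
  transitivity ((horner_alg f (expp n.+1) * horner_alg (- f) (expp n.+1)) n).
    rewrite !hcompM; apply: eq_bigr => i _.
    by rewrite -!cexp_expp // ?ltnS ?leq_subr ?leq_ord.
  by rewrite horner_alg_expN [in RHS]rmorphM.
set p := expp _ * _; rewrite -[p]coefK horner_alg_poly hcomp_sum.
have termE (k : nat) : (p`_k *: f ^+ k) n = if k == 0%N then (1 : C) n else 0.
  have [nk|kn] := ltnP n k; first by rewrite /= hcompX_small // scaler0; case: k nk.
  rewrite expp_mulN ?ltnS //; case: k {kn} => [|k]; first by rewrite scale1r.
  by rewrite scale0r.
under eq_bigr do rewrite termE.
case Ep: (size p) => [|m]; last by rewrite big_ord_recl big1 ?addr0.
have := expp_mulN (ltn0Sn n); rewrite -/p nth_default ?Ep //= => /esym/eqP.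
by rewrite oner_eq0.
Qed.

End Exponential.

Record units (R : pzRingType) := Units {
  uval :> R;
  uinv : R;
  uvalV : uval * uinv = 1;
  uVval : uinv * uval = 1
}.

HB.instance Definition _ (R : pzRingType) := gen_eqMixin (units R).
HB.instance Definition _ (R : pzRingType) := gen_choiceMixin (units R).

Section UnitGroup.
Variable R : pzRingType.
Implicit Types u v w : units R.

Lemma units_eq u v : uval u = uval v -> u = v.
Proof.
case: u v => [u u' uV Vu] [v v' vV Vv] /= uv; subst v.
have E : u' = v' by rewrite -[u']mulr1 -vV mulrA Vu mul1r.
by subst v'; congr Units; apply: Prop_irrelevance.
Qed.

Definition units_one : units R := Units (mulr1 1) (mulr1 1).
Definition units_inv u : units R := Units (uVval u) (uvalV u).

Fact units_mul_subproof1 u v : uval u * uval v * (uinv v * uinv u) = 1.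
Proof. by rewrite mulrA -(mulrA _ _ (uinv v)) uvalV mulr1 uvalV. Qed.
Fact units_mul_subproof2 u v : uinv v * uinv u * (uval u * uval v) = 1.
Proof. by rewrite mulrA -(mulrA _ _ (uval u)) uVval mulr1 uVval. Qed.
Definition units_mul u v : units R :=
  Units (units_mul_subproof1 u v) (units_mul_subproof2 u v).

Fact units_mulA : associative units_mul.
Proof. by move=> u v w; apply/units_eq; rewrite /= mulrA. Qed.
Fact units_mul1 : left_id units_one units_mul.
Proof. by move=> u; apply/units_eq; rewrite /= mul1r. Qed.
Fact units_1mul : right_id units_one units_mul.
Proof. by move=> u; apply/units_eq; rewrite /= mulr1. Qed.
Fact units_mulV : left_inverse units_one units_inv units_mul.
Proof. by move=> u; apply/units_eq; rewrite /= uVval. Qed.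
Fact units_Vmul : right_inverse units_one units_inv units_mul.
Proof. by move=> u; apply/units_eq; rewrite /= uvalV. Qed.

HB.instance Definition _ := isGroup.Build (units R)
  units_mulA units_mul1 units_1mul units_mulV units_Vmul.

End UnitGroup.

Section GeneratedSubgroup.
Local Open Scope group_scope.
Variables (G : groupType) (S : set G).

Inductive gen : G -> Prop :=
| gen_in x : S x -> gen x
| gen_1 : gen 1
| gen_M x y : gen x -> gen y -> gen (x * y)
| gen_V x : gen x -> gen x^-1.

Definition genp : {pred G} := fun x => `[< gen x >].

Record gen_group := GenGroup { gen_val :> G; gen_valP : gen_val \in genp }.

HB.instance Definition _ := [isSub for gen_val].
HB.instance Definition _ := [Choice of gen_group by <:].

Fact genp_closed : group_closed genp.
Proof.
split=> [|x y /asboolP gx /asboolP gy]; first exact/asboolP/gen_1.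
exact/asboolP/gen_M/gen_V.
Qed.

HB.instance Definition _ := SubChoice_isSubGroup.Build G genp gen_group genp_closed.

End GeneratedSubgroup.

Lemma gen_mono (G : groupType) (S T : set G) :
  (S `<=` T)%classic -> (gen S `<=` gen T)%classic.
Proof.
move=> ST x; elim=> {x} [x /ST|||].
- exact: gen_in.
- exact: gen_1.
- by move=> x y _ gx _ gy; apply: gen_M.
- by move=> x _ gx; apply: gen_V.
Qed.

Section LowerCentralSeries.
Local Open Scope group_scope.
Variable H : groupType.

Definition commutator (A B : set H) : set H :=
  gen [set z | exists2 x, A x & exists2 y, B y & z = [~ x, y]]%classic.

(* lcs n is gamma_n, numbered from gamma_1 = H; lcs 0 = H is a convention.    *)
Definition lcs (n : nat) : set H :=
  iter n.-1 (commutator [set: H]%classic) [set: H]%classic.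

Lemma lcsS n : lcs n.+2 = commutator [set: H]%classic (lcs n.+1).
Proof. by []. Qed.

Lemma lcs_sub n : (lcs n.+1 `<=` lcs n)%classic.
Proof.
case: n => [|n]; first by [].
elim: n => [|n IHn]; first by [].
rewrite !lcsS; apply: gen_mono => z [x Hx [y /IHn Hy ->]].
by exists x => //; exists y.
Qed.

Definition lcs_coset (n : nat) (x : H) : set H :=
  [set y | lcs n (x^-1 * y)]%classic.

(* The inverse limit of the H / lcs n.  A coset of lcs n.+1 lies over the     *)
(* unique coset of lcs n which contains it.                                   *)
Record hausdorff_completion := HausdorffCompletion {
  hcoset :> nat -> set H;
  hcosetP : forall n, exists x, hcoset n = lcs_coset n x;
  hcoset_compat : forall n, (hcoset n.+1 `<=` hcoset n)%classic
}.

Fact to_completion_subproof1 x n : exists y, lcs_coset n x = lcs_coset n y.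
Proof. by exists x. Qed.
Fact to_completion_subproof2 x n :
  (lcs_coset n.+1 x `<=` lcs_coset n x)%classic.
Proof. by move=> y; apply: lcs_sub. Qed.

Definition to_completion (x : H) : hausdorff_completion :=
  HausdorffCompletion (@to_completion_subproof1 x) (@to_completion_subproof2 x).

Section OrderedProduct.
Variables (d : Order.disp_t) (B : orderType d).

Definition initial_segment (P : pred B) (s : seq B) : Prop :=
  [/\ sorted <%O s, all P s &
      forall x y, x \in s -> P y -> (y <= x)%O -> y \in s].

(* The product of the u x, x in P, taken in increasing order, converges to l  *)
(* in the completion: for each n, the products over the sufficiently large    *)
(* finite initial segments of P have the same image as l in H / lcs n.  This  *)
(* is the usual notion when P has only finitely many elements below any given *)
(* one.                                                                       *)
Definition ordered_prod_is (P : pred B) (u : B -> H)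
    (l : hausdorff_completion) : Prop :=
  forall n, exists2 s0, initial_segment P s0 &
    forall s, initial_segment P s -> {subset s0 <= s} ->
      to_completion (\prod_(x <- s) u x) n = l n.

End OrderedProduct.
End LowerCentralSeries.

(* Generalised Cartan matrices. *)
Definition gcm (r : nat) (A : 'M[int]_r) : Prop :=
  [/\ forall i, A i i = 2,
      forall i j, i != j -> A i j <= 0 &
      forall i j, A i j = 0 <-> A j i = 0].

Section RealRoots.
Variables (r : nat) (A : 'M[int]_r).

(* The root lattice Q is 'cV[int]_r, with basis the simple roots. *)
Definition simple_root (i : 'I_r) : 'cV[int]_r := delta_mx i 0.

(* The column j is s_i(alpha_j) = alpha_j - a_ij alpha_i. *)
Definition simple_refl (i : 'I_r) : 'M[int]_r :=
  \matrix_(k, j) ((k == j)%:R - A i j * (k == i)%:R).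

Definition weyl : set (units 'M[int]_r) :=
  gen [set w | exists i, uval w = simple_refl i]%classic.

Definition spherical : Prop := finite_set weyl.

Definition real_root (alpha : 'cV[int]_r) : Prop :=
  exists2 w, weyl w & exists i, alpha = uval w *m simple_root i.

Definition pos_real_root (alpha : 'cV[int]_r) : Prop :=
  real_root alpha /\ forall i, 0 <= alpha i 0.

Definition ht (alpha : 'cV[int]_r) : int := \sum_i alpha i 0.

End RealRoots.

Definition principal_submx (r : nat) (A : 'M[int]_r) (J : {set 'I_r}) :
    'M[int]_#|J| :=
  \matrix_(i, j) A (enum_val i) (enum_val j).

Definition two_spherical (r : nat) (A : 'M[int]_r) : Prop :=
  forall J : {set 'I_r}, (#|J| <= 2)%N -> spherical (principal_submx A J).

Section KacMoody.
Variables (r : nat) (A : 'M[int]_r).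

Definition serre : set (lie_term rat 'I_r) :=
  [set t | exists i j, i != j /\
     t = iter `|1 - A i j|%N (LLie (LGen i)) (LGen j)]%classic.

Definition nplus : lieAlgType rat := lie_pres serre.
Definition nplus_e (i : 'I_r) : nplus := lie_gen serre i.

(* The smallest family of subspaces compatible with the bracket and with e_i  *)
(* in degree alpha_i: the relators being homogeneous, these are the           *)
(* components of the grading with deg e_i = alpha_i (zero outside Q_+).       *)
Inductive root_space : 'cV[int]_r -> nplus -> Prop :=
| root_space_e i : root_space (simple_root i) (nplus_e i)
| root_space_lie alpha beta x y : root_space alpha x -> root_space beta y ->
    root_space (alpha + beta) (lie x y)
| root_space_0 alpha : root_space alpha 0
| root_spaceD alpha x y :
    root_space alpha x -> root_space alpha y -> root_space alpha (x + y)
| root_spaceZ alpha a x : root_space alpha x -> root_space alpha (a *: x).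

Inductive env_height : nat -> env nplus -> Prop :=
| env_height_in alpha n x : root_space alpha x -> ht alpha = n%:Z ->
    env_height n (env_in x)
| env_height_1 : env_height 0 1
| env_heightM m n x y :
    env_height m x -> env_height n y -> env_height (m + n) (x * y)
| env_height_0 n : env_height n 0
| env_heightD n x y : env_height n x -> env_height n y -> env_height n (x + y)
| env_heightZ n a x : env_height n x -> env_height n (a *: x).

Definition height_pieces : pieces (env nplus) :=
  Pieces env_height_0 env_heightD env_heightZ env_height_1 env_heightM.

Definition env_hat := completion height_pieces.
HB.instance Definition _ := GRing.Algebra.on env_hat.

Definition root_group (alpha : 'cV[int]_r) : set (units env_hat) :=
  [set u | exists n x (hx : height_pieces n (env_in x)),
     [/\ root_space alpha x, ht alpha = n%:Z &
         uval u = cexp (homog hx)]]%classic.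

(* The positive unipotent subgroup of the minimal Kac-Moody group of simply   *)
(* connected type A over rat, in its standard realisation inside the units of *)
(* the completed enveloping algebra of nplus.                                 *)
Definition uplus : groupType :=
  gen_group [set u | exists2 alpha, pos_real_root A alpha
                                  & root_group alpha u]%classic.

Lemma ht_simple_root (i : 'I_r) : ht (simple_root i) = 1%N%:Z.
Proof.
rewrite /ht (bigD1 i) //= big1 ?addr0 ?mxE ?eqxx // => j ji.
by rewrite mxE (negPf ji).
Qed.

Fact simple_height i (a : rat) : height_pieces 1 (env_in (a *: nplus_e i)).
Proof.
exact: env_height_in (root_spaceZ a (root_space_e i)) (ht_simple_root i).
Qed.

Fact simple_exp_subproof1 i a :
  cexp (homog (simple_height i a)) * cexp (- homog (simple_height i a)) = 1.
Proof. exact: cexpxN. Qed.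
Fact simple_exp_subproof2 i a :
  cexp (- homog (simple_height i a)) * cexp (homog (simple_height i a)) = 1.
Proof.
by rewrite -{2}[homog _]opprK cexpxN //= scaler0.
Qed.

Definition simple_exp i a : units env_hat :=
  Units (simple_exp_subproof1 i a) (simple_exp_subproof2 i a).

Lemma simple_root_pos i : pos_real_root A (simple_root i).
Proof.
split; last by move=> j; rewrite mxE; case: andP.
exists 1%g; first exact: gen_1.
by exists i; rewrite /= mul1mx.
Qed.

Fact uplus_x_subproof i a :
  simple_exp i a \in genp [set u | exists2 alpha, pos_real_root A alpha
                                  & root_group alpha u]%classic.
Proof.
apply/asboolP/gen_in; exists (simple_root i); first exact: simple_root_pos.
exists 1%N, (a *: nplus_e i), (simple_height i a); split=> //.
- exact/root_spaceZ/root_space_e.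
- exact: ht_simple_root.
Qed.

Definition uplus_x (i : 'I_r) (a : rat) : uplus := GenGroup (uplus_x_subproof i a).

(* The pair (i, s) stands for the nonempty word i :: s. *)
Definition nested_lie (w : 'I_r * seq 'I_r) : nplus :=
  rnormed lie (nplus_e w.1) [seq nplus_e j | j <- w.2].

Definition nested_comm (w : 'I_r * seq 'I_r) (a : rat) : uplus :=
  rnormed commg (uplus_x w.1 a) [seq uplus_x j 1 | j <- w.2].

End KacMoody.

Definition word_length (T : Type) (w : T * seq T) : nat := (size w.2).+1.

Definition is_basis (K : fieldType) (V : lmodType K) (T : choiceType)
    (b : T -> V) : Prop :=
  (forall (s : seq T) (c : T -> K), uniq s ->
     \sum_(t <- s) c t *: b t = 0 -> {in s, forall t, c t = 0}) /\
  (forall x, exists (s : seq T) (c : T -> K), x = \sum_(t <- s) c t *: b t).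

(* Main.v *)
Require Import Defs.
From HB Require Import structures.
From mathcomp Require Import all_boot all_order all_algebra.
From mathcomp Require Import boolp classical_sets cardinality.
From mathcomp Require Import ring zify.

(* An element g of the completion with constant term 1 is of Lie type for a  *)
(* graded Lie subalgebra m if its logarithmic derivative g^-1 * deg g lies   *)
(* in the completion of m, where deg multiplies the component of degree n by *)
(* n.  Such elements form a group, and their leading terms lie in m; this    *)
(* replaces the Baker-Campbell-Hausdorff formula.  If m vanishes in large    *)
(* degrees, every element of Lie type is therefore a finite product of       *)
(* iterated commutators of exponentials of the generators of m.              *)
(*                                                                           *)
(* Applied to the rank 2 subalgebras of nplus, which are nilpotent because A *)
(* is 2-spherical, and to their images under Weyl group operators, this      *)
(* shows that uplus is generated by the exp (a e_i), and that the Serre      *)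
(* relations hold in the Lie ring of its lower central series.  Hence that   *)
(* ring receives a surjection from nplus, and taking leading terms in the    *)
(* enveloping algebra shows that the surjection is bijective: the            *)
(* u_x(lambda) with n_x = n parametrise gamma_n / gamma_(n+1), and lambda is *)
(* obtained one degree at a time.                                            *)

Set Implicit Arguments.
Unset Strict Implicit.
Unset Printing Implicit Defensive.

Import Order.TTheory GRing.Theory Num.Theory.
Local Open Scope ring_scope.

(** * Lie words and graded spans *)

(** Let gamma_n be the lower central series of [uplus A]. The normal form amounts to an isomorphism
    in each degree between the height n part of [nplus A] and gamma_n / gamma_(n+1), under which the
    class of u_x(lambda) corresponds to lambda x. Granted this, g is peeled from the left: an
    element of gamma_n is divided by the unique product over the basis words of length n that leaves
    it in gamma_(n+1) ([remainder]). The tail products converge to the successive remainders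
    ([above_remainder]), and two convergent products are compared one level at a time
    ([strip_unique]).

    Injectivity is read off in the completed enveloping algebra. The leading term of a group
    commutator is the commutator of the leading terms ([comm_low]); so elements of gamma_n are 1 up
    to degree n - 1 ([lcs_low]), and u_x(lambda) has the term lambda x in degree n_x
    ([word_commg_lead]). The graded pieces of [nplus A] embed into the enveloping algebra by means
    of an explicit representation ([env_in_der], [words_of_height_inj]), whence [level_unique].

    Surjectivity ([level_exists_coef]) rests on two facts about the group: the simple root groups
    generate it ([uplus_gen]), so classes of iterated commutators span each quotient
    ([gr_class_span]); and the iterated commutator of a Serre word falls one step deeper in the
    lower central series than its length predicts ([serre_relation]). Linear relations between Lie
    words then pass to the classes of the group commutators ([word_commg_relation]). The quotients
    are not known beforehand to be rational vector spaces, so the Lie algebra is made to act on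
    families of additive maps from [rat], as in the Dynkin-Specht-Wever argument.

    Both facts use 2-sphericity through the nilpotency of rank 2 subalgebras ([two_spherical_nil]):
    a unit of Lie type for a nilpotent graded algebra is a finite product of iterated commutators of
    the exponentials of the generators ([lie_unit_exhaust]). For the Serre words the algebra is
    generated by e_i and e_j. For generation, the action of f_k on [nplus A] is constructed
    ([lowering_exists]), and the reflection operators exp(e_k) exp(-f_k) exp(e_k) show that the root
    space of a non-simple positive real root lies in a nilpotent algebra generated by two real root
    vectors reached by fewer reflections ([root_path_spanned]). *)

Section LinearSpan.
Variables (K : pzRingType) (V : lmodType K).

Inductive lspan (S : set V) : V -> Prop :=
| lspan_in x : S x -> lspan S x
| lspan0 : lspan S 0
| lspanD x y : lspan S x -> lspan S y -> lspan S (x + y)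
| lspanZ a x : lspan S x -> lspan S (a *: x).

Lemma lspanN S x : lspan S x -> lspan S (- x).
Proof. by rewrite -scaleN1r; apply: lspanZ. Qed.

Lemma lspanB S x y : lspan S x -> lspan S y -> lspan S (x - y).
Proof. by move=> Sx /lspanN; apply: lspanD. Qed.

Lemma lspan_sum S (I : eqType) (s : seq I) (P : pred I) (F : I -> V) :
  (forall i, i \in s -> P i -> lspan S (F i)) -> lspan S (\sum_(i <- s | P i) F i).
Proof.
move=> SF; rewrite big_seq_cond; elim/big_ind: _.
- exact: lspan0.
- exact: lspanD.
- by move=> i /andP[]; apply: SF.
Qed.

Lemma lspan_sub (S : set V) (T : V -> Prop) : (forall x, S x -> T x) -> T 0 ->
  (forall x y, T x -> T y -> T (x + y)) -> (forall a x, T x -> T (a *: x)) ->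
  forall x, lspan S x -> T x.
Proof. by move=> ST T0 TD TZ x; elim=> {x}; auto. Qed.

Lemma lspan_mono (S T : set V) : (forall x, S x -> T x) ->
  forall x, lspan S x -> lspan T x.
Proof.
move=> ST; apply: lspan_sub => [x /ST||x y|a x]; first exact: lspan_in.
- exact: lspan0.
- exact: lspanD.
- exact: lspanZ.
Qed.

End LinearSpan.

Lemma lspan_linear (K : pzRingType) (V W : lmodType K) (f : {linear V -> W})
    (S : set V) (T : W -> Prop) : (forall x, S x -> T (f x)) -> T 0 ->
  (forall x y, T x -> T y -> T (x + y)) -> (forall a x, T x -> T (a *: x)) ->
  forall x, lspan S x -> T (f x).
Proof.
move=> ST T0 TD TZ; apply: lspan_sub => // [|x y Tx Ty|a x Tx].
- by rewrite linear0.
- by rewrite linearD; apply: TD.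
- by rewrite linearZ; apply: TZ.
Qed.

Section LieBasics.
Variables (K : pzRingType) (L : lieAlgType K).
Implicit Types x y z : L.

Fact lie_is_linear x : linear (lie x).
Proof. by move=> a y z; rewrite lieDr lieZr. Qed.
HB.instance Definition _ x := GRing.isLinear.Build K L L _ (lie x) (lie_is_linear x).

Lemma lie0l y : lie (0 : L) y = 0.
Proof. by have := lieZl 0 (0 : L) y; rewrite !scale0r. Qed.
Lemma lie0r x : lie x (0 : L) = 0. Proof. exact: linear0. Qed.
Lemma lieNl x y : lie (- x) y = - lie x y.
Proof. by rewrite -!scaleN1r lieZl. Qed.
Lemma lieNr x y : lie x (- y) = - lie x y.
Proof. exact: linearN. Qed.
Lemma lieC x y : lie x y = - lie y x.
Proof.
apply/eqP; rewrite -addr_eq0; apply/eqP.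
by have := liexx (x + y); rewrite lieDl !lieDr !liexx add0r addr0.
Qed.

Lemma lie_der x y z : lie x (lie y z) = lie (lie x y) z + lie y (lie x z).
Proof.
have := jacobi x y z; rewrite [lie z (lie x y)]lieC [lie z x]lieC lieNr => /eqP.
by rewrite -addrA -opprD subr_eq0 addrC => /eqP.
Qed.

Lemma lie_suml (I : Type) (s : seq I) (P : pred I) (F : I -> L) y :
  lie (\sum_(i <- s | P i) F i) y = \sum_(i <- s | P i) lie (F i) y.
Proof.
by apply: (big_morph (fun x => lie x y)) => [a b|]; rewrite ?lieDl ?lie0l.
Qed.

End LieBasics.

Section Words.
Variables (K : pzRingType) (L : lieAlgType K) (T : eqType) (a : T -> L).

Definition lie_word (w : T * seq T) : L := rnormed lie (a w.1) (map a w.2).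

Definition letters (w : T * seq T) : seq T := w.1 :: w.2.

Lemma lie_word1 t : lie_word (t, [::]) = a t. Proof. by []. Qed.
Lemma lie_wordS t u s :
  lie_word (t, u :: s) = lie (a t) (lie_word (u, s)).
Proof. by []. Qed.

Lemma word_ind (P : T * seq T -> Prop) :
  (forall t, P (t, [::])) -> (forall t u s, P (u, s) -> P (t, u :: s)) ->
  forall w, P w.
Proof.
move=> P1 PS [t s]; elim: s t => [|u s IHs] t; first exact: P1.
exact/PS/IHs.
Qed.

(** Induction on the first word: the Jacobi identity rewrites [[b,y],z] as [b,[y,z]] - [y,[b,z]],
    which takes one letter b off the left factor and only permutes the letters. *)
Lemma lie_word_lie v w : lspan
  (lie_word @` [set u | perm_eq (letters u) (letters v ++ letters w)])%classic
  (lie (lie_word v) (lie_word w)).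
Proof.
move: v w; apply: word_ind => [t|t u s IHs] [x m].
  by apply: lspan_in; exists (t, x :: m) => //=; apply: perm_refl.
rewrite lie_wordS.
have -> : forall b y z : L, lie (lie b y) z = lie b (lie y z) - lie y (lie b z).
  by move=> b y z; rewrite (lie_der b) addrK.
apply: lspanB.
  apply: lspan_linear (IHs (x, m)); try by [exact: lspan0|exact: lspanD|exact: lspanZ].
  move=> _ [[t' s'] us' <-]; apply: lspan_in; exists (t, t' :: s') => //.
  by rewrite /letters /= perm_cons.
apply: lspan_mono (IHs (t, x :: m)) => _ [v pv <-]; exists v => //.
apply: (perm_trans pv).
by have /permPl -> := perm_catCA (u :: s) [:: t] (x :: m).
Qed.

(** Turns any additive invariant of the multiset of letters, such as content or total height, into a
    Lie algebra grading of the span of words. *)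
Lemma lie_span_lie (P Q R : set (T * seq T)) :
  (forall u v w, P v -> Q w -> perm_eq (letters u) (letters v ++ letters w) -> R u) ->
  forall x y, lspan (lie_word @` P)%classic x -> lspan (lie_word @` Q)%classic y ->
    lspan (lie_word @` R)%classic (lie x y).
Proof.
move=> PQR x y Px Qy; move: y Qy x Px.
have base v y : P v -> lspan (lie_word @` Q)%classic y ->
    lspan (lie_word @` R)%classic (lie (lie_word v) y).
  move=> Pv; move: y; apply: lspan_linear; try by [exact: lspan0|exact: lspanD|exact: lspanZ].
  move=> _ [w Qw <-]; apply: lspan_mono (lie_word_lie v w) => _ [u uvw <-].
  by exists u => //; apply: PQR uvw.
move=> y Qy; apply: lspan_sub => [_ [v Pv <-]||x z Rx Rz|b x Rx].
- exact: base.
- by rewrite lie0l; apply: lspan0.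
- by rewrite lieDl; apply: lspanD.
- by rewrite lieZl; apply: lspanZ.
Qed.

End Words.

Section EigenIndependence.
Variables (K : fieldType) (V : lmodType K) (h : {linear V -> V}).
Variables (J : eqType) (a : J -> K) (S : J -> V -> Prop).
Hypothesis a_inj : injective a.
Hypothesis S0 : forall j, S j 0.
Hypothesis SD : forall j x y, S j x -> S j y -> S j (x + y).
Hypothesis SZ : forall j b x, S j x -> S j (b *: x).
Hypothesis hS : forall j x, S j x -> h x = a j *: x.

(** The operator h - a_i removes the term of index i and multiplies the others by the nonzero
    factors a_j - a_i, so the support shrinks. *)
Lemma eigen_free (s : seq J) (f : J -> V) : uniq s ->
  (forall j, S j (f j)) -> \sum_(j <- s) f j = 0 -> {in s, forall j, f j = 0}.
Proof.
elim: s f => [|i s IHs] f //= /andP[nis us] Sf; rewrite big_cons => f0.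
have fs0 : {in s, forall j, f j = 0}.
  move=> j js; pose g j := (a j - a i) *: f j.
  have /IHs : forall j, S j (g j) by move=> ?; apply/SZ/Sf.
  move/(_ us); have -> : \sum_(j <- s) g j = 0.
    transitivity (h (f i + \sum_(j <- s) f j) - a i *: (f i + \sum_(j <- s) f j)).
      rewrite linearD scalerDr (hS (Sf i)) opprD addrACA subrr add0r.
      rewrite linear_sum scaler_sumr -sumrB; apply: eq_bigr => k _.
      by rewrite (hS (Sf k)) -scalerBl.
    by rewrite f0 linear0 scaler0 subr0.
  move/(_ erefl _ js)/eqP; rewrite scaler_eq0 subr_eq0.
  by case/orP=> [/eqP/a_inj ji|/eqP//]; move: nis; rewrite -ji js.
move=> j; rewrite inE => /orP[/eqP ->|/fs0//].
by move: f0; rewrite big_seq big1 ?addr0.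
Qed.

Lemma eigen_decomp x : lspan [set y | exists j, S j y]%classic x ->
  exists (s : seq J) (f : J -> V), [/\ uniq s, forall j, S j (f j),
    forall j, j \notin s -> f j = 0 & x = \sum_(j <- s) f j].
Proof.
elim=> {x} [x [j Sx]||x y _ [s [f [us Sf f0 ->]]] _ [t [g [ut Sg g0 ->]]]|].
- exists [:: j], (fun i => if i == j then x else 0); split=> //.
  + by move=> i; case: eqP => [->|].
  + by move=> i; rewrite inE => /negPf ->.
  + by rewrite big_seq1 eqxx.
- by exists [::], (fun=> 0); split=> //; rewrite big_nil.
- exists (undup (s ++ t)), (fun j => f j + g j); split.
  + exact: undup_uniq.
  + by move=> j; apply: SD.
  + move=> j; rewrite mem_undup mem_cat negb_or => /andP[/f0 -> /g0 ->].
    by rewrite addr0.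
  + have ext (r : seq J) (k : J -> V) : uniq r -> (forall j, j \notin r -> k j = 0) ->
        {subset r <= s ++ t} -> \sum_(j <- r) k j = \sum_(j <- undup (s ++ t)) k j.
      move=> ur k0 rst; rewrite [RHS](bigID (mem r)) /= [X in _ = _ + X]big1 ?addr0 //.
      rewrite -[RHS]big_filter; apply: perm_big; apply: uniq_perm => //.
        by rewrite filter_uniq ?undup_uniq.
      move=> j; rewrite mem_filter mem_undup; case jr: (j \in r) => //.
      by rewrite rst.
    rewrite big_split /= -(ext s) // -?(ext t) // => j.
      by rewrite mem_cat => ->; rewrite orbT.
    by rewrite mem_cat => ->.
- move=> b x _ [s [f [us Sf f0 ->]]]; exists s, (fun j => b *: f j); split=> //.
  + by move=> j; apply: SZ.
  + by move=> j /f0 ->; rewrite scaler0.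
  + by rewrite scaler_sumr.
Qed.

Lemma eigen_component (s : seq J) (f : J -> V) j0 : uniq s ->
  (forall j, S j (f j)) -> (forall j, j \notin s -> f j = 0) ->
  h (\sum_(j <- s) f j) = a j0 *: \sum_(j <- s) f j -> \sum_(j <- s) f j = f j0.
Proof.
move=> us Sf f0 hf.
pose g j := (a j - a j0) *: f j.
have g0 : {in s, forall j, g j = 0}.
  apply: eigen_free => // [j|]; first exact/SZ/Sf.
  transitivity (h (\sum_(j <- s) f j) - a j0 *: \sum_(j <- s) f j).
    rewrite linear_sum scaler_sumr -sumrB; apply: eq_bigr => k _.
    by rewrite (hS (Sf k)) -scalerBl.
  by rewrite hf subrr.
have {g0} fz j : j != j0 -> f j = 0.
  move=> jj0; case js: (j \in s); last by apply: f0; rewrite js.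
  have /eqP := g0 j js; rewrite scaler_eq0 subr_eq0 (inj_eq a_inj) (negPf jj0).
  by move/eqP.
case j0s: (j0 \in s); last first.
  rewrite f0 ?j0s // big_seq big1 // => j js; apply: fz.
  by apply/eqP => jj0; rewrite -jj0 js in j0s.
by rewrite (bigD1_seq j0) //= big1 ?addr0.
Qed.

(** Stands in for a projection onto a graded piece: to lie in a piece it suffices to lie in the sum
    of all pieces and to have the right eigenvalue. *)
Lemma eigen_in x j0 : lspan [set y | exists j, S j y]%classic x ->
  h x = a j0 *: x -> S j0 x.
Proof.
move=> /eigen_decomp[s [f [us Sf f0 ->]]] hx.
by rewrite (eigen_component us Sf f0 hx).
Qed.

End EigenIndependence.

(** * Deciding identities between linear combinations *)

Section ModuleIdentities.
Variables (K : comNzRingType) (V : lmodType K).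

(* Reified module expressions: an identity between them reduces to the *)
(* equality of the coefficients of each atom, which [ring] decides.    *)
Inductive mexp := MAtom of nat | MZero | MAdd of mexp & mexp | MOpp of mexp
  | MScale of K & mexp.

Fixpoint meval (e : seq V) (m : mexp) : V :=
  match m with
  | MAtom i => nth 0 e i
  | MZero => 0
  | MAdd m n => meval e m + meval e n
  | MOpp m => - meval e m
  | MScale a m => a *: meval e m
  end.

(** [Nat.eqb] is used on atoms so that [module_over] can evaluate coefficients on literals by
    [cbv]. *)
Fixpoint mcoef (m : mexp) (i : nat) : K :=
  match m with
  | MAtom j => if Nat.eqb j i then 1 else 0
  | MZero => 0
  | MAdd m n => mcoef m i + mcoef n i
  | MOpp m => - mcoef m i
  | MScale a m => a * mcoef m i
  end.

Fixpoint matoms (m : mexp) (n : nat) : bool :=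
  match m with
  | MAtom j => (j < n)%N
  | MZero => true
  | MAdd m p => matoms m n && matoms p n
  | MOpp m => matoms m n
  | MScale a m => matoms m n
  end.

Fixpoint mcoef_eq (m p : mexp) (n : nat) : Prop :=
  if n is n'.+1 then mcoef m n' = mcoef p n' /\ mcoef_eq m p n' else True.

Lemma mevalE e m : matoms m (size e) ->
  meval e m = \sum_(i < size e) mcoef m i *: nth 0 e i.
Proof.
elim: m => [j|_|m IHm p IHp /andP[/IHm + /IHp]|m IHm /IHm|a m IHm /IHm] /=.
- move=> js; rewrite (bigD1 (Ordinal js)) //= PeanoNat.Nat.eqb_refl scale1r.
  rewrite big1 ?addr0 // => i /eqP ij; case: PeanoNat.Nat.eqb_spec => [ji|_].
    by case: ij; apply: val_inj.
  by rewrite scale0r.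
- by rewrite big1 // => i _; rewrite scale0r.
- by move=> -> ->; rewrite -big_split /=; apply: eq_bigr => i _; rewrite scalerDl.
- by move=> ->; rewrite -sumrN; apply: eq_bigr => i _; rewrite scaleNr.
- by move=> ->; rewrite scaler_sumr; apply: eq_bigr => i _; rewrite scalerA.
Qed.

Lemma meval_eq e m p : matoms m (size e) && matoms p (size e) ->
  mcoef_eq m p (size e) -> meval e m = meval e p.
Proof.
move=> /andP[/mevalE -> /mevalE ->] mp; apply: eq_bigr => -[i /= ni] _; congr (_ *: _).
elim: (size e) mp ni => //= n IHn [mpn /IHn mp].
by rewrite ltnS leq_eqVlt => /orP[/eqP ->|/mp].
Qed.

End ModuleIdentities.

Ltac mod_find x e :=
  match e with
  | x :: _ => constr:(O)
  | ?y :: _ => let _ := match goal with _ => unify x y end in constr:(O)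
  | _ :: ?e' => let n := mod_find x e' in constr:(S n)
  end.
Ltac mod_atoms x e :=
  match x with
  | (?a + ?b)%R => let e := mod_atoms a e in mod_atoms b e
  | (- ?a)%R => mod_atoms a e
  | (_ *: ?a)%R => mod_atoms a e
  | 0%R => e
  | _ => match e with
         | _ => let n := mod_find x e in e
         | _ => constr:(x :: e)
         end
  end.
Ltac mod_reify K x e :=
  match x with
  | (?a + ?b)%R => let a := mod_reify K a e in let b := mod_reify K b e in
                   constr:(MAdd a b)
  | (- ?a)%R => let a := mod_reify K a e in constr:(MOpp a)
  | (?c *: ?a)%R => let a := mod_reify K a e in constr:(@MScale K c a)
  | 0%R => constr:(@MZero K)
  | _ => let n := mod_find x e in constr:(@MAtom K n)
  end.
Ltac module_over K :=
  match goal with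
  | |- @eq ?V ?x ?y =>
    let e := mod_atoms x (@nil V) in let e := mod_atoms y e in
    let x' := mod_reify K x e in let y' := mod_reify K y e in
    apply: (@meval_eq K _ e x' y'); first by [];
    cbv [mcoef_eq mcoef size Nat.eqb]; do ?[split]; try by []; try ring
  end.

(** * Derivations of the Lie algebra *)

Section TwistedDerivation.
Variables (K : fieldType) (X : Type) (rel : set (lie_term K X)).
Local Notation L := (lie_pres rel).
Local Notation pi := (lie_pi rel).
Variables (h : {linear L -> L}) (cv : X -> K) (fv : X -> L).
Hypothesis hder : forall x y, h (lie x y) = lie (h x) y + lie x (h y).

Fixpoint tder_c (t : lie_term K X) : K :=
  match t with
  | LGen i => cv i
  | LZero => 0
  | LAdd s t => tder_c s + tder_c t
  | LScale a t => a * tder_c t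
  | LLie s t => 0
  end.

(** Model: for x in the positive part, [f,x] = F x + c(x) h with h in the Cartan subalgebra. The
    clause for [LLie] is the expansion of [f,[x,y]] by the Jacobi identity, with h acting as a
    derivation; such a bracket has no Cartan component, so c vanishes on it. *)
Fixpoint tder_f (t : lie_term K X) : L :=
  match t with
  | LGen i => fv i
  | LZero => 0
  | LAdd s t => tder_f s + tder_f t
  | LScale a t => a *: tder_f t
  | LLie s t => lie (pi s) (tder_f t) + lie (tder_f s) (pi t)
                - tder_c t *: h (pi s) + tder_c s *: h (pi t)
  end.

Hypothesis rel_c : forall t, rel t -> tder_c t = 0.
Hypothesis rel_f : forall t, rel t -> tder_f t = 0.

Lemma lie_pi0 : pi LZero = 0. Proof. by []. Qed.
Lemma lie_piD s t : pi (LAdd s t) = pi s + pi t.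
Proof. by rewrite -[RHS]/(lp_add _ _) lp_addE. Qed.
Lemma lie_piZ a t : pi (LScale a t) = a *: pi t.
Proof. by rewrite -[RHS]/(lp_scale _ _) lp_scaleE. Qed.
Lemma lie_piL s t : pi (LLie s t) = lie (pi s) (pi t).
Proof. by rewrite -[RHS]/(lp_lie _ _) lp_lieE. Qed.

Lemma tder_c_eq s t : lie_eq rel s t -> tder_c s = tder_c t.
Proof.
elim=> {s t} //=.
- by move=> s t u _ -> _ ->.
- by move=> s s' t t' _ -> _ ->.
- by move=> a t t' _ ->.
- by move=> s t u; rewrite addrA.
- by move=> s t; rewrite addrC.
- by move=> t; rewrite add0r.
- by move=> t; rewrite mulN1r addNr.
- by move=> a b t; rewrite mulrA.
- by move=> t; rewrite mul1r.
- by move=> a s t; rewrite mulrDr.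
- by move=> a b t; rewrite mulrDl.
all: by move=> *; rewrite ?mulr0 ?addr0.
Qed.

(** The bilinearity and antisymmetry cases hold by the shape of the formula; the Jacobi case is
    where h being a derivation enters. *)
Lemma tder_f_eq s t : lie_eq rel s t -> tder_f s = tder_f t.
Proof.
elim=> {s t} //=.
- by move=> s t u _ -> _ ->.
- by move=> s s' t t' _ -> _ ->.
- by move=> a t t' _ ->.
- move=> s s' t t' es IHs et IHt.
  by rewrite IHs IHt (tder_c_eq es) (tder_c_eq et) (proj2 (lie_piP _ _ _) es)
             (proj2 (lie_piP _ _ _) et).
- by move=> s t u; rewrite addrA.
- by move=> s t; rewrite addrC.
- by move=> t; rewrite add0r.
- by move=> t; rewrite scaleN1r addNr.
- by move=> a b t; rewrite scalerA.
- by move=> t; rewrite scale1r.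
- by move=> a s t; rewrite scalerDr.
- by move=> a b t; rewrite scalerDl.
- move=> s t u; rewrite lie_piD !(lieDl, lieDr) [h (_ + _)]linearD /=.
  module_over K.
- move=> s t u; rewrite lie_piD !(lieDl, lieDr) [h (_ + _)]linearD /=.
  module_over K.
- move=> a s t; rewrite lie_piZ !(lieZl, lieZr) [h (_ *: _)]linearZ /=.
  module_over K.
- move=> a s t; rewrite lie_piZ !(lieZl, lieZr) [h (_ *: _)]linearZ /=.
  module_over K.
- move=> t; rewrite (lieC (tder_f t)); module_over K.
- move=> s t u; rewrite !lie_piL !hder !(lieDl, lieDr, lieZl, lieZr, lieNl, lieNr).
  set S := pi s; set T := pi t; set U := pi u.
  rewrite (lie_der S T (tder_f u)) (lie_der T U (tder_f s)) (lie_der U S (tder_f t)).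
  rewrite (lieC (tder_f s) (lie _ _)) (lieC (tder_f t) (lie _ _)) (lieC (tder_f u) (lie _ _)).
  rewrite (lieC (tder_f t) U) (lieC (tder_f u) S) (lieC (tder_f s) T).
  rewrite (lieC (h S) T) (lieC (h T) U) (lieC (h U) S) !lieNr.
  module_over K.
Qed.

(** Serves twice: with c = 0 and h = 0 it yields derivations with prescribed values on generators,
    and with c nonzero it yields the action of the negative generators f_k. *)
Theorem twisted_derivation : exists (c : {scalar L}) (F : {linear L -> L}),
  [/\ forall i, c (lie_gen rel i) = cv i, forall x y, c (lie x y) = 0,
      forall i, F (lie_gen rel i) = fv i &
      forall x y, F (lie x y) = lie x (F y) + lie (F x) y - c y *: h x + c x *: h y].
Proof.
pose c (x : L) := tder_c (lie_repr x); pose F (x : L) := tder_f (lie_repr x).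
have cE t : c (pi t) = tder_c t by apply: tder_c_eq; apply: lie_repr_pi.
have FE t : F (pi t) = tder_f t by apply: tder_f_eq; apply: lie_repr_pi.
have c_lin : scalar c.
  move=> a x y; have [s ->] := lie_pi_surj x; have [t ->] := lie_pi_surj y.
  by rewrite -lie_piZ -lie_piD !cE.
have F_lin : linear F.
  move=> a x y; have [s ->] := lie_pi_surj x; have [t ->] := lie_pi_surj y.
  by rewrite -lie_piZ -lie_piD !FE.
pose C := HB.pack_for {scalar L} c (GRing.isLinear.Build _ _ _ _ c c_lin).
pose D := HB.pack_for {linear L -> L} F (GRing.isLinear.Build _ _ _ _ F F_lin).
exists C, D; split=> [i|x y|i|x y] /=.
- exact: cE.
- have [s ->] := lie_pi_surj x; have [t ->] := lie_pi_surj y.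
  by rewrite -lie_piL cE.
- exact: FE.
- have [s ->] := lie_pi_surj x; have [t ->] := lie_pi_surj y.
  by rewrite -lie_piL !FE !cE.
Qed.

End TwistedDerivation.

Lemma lie_pres_ind (K : fieldType) (X : Type) (rel : set (lie_term K X))
    (P : lie_pres rel -> Prop) : (forall i, P (lie_gen rel i)) -> P 0 ->
  (forall x y, P x -> P y -> P (x + y)) -> (forall a x, P x -> P (a *: x)) ->
  (forall x y, P x -> P y -> P (lie x y)) -> forall x, P x.
Proof.
move=> Pg P0 PD PZ PL x; have [t ->] := lie_pi_surj x.
elim: t => [i||s Ps t Pt|a t Pt|s Ps t Pt].
- exact: Pg.
- by rewrite lie_pi0.
- by rewrite lie_piD; apply: PD.
- by rewrite lie_piZ; apply: PZ.
- by rewrite lie_piL; apply: PL.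
Qed.

(** * Gradings, coroots and lowering operators on the positive part *)

Section NPlus.
Variables (r : nat) (A : 'M[int]_r).
Hypothesis gcmA : gcm A.
Local Notation L := (nplus A).
Local Notation e := (nplus_e A).

Definition serre_term (i j : 'I_r) n : lie_term rat 'I_r :=
  iter n (LLie (LGen i)) (LGen j).

Lemma serre_exp i j : i != j -> exists2 p, `|1 - A i j|%N = p.+1 & A i j = - p%:Z.
Proof.
case: gcmA => _ Aneg _ /Aneg; case: (A i j) => [[|n]|n] // _; first by exists 0.
by exists n.+1; rewrite ?NegzE // opprK.
Qed.

Lemma serre_term_rel i j p : i != j -> A i j = - p%:Z -> serre A (serre_term i j p.+1).
Proof.
move=> ij Aij; exists i, j; split=> //.
by have [q -> /eqP] := serre_exp ij; rewrite Aij eqr_opp => /eqP[->].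
Qed.

Lemma serre_pi0 t : serre A t -> lie_pi (serre A) t = 0.
Proof. by move=> /lie_eq_rel /lie_piP. Qed.

(** On a Serre relator the prospective derivation acts by a scalar, so it sends the relator to a
    multiple of zero. *)
Lemma derivation_exists (lam : 'I_r -> rat) : exists D : {linear L -> L},
  (forall i, D (e i) = lam i *: e i) /\
  (forall x y, D (lie x y) = lie (D x) y + lie x (D y)).
Proof.
pose z : {linear L -> L} := \0.
have zder x y : z (lie x y) = lie (z x) y + lie x (z y).
  by rewrite /= lie0l lie0r addr0.
have c0 (t : lie_term rat 'I_r) : tder_c (fun=> 0) t = 0 :> rat.
  by elim: t => //= [s -> t ->|a t ->]; rewrite ?addr0 ?mulr0.
have rf t : serre A t ->
    @tder_f rat 'I_r (serre A) z (fun=> 0) (fun i => lam i *: e i) t = 0.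
  move=> rt; have := serre_pi0 rt; case: rt => i [j [ij ->]] relt0.
  set n := `|_|%N in relt0 *.
  suff -> : tder_f z (fun=> 0) (fun i => lam i *: e i) (serre_term i j n) =
      (lam i *+ n + lam j) *: lie_pi (serre A) (serre_term i j n).
    by rewrite relt0 scaler0.
  elim: n {relt0} => [|n IHn] /=; first by rewrite add0r.
  rewrite c0 IHn !scale0r subr0 addr0 lie_piL lieZr lieZl mulrS.
  by rewrite -scalerDl [X in X *: _]addrC addrA.
have [c [F [_ _ Fe Fl]]] := twisted_derivation zder (fun t _ => c0 t) rf.
exists F; split=> // x y.
by rewrite Fl /= !scaler0 subr0 addr0 addrC.
Qed.

Definition grading_der lam : {linear L -> L} := projT1 (cid (derivation_exists lam)).
Lemma grading_der_e lam i : grading_der lam (e i) = lam i *: e i.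
Proof. by case: (projT2 (cid (derivation_exists lam))). Qed.
Lemma grading_der_lie lam x y : grading_der lam (lie x y) =
  lie (grading_der lam x) y + lie x (grading_der lam y).
Proof. by case: (projT2 (cid (derivation_exists lam))). Qed.

Definition weight (lam : 'I_r -> rat) (alpha : 'cV[int]_r) : rat :=
  \sum_l lam l * (alpha l 0)%:~R.

Lemma weightD lam alpha beta :
  weight lam (alpha + beta) = weight lam alpha + weight lam beta.
Proof. by rewrite -big_split; apply: eq_bigr => l _; rewrite mxE rmorphD mulrDr. Qed.

Lemma weight_simple lam i : weight lam (simple_root i) = lam i.
Proof.
rewrite /weight (bigD1 i) //= big1 ?addr0 ?mxE ?eqxx ?mulr1 // => j ji.
by rewrite mxE (negPf ji) mulr0.
Qed.

Lemma grading_der_root lam alpha x : root_space alpha x ->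
  grading_der lam x = weight lam alpha *: x.
Proof.
elim=> {alpha x} [i|alpha beta x y _ IHx _ IHy|alpha|alpha x y _ IHx _ IHy|alpha a x _ IHx].
- by rewrite grading_der_e weight_simple.
- by rewrite grading_der_lie IHx IHy lieZl lieZr weightD scalerDl.
- by rewrite linear0 scaler0.
- by rewrite linearD /= IHx IHy scalerDr.
- by rewrite linearZ /= IHx !scalerA mulrC.
Qed.

(** The operator ad h_k of the Kac-Moody algebra on its positive part; [pairing] is the value of a
    root on h_k. *)
Definition coroot k : {linear L -> L} := grading_der (fun l => (A k l)%:~R).
Definition pairing k alpha := weight (fun l => (A k l)%:~R) alpha.

Lemma coroot_serre k i j n :
  coroot k (lie_pi (serre A) (serre_term i j n)) =
  ((A k i)%:~R *+ n + (A k j)%:~R) *: lie_pi (serre A) (serre_term i j n).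
Proof.
elim: n => [|n IHn] /=; first by rewrite add0r; apply: grading_der_e.
rewrite lie_piL /coroot grading_der_lie grading_der_e -/(coroot k) -/(serre_term i j n).
by rewrite IHn lieZl lieZr -scalerDl mulrS addrA.
Qed.

(** This is ad f_k, normalised by [f_k, e_k] = -h_k, with its Cartan component split off as c. That
    it descends to [nplus A] is the classical fact that f_k kills the Serre elements. *)
Lemma lowering_exists k : exists (c : {scalar L}) (F : {linear L -> L}),
  [/\ forall i, c (e i) = - (i == k)%:R, forall x y, c (lie x y) = 0,
      forall i, F (e i) = 0 &
      forall x y, F (lie x y) = lie x (F y) + lie (F x) y
                                - c y *: coroot k x + c x *: coroot k y].
Proof.
pose cv (i : 'I_r) : rat := - (i == k)%:R.
apply: (@twisted_derivation rat 'I_r (serre A) (coroot k) cv (fun=> 0)).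
- exact: grading_der_lie.
- move=> t [i [j [ij ->]]].
  by have [p -> _] := serre_exp ij.
- move=> t [i [j [ij ->]]]; have [p -> Aij] := serre_exp ij.
  rewrite -/(serre_term i j p.+1).
  have step n : tder_f (coroot k) cv (fun=> 0) (serre_term i j n.+1) =
      lie (e i) (tder_f (coroot k) cv (fun=> 0) (serre_term i j n))
      - (tder_c cv (serre_term i j n) * (A k i)%:~R) *: e i
      - ((i == k)%:R * ((A k i)%:~R *+ n + (A k j)%:~R)) *:
          lie_pi (serre A) (serre_term i j n).
    rewrite /= lie0l addr0 -/(serre_term i j n) coroot_serre.
    rewrite [coroot k _]grading_der_e !scalerA mulNr scaleNr.
    by rewrite -[lie_pi _ (LGen i)]/(e i).
  have [ik|ik] := eqVneq i k.
    have jk : (j == k) = false by rewrite -ik eq_sym (negPf ij).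
    have cs n : tder_c cv (serre_term i j n) = 0 by case: n => //=; rewrite /cv jk oppr0.
    (* The sl_2 computation on a string through e_j: the factor a_ij + n vanishes at n = -a_ij,
       which is the length fixed by the Serre relation. *)
    have fE n : tder_f (coroot k) cv (fun=> 0) (serre_term i j n.+1) =
        - ((n.+1)%:R * ((A i j)%:~R + n%:R)) *: lie_pi (serre A) (serre_term i j n).
      case: (gcmA) => Aii _ _.
      elim: n => [|n IHn].
        by rewrite step cs mul0r scale0r subr0 ik eqxx /= lie0r mulr0n sub0r !mul1r addr0 add0r scaleNr.
      rewrite step IHn cs mul0r scale0r subr0 ik eqxx -ik Aii lieZr /=.
      rewrite -/(serre_term i j n) -lie_piL -/(serre_term i j n.+1).
      by rewrite -scalerBl; congr (_ *: _); ring.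
    rewrite fE Aij; apply/eqP; rewrite scaler_eq0; apply/orP; left.
    by apply/eqP; rewrite rmorphN /= -pmulrn addNr mulr0 oppr0.
  have [jk|jk] := eqVneq j k; last first.
    elim: (p.+1) => // n IHn; rewrite step IHn lie0r (negPf ik) mul0r scale0r !subr0.
    have -> : tder_c cv (serre_term i j n) = 0.
      by case: (n) => //=; rewrite /cv (negPf jk) oppr0.
    by rewrite mul0r scale0r subr0.
  (* For j = k only the innermost letter is lowered: the first bracket leaves a_ki e_i, and a second
     bracket with e_i kills it. A Serre relator with a single bracket has a_ij = 0, hence a_ki =
     a_ji = 0. *)
  have f1 : tder_f (coroot k) cv (fun=> 0) (serre_term i j 1) = (A k i)%:~R *: e i.
    rewrite step (negPf ik) mul0r scale0r subr0 /= lie0r sub0r /cv jk eqxx.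
    by rewrite mulN1r scaleNr opprK.
  have f2 n : tder_f (coroot k) cv (fun=> 0) (serre_term i j n.+2) = 0.
    elim: n => [|n IHn]; rewrite step (negPf ik) mul0r scale0r subr0.
      by rewrite f1 lieZr liexx scaler0 mul0r scale0r subrr.
    by rewrite IHn lie0r mul0r scale0r subrr.
  case: p Aij => [|p] Aij; last exact: f2.
  case: (gcmA) => _ _ A0; rewrite f1 -jk.
  have Aij0 : A i j = 0 by rewrite Aij oppr0.
  by have [/(_ Aij0) -> _] := A0 i j; rewrite scale0r.
Qed.

Definition low_coef k : {scalar L} := projT1 (cid (lowering_exists k)).
Definition lowering k : {linear L -> L} := projT1 (cid (projT2 (cid (lowering_exists k)))).

Lemma lowering_spec k :
  [/\ forall i, low_coef k (e i) = - (i == k)%:R,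
      forall x y, low_coef k (lie x y) = 0,
      forall i, lowering k (e i) = 0 &
      forall x y, lowering k (lie x y) = lie x (lowering k y) + lie (lowering k x) y
        - low_coef k y *: coroot k x + low_coef k x *: coroot k y].
Proof. exact: (projT2 (cid (projT2 (cid (lowering_exists k))))). Qed.

Lemma low_coef_e k i : low_coef k (e i) = - (i == k)%:R.
Proof. by case: (lowering_spec k). Qed.
Lemma low_coef_lie k (x y : L) : low_coef k (lie x y) = 0.
Proof. by case: (lowering_spec k). Qed.
Lemma lowering_e k i : lowering k (e i) = 0.
Proof. by case: (lowering_spec k). Qed.
Lemma lowering_lie k x y : lowering k (lie x y) =
  lie x (lowering k y) + lie (lowering k x) y
  - low_coef k y *: coroot k x + low_coef k x *: coroot k y.
Proof. by case: (lowering_spec k). Qed.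

Lemma nplus_e_neq0 i : e i != 0.
Proof.
apply/eqP => ei0; have := low_coef_e i i; rewrite ei0 linear0 eqxx => /eqP.
by rewrite eq_sym oppr_eq0 oner_eq0.
Qed.

Lemma low_coef_coroot k x : low_coef k (coroot k x) = 2 * low_coef k x.
Proof.
elim/lie_pres_ind: x => [i||x y IHx IHy|b x IHx|x y _ _].
- rewrite /coroot grading_der_e linearZ /= low_coef_e.
  case: eqP => [->|_]; last by rewrite oppr0 !mulr0.
  by case: gcmA => -> _ _.
- by rewrite !linear0 mulr0.
- by rewrite !linearD /= IHx IHy mulrDr.
- by rewrite !linearZ /= IHx mulrCA.
- by rewrite /coroot grading_der_lie linearD /= !low_coef_lie mulr0 addr0.
Qed.

Lemma low_coef_lowering k x : low_coef k (lowering k x) = 0.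
Proof.
elim/lie_pres_ind: x => [i||x y IHx IHy|b x IHx|x y _ _].
- by rewrite lowering_e linear0.
- by rewrite !linear0.
- by rewrite !linearD /= IHx IHy addr0.
- by rewrite !linearZ /= IHx mulr0.
- rewrite lowering_lie !(linearD, linearN, linearZ) /= !low_coef_lie !low_coef_coroot.
  by ring.
Qed.

(** The relation [e_k, f_k] = h_k, stated where [f_k, y] has no Cartan component. The subset W in
    the results on exponentials below is there to be this kernel of [low_coef]. *)
Lemma lowering_raising k y : low_coef k y = 0 ->
  lie (e k) (lowering k y) - lowering k (lie (e k) y) = coroot k y.
Proof.
move=> y0; rewrite lowering_lie lowering_e lie0l y0 low_coef_e eqxx.
by rewrite scale0r subr0 addr0 scaleN1r opprB addrC subrK.
Qed.

Lemma coroot_e k : coroot k (e k) = 2 *: e k.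
Proof. by rewrite /coroot grading_der_e; case: gcmA => -> _ _. Qed.

Lemma coroot_raising k y :
  coroot k (lie (e k) y) = lie (e k) (coroot k y) + 2 *: lie (e k) y.
Proof. by rewrite /coroot grading_der_lie -/(coroot k) coroot_e lieZl addrC. Qed.

Lemma root_space_pos alpha (x : L) : root_space alpha x ->
  x = 0 \/ (forall i, 0 <= alpha i 0) /\ 1 <= ht alpha.
Proof.
elim=> {alpha x} [i|alpha beta x y _ IHx _ IHy|alpha|alpha x y _ IHx _ IHy|alpha a x _ IHx].
- right; rewrite ht_simple_root; split=> // j; rewrite mxE; by case: andP.
- case: IHx IHy => [->|[a0 a1]]; first by rewrite lie0l; left.
  case=> [->|[b0 b1]]; first by rewrite lie0r; left.
  right; split=> [i|]; first by rewrite mxE addr_ge0.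
  rewrite /ht; under eq_bigr do rewrite mxE.
  by rewrite big_split /= (le_trans a1) // lerDl (le_trans _ b1).
- by left.
- by case: IHx IHy => [->|]; [rewrite add0r|right].
- by case: IHx => [->|]; [rewrite scaler0; left|right].
Qed.

Lemma root_space_neg (alpha : 'cV[int]_r) (x : L) i : alpha i 0 < 0 -> root_space alpha x -> x = 0.
Proof. by move=> ai /root_space_pos[//|[/(_ i)]]; rewrite leNgt ai. Qed.

Definition content (w : 'I_r * seq 'I_r) : 'cV[int]_r :=
  \sum_(i <- letters w) simple_root i.

Lemma content_cons i j s : content (i, j :: s) = simple_root i + content (j, s).
Proof. by rewrite /content big_cons. Qed.

Lemma nested_lie_root w : root_space (content w) (nested_lie A w).
Proof.
move: w; apply: word_ind => [i|i j s IHs].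
  by rewrite /content big_seq1; apply: root_space_e.
by rewrite content_cons; apply: root_space_lie IHs; apply: root_space_e.
Qed.

Lemma root_space_words alpha (x : L) : root_space alpha x ->
  lspan (lie_word e @` [set w | content w = alpha])%classic x.
Proof.
elim=> {alpha x} [i|alpha beta x y _ IHx _ IHy|alpha|alpha x y _ IHx _ IHy|alpha a x _ IHx].
- by apply: lspan_in; exists (i, [::]) => //=; rewrite /content big_seq1.
- apply: (lie_span_lie _ IHx IHy) => u v w <- <- uvw /=.
  by rewrite /content (perm_big _ uvw) big_cat.
- exact: lspan0.
- exact: lspanD.
- exact: lspanZ.
Qed.

Lemma ht_content w : ht (content w) = (word_length w)%:Z.
Proof.
have htD (a b : 'cV[int]_r) : ht (a + b) = ht a + ht b.
  by rewrite /ht -big_split; apply: eq_bigr => i _; rewrite mxE.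
move: w; apply: word_ind => [i|i j s IHs].
  by rewrite /content big_seq1 ht_simple_root.
by rewrite content_cons htD IHs ht_simple_root.
Qed.

Lemma content_ge i w : content w i 0 = (count_mem i (letters w))%:Z.
Proof.
rewrite /content summxE; elim: (letters w) => [|j s IHs]; first by rewrite big_nil.
by rewrite big_cons IHs /= mxE andbT eq_sym PoszD; case: eqP.
Qed.

Lemma nplus_words (x : L) : lspan (lie_word e @` setT)%classic x.
Proof.
elim/lie_pres_ind: x => [i||x y|b x|x y IHx IHy].
- by apply: lspan_in; exists (i, [::]).
- exact: lspan0.
- exact: lspanD.
- exact: lspanZ.
- exact: (lie_span_lie _ IHx IHy).
Qed.

Lemma root_space_simple i (x : L) : root_space (simple_root i) x -> exists c, x = c *: e i.
Proof.
move=> /root_space_words.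
apply: (@lspan_sub _ _ _ (fun y => exists c, y = c *: e i)) => [_ [w cw <-]||x' y [a ->] [b ->]|a x' [b ->]].
- have := ht_content w; rewrite cw ht_simple_root; case: w cw => j [|//] cw _.
  have := congr1 (fun a : 'cV[int]_r => a i 0) cw.
  rewrite content_ge mxE eqxx /= addn0; case: eqP => // -> _.
  by exists 1; rewrite scale1r.
- by exists 0; rewrite scale0r.
- by exists (a + b); rewrite scalerDl.
- by exists (a * b); rewrite scalerA.
Qed.

Lemma low_coef_root k alpha (x : L) : root_space alpha x ->
  alpha = simple_root k \/ low_coef k x = 0.
Proof.
elim=> {alpha x} [i|alpha beta x y _ _ _ _|alpha|alpha x y _ IHx _ IHy|alpha a x _ IHx].
- by case: (eqVneq i k) => [->|ik]; [left|right; rewrite low_coef_e (negPf ik) oppr0].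
- by right; apply: low_coef_lie.
- by right; apply: linear0.
- case: IHx IHy => [->|x0 [->|y0]]; [by left|by left|right].
  by rewrite linearD /= x0 y0 addr0.
- by case: IHx => [->|x0]; [left|right; rewrite linearZ /= x0 mulr0].
Qed.

Lemma coroot_root k alpha x : root_space alpha x -> root_space alpha (coroot k x).
Proof. by move=> rx; rewrite /coroot (grading_der_root _ rx); apply: root_spaceZ. Qed.

Lemma lowering_root k alpha x : root_space alpha x ->
  root_space (alpha - simple_root k) (lowering k x).
Proof.
elim=> {alpha x} [i|alpha beta x y rx IHx ry IHy|alpha|alpha x y _ IHx _ IHy|alpha a x _ IHx].
- by rewrite lowering_e; apply: root_space_0.
- rewrite lowering_lie -!scaleNr; do 3?apply: root_spaceD.
  + by rewrite -addrA; apply: root_space_lie.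
  + by rewrite addrAC; apply: root_space_lie.
  + have [->|->] := low_coef_root k ry; last by rewrite oppr0 scale0r; apply: root_space_0.
    by rewrite addrK; apply/root_spaceZ/coroot_root.
  + have [->|->] := low_coef_root k rx; last by rewrite scale0r; apply: root_space_0.
    by rewrite addrC addKr; apply/root_spaceZ/coroot_root.
- by rewrite linear0; apply: root_space_0.
- by rewrite linearD; apply: root_spaceD.
- by rewrite linearZ; apply: root_spaceZ.
Qed.

Lemma raising_root k alpha (x : L) : root_space alpha x ->
  root_space (alpha + simple_root k) (lie (e k) x).
Proof. by rewrite addrC; apply/root_space_lie/root_space_e. Qed.

End NPlus.

(** * Locally nilpotent exponentials *)

Section LocallyNilpotentExp.
Variables (K : numFieldType) (V : lmodType K).
Implicit Types (D : {linear V -> V}) (x y : V).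

Definition locally_nilpotent (D : V -> V) := forall x, exists n, iter n D x = 0.

Definition expn (D : V -> V) N x : V := \sum_(n < N) (n`!%:R)^-1 *: iter n D x.

(** The exponential series is cut at some order where the iterates of D on x vanish; [nexpE] shows
    that the choice is immaterial. The default 0 is never met when D is locally nilpotent. *)
Definition nexp (D : V -> V) x : V :=
  if pselect (exists n, iter n D x = 0) is left H then expn D (projT1 (cid H)) x else 0.

Lemma iter_lin0 D n : iter n D 0 = 0.
Proof. by elim: n => //= n ->; rewrite linear0. Qed.

Lemma iter_linD D n x y : iter n D (x + y) = iter n D x + iter n D y.
Proof. by elim: n => //= n ->; rewrite linearD. Qed.

Lemma iter_linZ D n a x : iter n D (a *: x) = a *: iter n D x.
Proof. by elim: n => //= n ->; rewrite linearZ. Qed.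

Lemma iter_nil_ge D N M x : iter N D x = 0 -> (N <= M)%N -> iter M D x = 0.
Proof. by move=> x0 /subnK <-; rewrite iterD x0 iter_lin0. Qed.

Lemma expn_ge D N M x : iter N D x = 0 -> (N <= M)%N -> expn D M x = expn D N x.
Proof.
move=> x0 NM; rewrite /expn -(subnKC NM) big_split_ord /= [X in _ + X]big1 ?addr0 //.
by move=> i _; rewrite (iter_nil_ge x0) ?scaler0 ?leq_addr.
Qed.

Lemma nexpE D N x : iter N D x = 0 -> nexp D x = expn D N x.
Proof.
move=> x0; rewrite /nexp; case: pselect => [H|[]]; last by exists N.
case: cid => M xM /=; case: (leqP N M) => [|/ltnW] NM.
  exact: expn_ge.
by rewrite (expn_ge xM).
Qed.

Section Nilpotent.
Variables (D : {linear V -> V}) (nilD : locally_nilpotent D).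

Lemma nexpD x y : nexp D (x + y) = nexp D x + nexp D y.
Proof.
have [N xN] := nilD x; have [M yM] := nilD y.
have xNM := iter_nil_ge xN (leq_addr M N); have yNM := iter_nil_ge yM (leq_addl N M).
rewrite (nexpE xNM) (nexpE yNM) (@nexpE _ (N + M)) ?iter_linD ?xNM ?yNM ?addr0 //.
by rewrite -big_split; apply: eq_bigr => n _; rewrite iter_linD scalerDr.
Qed.

Lemma nexpZ a x : nexp D (a *: x) = a *: nexp D x.
Proof.
have [N xN] := nilD x.
rewrite (nexpE xN) (@nexpE _ N) ?iter_linZ ?xN ?scaler0 // scaler_sumr.
by apply: eq_bigr => n _; rewrite iter_linZ !scalerA mulrC.
Qed.

Lemma nexp_stable (T : V -> Prop) : T 0 -> (forall x y, T x -> T y -> T (x + y)) ->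
  (forall a x, T x -> T (a *: x)) -> (forall x, T x -> T (D x)) ->
  forall x, T x -> T (nexp D x).
Proof.
move=> T0 TD TZ TDx x Tx; have [N xN] := nilD x; rewrite (nexpE xN).
rewrite /expn; apply: big_ind => // n _; apply: TZ.
by elim: (n : nat) => //= m; apply: TDx.
Qed.

Section Commutation.
Variables (T T1 T2 : {linear V -> V}) (W : V -> Prop).
Hypothesis WD : forall y, W y -> W (D y).
Hypothesis DT : forall y, W y -> D (T y) = T (D y) + T1 y.
Hypothesis DT1 : forall y, W y -> D (T1 y) = T1 (D y) + T2 y.
Hypothesis DT2 : forall y, W y -> D (T2 y) = T2 (D y).

Lemma iter_commutation n x : W x -> iter n D (T x) = T (iter n D x)
  + n%:R *: T1 (iter n.-1 D x) + 'C(n, 2)%:R *: T2 (iter n.-2 D x).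
Proof.
move=> Wx; have WDn m : W (iter m D x) by elim: m => //= m; apply: WD.
elim: n => [|n IHn] /=; first by rewrite ?bin0n ?mulr0n !scale0r !addr0.
rewrite IHn !linearD !linearZ /= (DT (WDn n)) (DT1 (WDn _)) (DT2 (WDn _)).
rewrite binS bin1 natrD -[n.+1%:R]natr1.
have -> : n%:R *: (T1 (D (iter n.-1 D x)) + T2 (iter n.-1 D x)) =
    n%:R *: T1 (iter n D x) + n%:R *: T2 (iter n.-1 D x).
  by rewrite scalerDr; case: n {IHn} => [|n] //=; rewrite !scale0r.
have -> : 'C(n, 2)%:R *: T2 (D (iter n.-2 D x)) = 'C(n, 2)%:R *: T2 (iter n.-1 D x).
  by case: n {IHn} => [|[|n]] //=; rewrite ?bin0n ?bin_small // !scale0r.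
module_over K.
Qed.

(** This is exp(D) T exp(-D) = exp(ad D) T, where T1 and T2 are the first two iterates of ad D on T
    and the third is zero. *)
Lemma nexp_commutation x : W x ->
  nexp D (T x) = T (nexp D x) + T1 (nexp D x) + 2^-1 *: T2 (nexp D x).
Proof.
move=> Wx; have [N xN] := nilD x.
have xN1 := iter_nil_ge xN (leqnSn N); have xN2 := iter_nil_ge xN1 (leqnSn N.+1).
have fact0 n : (n`!%:R : K) != 0 by rewrite pnatr_eq0 -lt0n fact_gt0.
rewrite (@nexpE _ N.+2); last first.
  rewrite (iter_commutation _ Wx) -[N.+2.-1]/N.+1 -[N.+2.-2]/N xN xN1 xN2.
  by rewrite !(linear0, scaler0, addr0).
rewrite {1}(nexpE xN2) {1}(nexpE xN1) (nexpE xN) /expn.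
under [LHS]eq_bigr => n _ do rewrite (iter_commutation _ Wx) !scalerDr.
rewrite !big_split /= !linear_sum /=; congr (_ + _ + _).
- by apply: eq_bigr => n _; rewrite linearZ.
- rewrite big_ord_recl /= ?mulr0n !scale0r !scaler0 add0r.
  apply: eq_bigr => n _; rewrite [T1 (_ *: _)]linearZ /= scalerA; congr (_ *: _).
  rewrite /bump /= add1n factS natrM invfM mulrAC mulVf ?mul1r //.
  by rewrite pnatr_eq0.
- rewrite 2!big_ord_recl /= ?bin0n ?bin_small // ?mulr0n !scale0r !scaler0 !add0r.
  apply: eq_bigr => n _; rewrite [T2 (_ *: _)]linearZ /= !scalerA; congr (_ *: _).
  rewrite /bump /= !add1n; have := bin_ffact n.+2 2.
  rewrite ffactnS ffactn1 /= -[2`!]/2%N => binE.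
  have {}binE : ('C(n.+2, 2)%:R : K) * 2 = n.+2%:R * n.+1%:R by rewrite -!natrM binE.
  have -> : 'C(n.+2, 2)%:R = n.+2%:R * n.+1%:R / 2 :> K.
    by rewrite -binE mulfK // pnatr_eq0.
  rewrite !factS !natrM; move: (fact0 n).
  have : (n.+1%:R : K) != 0 by rewrite pnatr_eq0.
  have : (n.+2%:R : K) != 0 by rewrite pnatr_eq0.
  move: (n.+2%:R : K) (n.+1%:R : K) (n`!%:R : K) => a b c a0 b0 c0.
  by field; rewrite a0 b0 c0.
Qed.

End Commutation.

End Nilpotent.

Lemma sum_triangle (f : nat -> nat -> V) S :
  \sum_(n < S) \sum_(i < n.+1) f i (n - i)%N = \sum_(i < S) \sum_(j < S - i) f i j.
Proof.
elim: S => [|S IHS]; first by rewrite !big_ord0.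
rewrite !big_ord_recr /= IHS subSnn big_ord1 subnn addrA; congr (_ + _).
rewrite -big_split /=; apply: eq_bigr => i _.
by rewrite subSn 1?ltnW // big_ord_recr.
Qed.

Lemma sum_cauchy (f : nat -> nat -> V) N M :
  (forall i j, (N <= i)%N || (M <= j)%N -> f i j = 0) ->
  \sum_(n < N + M) \sum_(i < n.+1) f i (n - i)%N = \sum_(i < N) \sum_(j < M) f i j.
Proof.
move=> f0; rewrite sum_triangle big_split_ord /= [X in _ + X]big1 ?addr0; last first.
  by move=> i _; rewrite big1 // => j _; rewrite f0 ?leq_addr.
apply: eq_bigr => i _; rewrite -addnC -addnBA 1?ltnW //.
rewrite big_split_ord /= [X in _ + X]big1 ?addr0 // => j _.
by rewrite f0 // leq_addr orbT.
Qed.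

Definition opp_linear (D : {linear V -> V}) : {linear V -> V} := \- D.

Lemma iter_opp D n x : iter n (opp_linear D) x = (-1) ^+ n *: iter n D x.
Proof.
elim: n => [|n IHn] /=; first by rewrite scale1r.
by rewrite IHn linearZ /= -scaleN1r scalerA exprS.
Qed.

Lemma nilpotent_opp D : locally_nilpotent D -> locally_nilpotent (opp_linear D).
Proof.
by move=> nilD x; have [n xn] := nilD x; exists n; rewrite iter_opp xn scaler0.
Qed.

Lemma nexp_oppK D : locally_nilpotent D -> cancel (nexp D) (nexp (opp_linear D)).
Proof.
move=> nilD x; have [N xN] := nilD x.
have fact0 n : (n`!%:R : K) != 0 by rewrite pnatr_eq0 -lt0n fact_gt0.
rewrite (nexpE xN) (@nexpE _ N); last first.
  rewrite iter_opp; apply/eqP; rewrite scaler_eq0; apply/orP; right; apply/eqP.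
  rewrite /expn; apply: (big_ind (fun u => iter N D u = 0)) => [|y z y0 z0|i _].
  - exact: iter_lin0.
  - by rewrite iter_linD y0 z0 addr0.
  - by rewrite iter_linZ -iterD addnC iterD xN iter_lin0 scaler0.
pose f i j : V := ((-1) ^+ i * ((i`!%:R)^-1 * (j`!%:R)^-1)) *: iter (i + j) D x.
transitivity (\sum_(i < N) \sum_(j < N) f i j).
  apply: eq_bigr => i _; rewrite iter_opp /expn.
  rewrite (big_morph (iter i D) (iter_linD D i) (iter_lin0 D i)).
  rewrite !scaler_sumr; apply: eq_bigr => j _.
  by rewrite iter_linZ /f iterD !scalerA; congr (_ *: _); ring.
rewrite -sum_cauchy; last first.
  move=> i j ij; rewrite /f (iter_nil_ge xN) ?scaler0 //.
  by case/orP: ij => /leq_trans ->; rewrite ?leq_addr ?leq_addl.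
have fE n : \sum_(i < n.+1) f i (n - i)%N = (0 ^+ n / n`!%:R) *: iter n D x.
  transitivity ((\sum_(i < n.+1) (-1) ^+ i * ((i`!%:R)^-1 * ((n - i)`!%:R)^-1)) *: iter n D x).
    by rewrite scaler_suml; apply: eq_bigr => i _; rewrite /f subnKC // -ltnS.
  have -> : (0 : K) ^+ n = (1 - 1) ^+ n by rewrite subrr.
  congr (_ *: _); rewrite exprBn mulr_suml; apply: eq_bigr => i _.
  rewrite !expr1n !mulr1 -(bin_fact (leq_ord i)) !natrM.
  have bin0 : ('C(n, i)%:R : K) != 0 by rewrite pnatr_eq0 -lt0n bin_gt0 -ltnS.
  rewrite -[_ *+ 'C(n, i)]mulr_natr; move: (fact0 i) (fact0 (n - i)%N) bin0.
  move: ((i`!)%:R : K) ((n - i)`!%:R : K) ('C(n, i)%:R : K) => a b c a0 b0 c0.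
  by field; rewrite a0 b0 c0.
under eq_bigr do rewrite fE.
case: N xN => [/= ->|N _]; first by rewrite big_ord0.
rewrite addSn big_ord_recl big1 => [|i _]; last by rewrite expr0n mul0r scale0r.
by rewrite addr0 expr0 -[0`!]/1%N divr1 scale1r.
Qed.

End LocallyNilpotentExp.

Section NilpotentDerivation.
Variables (K : numFieldType) (L : lieAlgType K) (D : {linear L -> L}) (W : L -> Prop).
Hypothesis WD : forall x, W x -> W (D x).
Hypothesis WZ : forall a x, W x -> W (a *: x).
Hypothesis derD : forall x y, W x -> W y -> D (lie x y) = lie (D x) y + lie x (D y).

Let dp n x := (n`!%:R)^-1 *: iter n D x.

Let dpS n x : D (dp n x) = n.+1%:R *: dp n.+1 x.
Proof.
rewrite /dp linearZ scalerA factS natrM invfM mulrA mulfV ?mul1r //.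
by rewrite pnatr_eq0.
Qed.

(** The Leibniz rule for divided powers, in which the binomial coefficients disappear; the
    exponential of a derivation is then multiplicative by a Cauchy product. *)
Lemma dp_lie n x y : W x -> W y ->
  (n`!%:R)^-1 *: iter n D (lie x y) = \sum_(i < n.+1) lie (dp i x) (dp (n - i) y).
Proof.
move=> Wx Wy.
have Wn m z : W z -> W (dp m z) by move=> Wz; apply: WZ; elim: m => //= m; apply: WD.
elim: n => [|n IHn]; first by rewrite big_ord1 /dp /= !fact0 invr1 !scale1r.
apply: (@scalerI _ _ (n.+1%:R : K)); first by rewrite pnatr_eq0.
rewrite -/(dp _ _) -dpS {1}/dp IHn linear_sum /=.
have step (i : 'I_n.+1) : true -> D (lie (dp i x) (dp (n - i) y)) =
    i.+1%:R *: lie (dp i.+1 x) (dp (n - i) y)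
    + (n - i).+1%:R *: lie (dp i x) (dp (n - i).+1 y).
  by move=> _; rewrite derD ?dpS ?(lieZl i.+1%:R) ?(lieZr (n - i).+1%:R) //; apply: Wn.
rewrite (eq_bigr _ step).
rewrite big_split /= scaler_sumr.
have -> : \sum_(i < n.+1) i.+1%:R *: lie (dp i.+1 x) (dp (n - i) y) =
    \sum_(i < n.+2) i%:R *: lie (dp i x) (dp (n.+1 - i) y).
  by rewrite [RHS]big_ord_recl scale0r add0r; apply: eq_bigr => i _.
have -> : \sum_(i < n.+1) (n - i).+1%:R *: lie (dp i x) (dp (n - i).+1 y) =
    \sum_(i < n.+2) (n.+1 - i)%:R *: lie (dp i x) (dp (n.+1 - i) y).
  rewrite [RHS]big_ord_recr /= subnn scale0r addr0.
  by apply: eq_bigr => i _; rewrite subSn // -ltnS.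
rewrite -big_split /=; apply: eq_bigr => i _; rewrite -scalerDl -natrD.
by rewrite subnKC // -ltnS.
Qed.

Lemma nil_lie x y N M : W x -> W y -> iter N D x = 0 -> iter M D y = 0 ->
  iter (N + M) D (lie x y) = 0.
Proof.
move=> Wx Wy xN yM; have := dp_lie (N + M) Wx Wy; rewrite big1 => [/eqP|i _].
  by rewrite scaler_eq0 invr_eq0 pnatr_eq0 -leqn0 leqNgt fact_gt0 => /eqP.
rewrite /dp; case: (leqP N i) => Ni.
  by rewrite (iter_nil_ge xN Ni) scaler0 lie0l.
rewrite (iter_nil_ge yM) ?scaler0 ?lie0r //.
by clear -Ni; lia.
Qed.

Lemma nexp_lie x y : locally_nilpotent D -> W x -> W y ->
  nexp D (lie x y) = lie (nexp D x) (nexp D y).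
Proof.
move=> nilD Wx Wy; have [N xN] := nilD x; have [M yM] := nilD y.
rewrite (nexpE (nil_lie Wx Wy xN yM)) (nexpE xN) (nexpE yM) /expn.
under eq_bigr do rewrite dp_lie //.
rewrite (sum_cauchy (f := fun i j => lie (dp i x) (dp j y))).
  by rewrite lie_suml; apply: eq_bigr => i _; rewrite linear_sum.
move=> i j /orP[] ij.
  by rewrite /dp (iter_nil_ge xN ij) scaler0 lie0l.
by rewrite /dp (iter_nil_ge yM ij) scaler0 lie0r.
Qed.

End NilpotentDerivation.

Section SL2.
Variables (K : numFieldType) (V : lmodType K) (E G h : {linear V -> V}).
Hypotheses (nilE : locally_nilpotent E) (nilG : locally_nilpotent G).
Variable W : V -> Prop.
Hypothesis W0 : W 0.
Hypothesis WD : forall x y, W x -> W y -> W (x + y).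
Hypothesis WZ : forall a x, W x -> W (a *: x).
Hypothesis WE : forall x, W x -> W (E x).
Hypothesis WG : forall x, W x -> W (G x).
Hypothesis hE : forall x, h (E x) = E (h x) + 2 *: E x.
Hypothesis hG : forall x, h (G x) = G (h x) - 2 *: G x.
Hypothesis GE : forall x, W x -> G (E x) = E (G x) + h x.

(* With G standing for -f, this is the action of a representative of the *)
(* nontrivial Weyl group element of SL_2.                                *)
Definition weyl_op x := nexp E (nexp G (nexp E x)).

(** Moving h outwards through the three exponentials by [nexp_commutation] turns it into h - 2E,
    then into -h - 2E, and finally into -h. *)
Lemma weyl_op_coroot x : W x -> h (weyl_op x) = - weyl_op (h x).
Proof.
move=> Wx; rewrite /weyl_op.
have We y : W y -> W (nexp E y) by apply: nexp_stable.
have Wg y : W y -> W (nexp G y) by apply: nexp_stable.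
pose z : {linear V -> V} := \0.
have eh y : nexp E (h y) = h (nexp E y) - 2 *: E (nexp E y).
  pose E2 : {linear V -> V} := (-2) \*: E.
  rewrite (nexp_commutation nilE (T := h) (T1 := E2) (T2 := z) (W := fun=> True)) //.
  - by rewrite /= scaler0 addr0 scaleNr.
  - by move=> u _ /=; rewrite hE scaleNr addrK.
  - by move=> u _ /=; rewrite linearZ addr0.
  - by move=> u _ /=; rewrite linear0.
have gh y : nexp G (h y) = h (nexp G y) + 2 *: G (nexp G y).
  pose G2 : {linear V -> V} := 2 \*: G.
  rewrite (nexp_commutation nilG (T := h) (T1 := G2) (T2 := z) (W := fun=> True)) //.
  - by rewrite /= scaler0 addr0.
  - by move=> u _ /=; rewrite hG subrK.
  - by move=> u _ /=; rewrite linearZ addr0.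
  - by move=> u _ /=; rewrite linear0.
have ge y : W y -> nexp G (E y) = E (nexp G y) + h (nexp G y) + G (nexp G y).
  pose G2 : {linear V -> V} := 2 \*: G.
  move=> Wy; rewrite (nexp_commutation nilG (T := E) (T1 := h) (T2 := G2) (W := W)) //=.
  - by rewrite scalerA mulVf ?scale1r // pnatr_eq0.
  - by move=> u _; rewrite hG subrK.
  - by move=> u _; rewrite linearZ.
rewrite eh (nexpD nilG) -scaleNr (nexpZ nilG) gh ge; last exact: We.
set w := nexp G _.
have -> : h w + 2 *: G w + (-2) *: (E w + h w + G w) = (-1) *: h w + (-2) *: E w.
  by module_over K.
rewrite (nexpD nilE) !(nexpZ nilE) eh.
have -> : nexp E (E w) = E (nexp E w).
  rewrite (nexp_commutation nilE (T := E) (T1 := z) (T2 := z) (W := fun=> True)) //=.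
  - by rewrite scaler0 !addr0.
  - by move=> u _; rewrite addr0.
  - by move=> u _; rewrite linear0 addr0.
  - by move=> u _; rewrite linear0.
by module_over K.
Qed.

End SL2.

(** * Real roots *)

Section Reflections.
Variables (r : nat) (A : 'M[int]_r).
Hypothesis gcmA : gcm A.
Local Notation L := (nplus A).
Local Notation e := (nplus_e A).
Local Notation alpha_ := (@simple_root r).

Definition raising k : {linear L -> L} := lie (e k).
Definition lower_opp k : {linear L -> L} := opp_linear (lowering gcmA k).

Lemma nil_max (D : {linear L -> L}) x y n m : iter n D x = 0 -> iter m D y = 0 ->
  iter (n + m) D (x + y) = 0.
Proof.
move=> xn ym; rewrite iter_linD (iter_nil_ge xn) ?leq_addr //.
by rewrite (iter_nil_ge ym) ?leq_addl // addr0.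
Qed.

Lemma iter_raising k j n :
  iter n (raising k) (e j) = lie_pi (serre A) (serre_term k j n).
Proof. by elim: n => //= n ->; rewrite lie_piL. Qed.

(** The Serre relations give nilpotency on the generators, and the Leibniz rule passes it on to
    brackets. *)
Lemma raising_nil k : locally_nilpotent (raising k).
Proof.
elim/lie_pres_ind => [j||x y [n xn] [m ym]|a x [n xn]|x y [n xn] [m ym]].
- have [->|kj] := eqVneq k j; first by exists 1%N; rewrite /= liexx.
  have [p _ kjp] := serre_exp gcmA kj; exists p.+1.
  by rewrite iter_raising (serre_pi0 (serre_term_rel gcmA kj kjp)).
- by exists 0%N.
- by exists (n + m)%N; apply: nil_max.
- by exists n; rewrite iter_linZ xn scaler0.
- exists (n + m)%N; apply: (nil_lie (W := fun=> True)) xn ym => // u v _ _.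
  exact: lie_der.
Qed.

Lemma iter_lowering_root k n alpha (x : L) : root_space alpha x ->
  root_space (alpha - n%:Z *: alpha_ k) (iter n (lowering gcmA k) x).
Proof.
move=> rx; elim: n => [|n IHn] /=; first by rewrite scale0r subr0.
have -> : alpha - n.+1%:Z *: alpha_ k = alpha - n%:Z *: alpha_ k - alpha_ k.
  by rewrite -[n.+1]addn1 PoszD scalerDl scale1r opprD addrA.
exact: lowering_root.
Qed.

(** Each application lowers the coordinate along alpha_k by one, and root spaces with a negative
    coordinate are zero. *)
Lemma lowering_nil k : locally_nilpotent (lowering gcmA k).
Proof.
move=> x.
apply: (@lspan_sub _ _ _ (fun x => exists n, iter n (lowering gcmA k) x = 0)) (nplus_words x).
- move=> _ [w _ <-]; exists `|content w k 0|.+1; set n := _.+1.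
  have := iter_lowering_root k n (nested_lie_root A w); apply: (@root_space_neg _ _ _ _ k).
  by rewrite !mxE !eqxx mulr1 subr_lt0 (le_lt_trans (ler_norm _)) // -abszE ltz_nat.
- by exists 0%N.
- by move=> u v [n un] [m vm]; exists (n + m)%N; apply: nil_max.
- by move=> a u [n un]; exists n; rewrite iter_linZ un scaler0.
Qed.

Lemma coroot_lowering k (x : L) :
  coroot A k (lowering gcmA k x) =
  lowering gcmA k (coroot A k x) - 2 *: lowering gcmA k x.
Proof.
apply: (@lspan_sub _ _ _ (fun x => coroot A k (lowering gcmA k x) =
  lowering gcmA k (coroot A k x) - 2 *: lowering gcmA k x)) (nplus_words x).
- move=> _ [w _ <-]; have rw := nested_lie_root A w.
  rewrite (grading_der_root _ (lowering_root gcmA k rw)) [coroot _ _ _](grading_der_root _ rw).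
  rewrite linearZ /= weightD -scalerBl; congr (_ *: _); congr (_ + _).
  rewrite -scaleN1r /weight.
  under eq_bigr do rewrite mxE rmorphM mulrCA.
  rewrite -mulr_sumr -/(weight _ _) weight_simple; case: gcmA => -> _ _.
  by rewrite mulN1r.
- by rewrite !(linear0, scaler0, subr0).
- by move=> u v; rewrite !linearD /= => -> ->; module_over rat.
- by move=> a u; rewrite !linearZ /= => ->; module_over rat.
Qed.

Definition int_pairing k (alpha : 'cV[int]_r) : int := \sum_l A k l * alpha l 0.

Lemma pairingE k alpha : pairing A k alpha = (int_pairing k alpha)%:~R.
Proof. by rewrite rmorph_sum; apply: eq_bigr => l _; rewrite rmorphM. Qed.

Lemma simple_reflE k alpha :
  simple_refl A k *m alpha = alpha - int_pairing k alpha *: alpha_ k.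
Proof.
apply/matrixP => i j; rewrite !mxE ord1 mulr_suml andbT.
transitivity (\sum_l (l == i)%:R * alpha l 0 - \sum_l A k l * alpha l 0 * (i == k)%:R).
  by rewrite -sumrB; apply: eq_bigr => l _; rewrite mxE eq_sym; ring.
congr (_ - _); rewrite (bigD1 i) //= eqxx mul1r big1 ?addr0 // => l /negPf ->.
by rewrite mul0r.
Qed.

Lemma int_pairing_simple k : int_pairing k (alpha_ k) = 2.
Proof.
rewrite /int_pairing (bigD1 k) //= mxE !eqxx mulr1 big1 ?addr0.
  by case: gcmA.
by move=> l /negPf lk; rewrite mxE lk mulr0.
Qed.

Lemma simple_refl_simple k : simple_refl A k *m alpha_ k = - alpha_ k.
Proof.
by rewrite simple_reflE int_pairing_simple -[2]/(1 + 1) scalerDl scale1r opprD addNKr.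
Qed.

Lemma simple_reflK k : involutive (fun alpha : 'cV[int]_r => simple_refl A k *m alpha).
Proof.
move=> alpha; rewrite [in X in _ *m X]simple_reflE mulmxBr -scalemxAr.
by rewrite simple_refl_simple simple_reflE scalerN opprK subrK.
Qed.

Section WeylOperator.
Variables (k : 'I_r) (E G : {linear L -> L}).
Hypotheses (nilE : locally_nilpotent E) (nilG : locally_nilpotent G).
Hypothesis WE : forall x, low_coef gcmA k x = 0 -> low_coef gcmA k (E x) = 0.
Hypothesis WG : forall x, low_coef gcmA k x = 0 -> low_coef gcmA k (G x) = 0.
Hypothesis hE : forall x, coroot A k (E x) = E (coroot A k x) + 2 *: E x.
Hypothesis hG : forall x, coroot A k (G x) = G (coroot A k x) - 2 *: G x.
Hypothesis GE : forall x, low_coef gcmA k x = 0 -> G (E x) = E (G x) + coroot A k x.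
Hypothesis rE : forall alpha x, root_space alpha x -> root_space (alpha + alpha_ k) (E x).
Hypothesis rG : forall alpha x, root_space alpha x -> root_space (alpha - alpha_ k) (G x).

(** The image stays in the sum of the root spaces along the string alpha + j alpha_k, on which h_k
    has the distinct eigenvalues <alpha, h_k> + 2j. By [weyl_op_coroot] it has eigenvalue -<alpha,
    h_k>, which singles out j = -<alpha, h_k>, that is, the reflected root. *)
Lemma weyl_op_root alpha x : alpha <> alpha_ k -> root_space alpha x ->
  root_space (simple_refl A k *m alpha) (weyl_op E G x).
Proof.
move=> ak rx; pose S (j : int) (y : L) := root_space (alpha + j *: alpha_ k) y.
pose a (j : int) : rat := (int_pairing k alpha + 2 * j)%:~R.
have x0 : low_coef gcmA k x = 0 by have [] := low_coef_root gcmA k rx.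
have hS j (y : L) : S j y -> coroot A k y = a j *: y.
  move=> /(grading_der_root) hy; rewrite /coroot hy -/(pairing A k _) pairingE.
  congr (_%:~R *: _); rewrite -(int_pairing_simple k) /int_pairing mulr_suml -big_split /=.
  by apply: eq_bigr => l _; rewrite !mxE; ring.
have a_inj : injective a by move=> i j /intr_inj; lia.
have SD j y z : S j y -> S j z -> S j (y + z) by apply: root_spaceD.
have SZ j b y : S j y -> S j (b *: y) by apply: root_spaceZ.
pose T := lspan [set y | exists j, S j y]%classic.
have TE y : T y -> T (E y).
  apply: lspan_linear; try by [exact: lspan0|exact: lspanD|exact: lspanZ].
  move=> u [j Su]; apply: lspan_in; exists (j + 1).
  by rewrite /S scalerDl scale1r addrA; apply: rE.
have TG y : T y -> T (G y).
  apply: lspan_linear; try by [exact: lspan0|exact: lspanD|exact: lspanZ].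
  move=> u [j Su]; apply: lspan_in; exists (j - 1).
  by rewrite /S scalerBl scale1r addrA; apply: rG.
have Te (D : {linear L -> L}) : locally_nilpotent D -> (forall y, T y -> T (D y)) ->
    forall y, T y -> T (nexp D y).
  move=> nilD TD; apply: nexp_stable => //; first exact: lspan0.
  - exact: lspanD.
  - exact: lspanZ.
have Tx : T x by apply: lspan_in; exists 0; rewrite /S scale0r addr0.
have Tsx : T (weyl_op E G x) by apply: (Te E) => //; apply: (Te G) => //; apply: Te.
rewrite simple_reflE -scaleNr.
apply: (eigen_in a_inj (S := S) _ SD SZ hS Tsx) => [j|]; first exact: root_space_0.
rewrite (weyl_op_coroot nilE nilG (W := fun y => low_coef gcmA k y = 0)) //.
- rewrite [coroot _ _ _](grading_der_root _ rx) -/(pairing A k alpha) pairingE.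
  rewrite /weyl_op (nexpZ nilE) (nexpZ nilG) (nexpZ nilE) -scaleNr -rmorphN /=.
  by congr (_%:~R *: _); ring.
- exact: linear0.
- by move=> y z; rewrite linearD => /= -> ->; rewrite addr0.
- by move=> b y; rewrite linearZ => /= ->; rewrite mulr0.
Qed.

End WeylOperator.

Definition sigma k : L -> L := weyl_op (raising k) (lower_opp k).
Definition sigmaV k : L -> L := weyl_op (opp_linear (raising k)) (opp_linear (lower_opp k)).

Lemma lower_opp_nil k : locally_nilpotent (lower_opp k).
Proof. exact/nilpotent_opp/lowering_nil. Qed.

Lemma sigma_root k alpha x : alpha <> alpha_ k -> root_space alpha x ->
  root_space (simple_refl A k *m alpha) (sigma k x).
Proof.
apply: weyl_op_root.
- exact: raising_nil.
- exact: lower_opp_nil.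
- by move=> y _; apply: low_coef_lie.
- by move=> y _ /=; rewrite linearN low_coef_lowering oppr0.
- exact: coroot_raising gcmA k.
- by move=> y /=; rewrite linearN coroot_lowering /=; module_over rat.
- by move=> y y0 /=; rewrite lieNr -(lowering_raising y0); module_over rat.
- by move=> beta y; apply: raising_root.
- by move=> beta y /(lowering_root gcmA k) ry; have := root_spaceZ (-1) ry; rewrite scaleN1r.
Qed.

Lemma sigmaV_root k alpha x : alpha <> alpha_ k -> root_space alpha x ->
  root_space (simple_refl A k *m alpha) (sigmaV k x).
Proof.
apply: weyl_op_root.
- exact/nilpotent_opp/raising_nil.
- exact/nilpotent_opp/lower_opp_nil.
- by move=> y _ /=; rewrite linearN low_coef_lie oppr0.
- by move=> y _ /=; rewrite opprK low_coef_lowering.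
- by move=> y /=; rewrite linearN (coroot_raising gcmA) /=; module_over rat.
- by move=> y /=; rewrite !opprK coroot_lowering.
- move=> y y0 /=; rewrite !opprK linearN -(lowering_raising y0).
  by module_over rat.
- by move=> beta y /(raising_root k) ry; have := root_spaceZ (-1) ry; rewrite scaleN1r.
- by move=> beta y ry /=; rewrite opprK; apply: lowering_root.
Qed.

Lemma opp_linearK (D : {linear L -> L}) : opp_linear (opp_linear D) =1 D.
Proof. by move=> x /=; rewrite opprK. Qed.

Lemma eq_nexp (D D' : L -> L) : D =1 D' -> nexp D =1 nexp D'.
Proof. by move=> /funext ->. Qed.

Lemma sigmaK k : cancel (sigma k) (sigmaV k).
Proof.
move=> x; rewrite /sigma /sigmaV /weyl_op (nexp_oppK (raising_nil k)).
by rewrite (nexp_oppK (lower_opp_nil k)) (nexp_oppK (raising_nil k)).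
Qed.

Lemma sigmaVK k : cancel (sigmaV k) (sigma k).
Proof.
move=> x; rewrite /sigma /sigmaV /weyl_op.
have nE := nilpotent_opp (raising_nil k); have nG := nilpotent_opp (lower_opp_nil k).
have EK y : nexp (raising k) (nexp (opp_linear (raising k)) y) = y.
  by rewrite -(eq_nexp (opp_linearK (raising k))) (nexp_oppK nE).
have GK y : nexp (lower_opp k) (nexp (opp_linear (lower_opp k)) y) = y.
  by rewrite -(eq_nexp (opp_linearK (lower_opp k))) (nexp_oppK nG).
by rewrite EK GK EK.
Qed.

Lemma sigmaD k x y : sigma k (x + y) = sigma k x + sigma k y.
Proof.
rewrite /sigma /weyl_op (nexpD (raising_nil k)) (nexpD (lower_opp_nil k)).
exact: nexpD (raising_nil k) _ _.
Qed.

Lemma sigmaZ k a x : sigma k (a *: x) = a *: sigma k x.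
Proof.
rewrite /sigma /weyl_op (nexpZ (raising_nil k)) (nexpZ (lower_opp_nil k)).
exact: nexpZ (raising_nil k) _ _.
Qed.

Lemma sigma0 k : sigma k 0 = 0.
Proof. by rewrite -{1}(scale0r (0 : L)) sigmaZ scale0r. Qed.

Lemma sigma_neq0 k x : x != 0 -> sigma k x != 0.
Proof.
apply: contraNneq => sx0; rewrite -(sigmaK k x) sx0 -(sigma0 k) sigmaK //.
by rewrite sigma0.
Qed.

(** On the kernel of [low_coef] the correction terms of the lowering operator vanish, so it is a
    genuine derivation there and each of the three exponentials respects brackets. *)
Lemma sigma_lie k x y : low_coef gcmA k x = 0 -> low_coef gcmA k y = 0 ->
  sigma k (lie x y) = lie (sigma k x) (sigma k y).
Proof.
move=> x0 y0; pose W z := low_coef gcmA k z = 0.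
have W0 : W 0 by apply: linear0.
have WD u v : W u -> W v -> W (u + v) by rewrite /W linearD => /= -> ->; rewrite addr0.
have WZ a u : W u -> W (a *: u) by rewrite /W linearZ => /= ->; rewrite mulr0.
have WE u : W u -> W (raising k u) by move=> _; apply: low_coef_lie.
have WG u : W u -> W (lower_opp k u).
  by move=> _; rewrite /W /= linearN low_coef_lowering oppr0.
have eE := nexp_stable (raising_nil k) W0 WD WZ WE.
have eG := nexp_stable (lower_opp_nil k) W0 WD WZ WG.
have dE u v : W u -> W v -> raising k (lie u v) = lie (raising k u) v + lie u (raising k v).
  by move=> _ _; apply: lie_der.
have dG u v : W u -> W v ->
    lower_opp k (lie u v) = lie (lower_opp k u) v + lie u (lower_opp k v).
  move=> Wu Wv; rewrite /= lowering_lie Wu Wv !scale0r subr0 addr0 lieNl lieNr.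
  by module_over rat.
rewrite /sigma /weyl_op (nexp_lie WE WZ dE (raising_nil k)) //.
rewrite (nexp_lie WG WZ dG (lower_opp_nil k)); [|exact: eE|exact: eE].
by rewrite (nexp_lie WE WZ dE (raising_nil k)) //; apply/eG/eE.
Qed.

(** Real roots reached from a simple root by n reflections, where s_k is never applied to alpha_k
    itself, so that [sigma_root] is available at every step. *)
Inductive root_path : nat -> 'cV[int]_r -> Prop :=
| root_path0 i : root_path 0 (alpha_ i)
| root_pathS n alpha k : root_path n alpha -> alpha <> alpha_ k ->
    root_path n.+1 (simple_refl A k *m alpha).

Lemma root_path_vector n alpha : root_path n alpha ->
  exists2 x : L, root_space alpha x & x != 0.
Proof.
elim=> {n alpha} [i|n alpha k _ [x rx x0] ak].
  by exists (e i); [apply: root_space_e|apply: nplus_e_neq0].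
by exists (sigma k x); [apply: sigma_root|apply: sigma_neq0].
Qed.

Lemma root_path_pos n alpha : root_path n alpha ->
  (forall i, 0 <= alpha i 0) /\ 1 <= ht alpha.
Proof.
move=> /root_path_vector[x rx x0].
by case: (root_space_pos rx) => // /eqP; rewrite (negPf x0).
Qed.

Lemma root_path_neg n alpha k : root_path n alpha -> alpha <> - alpha_ k.
Proof.
move=> /root_path_pos[/(_ k) + _] ak; rewrite ak !mxE !eqxx.
by [].
Qed.

(** The roots with a path, together with their negatives, are stable under the Weyl group: the
    excluded step merely sends alpha_k to -alpha_k. A positive root cannot be the negative of a root
    with a path, because the latter has nonnegative coordinates and positive height. *)
Lemma real_root_path alpha : pos_real_root A alpha -> exists n, root_path n alpha.
Proof.
pose Q v := (exists n, root_path n v) \/ (exists n, root_path n (- v)).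
have Qs k v : Q v -> Q (simple_refl A k *m v).
  have half u : (exists n, root_path n u) -> Q (simple_refl A k *m u).
    move=> [n pu]; have [->|/eqP uk] := eqVneq u (alpha_ k).
      by right; exists 0%N; rewrite simple_refl_simple opprK; apply: root_path0.
    by left; exists n.+1; apply: root_pathS.
  by case=> /half // []; rewrite mulmxN ?opprK; [right|left].
have Qw w : weyl A w -> forall v, (Q v -> Q (uval w *m v)) /\ (Q v -> Q (uinv w *m v)).
  elim=> {w} [w [k wk] v|v|x y _ IHx _ IHy v|x _ IHx v] /=.
  - rewrite wk; split; first exact: Qs.
    suff -> : uinv w = simple_refl A k by apply: Qs.
    have kk : simple_refl A k *m simple_refl A k = 1%:M.
      apply/matrixP => i j; have := simple_reflK k (delta_mx j 0).
      by rewrite mulmxA -colE => /matrixP/(_ i 0); rewrite !mxE eqxx andbT.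
    have wV : simple_refl A k *m uinv w = 1%:M by rewrite -wk; apply: uvalV.
    by rewrite -[uinv w]mul1mx -kk -mulmxA wV mulmx1.
  - by rewrite mul1mx.
  - rewrite -[uval x * uval y]/(uval x *m uval y) -[uinv y * uinv x]/(uinv y *m uinv x).
    rewrite -!mulmxA; split.
      by move/(IHy v).1/(IHx _).1.
    by move/(IHx v).2/(IHy _).2.
  - by split=> [/(IHx v).2|/(IHx v).1].
move=> [[w /Qw ww [i ->]] pos].
case: ((ww (alpha_ i)).1 _) => [|//|[n /root_path_pos[neg h1]]]; first by left; exists 0%N; apply: root_path0.
move: h1; rewrite /ht big1 // => j _; apply/eqP; rewrite eq_le neg andbT.
by rewrite mxE oppr_le0 pos.
Qed.

End Reflections.

Section WordMaps.
Variables (K : pzRingType) (L M : lieAlgType K).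

Lemma lie_word_map (T U : eqType) (f : T -> U) (a : U -> L) w :
  lie_word a (f w.1, map f w.2) = lie_word (a \o f) w.
Proof. by rewrite /lie_word /= -map_comp. Qed.

Lemma eq_lie_word (T : eqType) (a b : T -> L) w :
  {in letters w, a =1 b} -> lie_word a w = lie_word b w.
Proof.
move=> ab; rewrite /lie_word ab ?mem_head //; congr rnormed.
by apply/eq_in_map => t tw; rewrite ab // inE tw orbT.
Qed.

Lemma lie_word_morph (T : eqType) (f : L -> M) (W : L -> Prop) (a : T -> L) w :
  (forall x y, W x -> W y -> W (lie x y)) ->
  (forall x y, W x -> W y -> f (lie x y) = lie (f x) (f y)) -> (forall t, W (a t)) ->
  W (lie_word a w) /\ f (lie_word a w) = lie_word (f \o a) w.
Proof.
move=> WL fL Wa; move: w; apply: word_ind => [t|t u s [IHW IHf]]; first by split; first exact: Wa.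
by rewrite !lie_wordS fL // -IHf; split=> //; apply: WL.
Qed.

End WordMaps.

(** * Real root spaces inside nilpotent algebras with two generators *)

Section RealRootVectors.
Variables (r : nat) (A : 'M[int]_r).
Hypothesis gcmA : gcm A.
Local Notation L := (nplus A).
Local Notation e := (nplus_e A).
Local Notation alpha_ := (@simple_root r).
Definition rank2 (i j : 'I_r) (t : bool) := e (if t then i else j).

Hypothesis rank2_nil : forall i j, i != j ->
  exists N, forall w, (N <= size w.2)%N -> lie_word (rank2 i j) w = 0.

(* The pair (a true, a false) is the image of (e_i, e_j) under a Weyl group *)
(* operator, and b true, b false are the corresponding images of the simple *)
(* roots.  That b true - b false is not a root replaces [f_i, e_j] = 0.     *)
Definition rank2_spanned n (alpha : 'cV[int]_r) :=
  exists (b : bool -> 'cV[int]_r) (a : bool -> L) (N : nat),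
  [/\ forall t, exists2 m, (m <= n)%N & root_path A m (b t),
      (forall t, root_space (b t) (a t) /\ a t != 0) /\ b true <> b false,
      forall t (x : L), root_space (b t - b (~~ t)) x -> x = 0,
      forall w, (N <= size w.2)%N -> lie_word a w = 0 &
      forall x : L, root_space alpha x -> lspan (range (lie_word a)) x].

(** The root s_k(alpha_j) is supported on {j, k}, so every word of this content uses only the
    letters e_k and e_j. *)
Lemma rank2_spanned0 j k : alpha_ j <> alpha_ k ->
  rank2_spanned 0 (simple_refl A k *m alpha_ j).
Proof.
move=> jk; have kj : k != j by apply/eqP => kj; rewrite kj in jk.
have [N nilN] := rank2_nil kj.
exists (fun t => alpha_ (if t then k else j)), (rank2 k j), N; split=> //.
- by move=> t; exists 0%N => //; apply: root_path0.
- split=> [t|kj']; first by split; [apply: root_space_e|apply: nplus_e_neq0].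
  by case: jk.
- move=> t x; apply: (root_space_neg (i := if t then j else k)).
  rewrite !mxE; case: t => /=; rewrite !eqxx ?(negPf kj) ?[j == k]eq_sym ?(negPf kj) //.
- move=> x /root_space_words; apply: lspan_mono => _ [w cw <-].
  have lw : {in letters w, forall l, (l == k) || (l == j)}.
    move=> l lw; apply/norP => -[lk lj].
    have cl : content w l 0 = 0.
      by rewrite cw simple_reflE !mxE (negPf lk) (negPf lj) /= mulr0 subr0.
    move: lw; rewrite -has_pred1 has_count.
    by have := content_ge l w; rewrite cl => /eqP; rewrite eqz_nat => /eqP <-.
  exists (w.1 == k, map (pred1 k) w.2) => //.
  rewrite (lie_word_map (pred1 k)); apply: eq_lie_word => l /lw /=.
  by rewrite /rank2; case: eqP => [->|_ /eqP ->].
Qed.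

(** If neither root of the pair is alpha_k, the pair is transported by [sigma]. Otherwise the pair
    is kept: the algebra that it generates contains e_k and is stable under f_k, hence under
    [sigma]. *)
Lemma rank2_spannedS n m alpha k : root_path A m alpha -> alpha <> alpha_ k ->
  rank2_spanned n alpha -> rank2_spanned n.+1 (simple_refl A k *m alpha).
Proof.
move=> pa ak [b [a [N [bp [ra bTF] bD nilN sp]]]].
pose s := sigma gcmA k.
have preim x : root_space (simple_refl A k *m alpha) x ->
    exists2 y, root_space alpha y & x = s y.
  move=> rx; exists (sigmaV gcmA k x); last by rewrite /s sigmaVK.
  rewrite -[alpha](simple_reflK gcmA k); apply: sigmaV_root => // sk.
  apply: (root_path_neg gcmA pa (k := k)).
  by rewrite -[alpha](simple_reflK gcmA k) sk simple_refl_simple.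
have slin (T : L -> Prop) (S : set L) : (forall x, S x -> T (s x)) -> T 0 ->
    (forall x y, T x -> T y -> T (x + y)) -> (forall c x, T x -> T (c *: x)) ->
    forall x, lspan S x -> T (s x).
  move=> ST T0 TD TZ x; elim=> {x}; first exact: ST.
  - by rewrite /s sigma0.
  - by move=> x y _ Tx _ Ty; rewrite /s sigmaD; apply: TD.
  - by move=> c x _ Tx; rewrite /s sigmaZ; apply: TZ.
have bp' t : exists2 m, (m <= n.+1)%N & root_path A m (b t).
  by have [l ln pl] := bp t; exists l => //; apply: leqW.
have [bk|bk] := pselect (forall t, b t <> alpha_ k).
  have Wa t : low_coef gcmA k (a t) = 0.
    by have [/bk|] := low_coef_root gcmA k (ra t).1.
  have word_s w : s (lie_word a w) = lie_word (s \o a) w.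
    have [] // := lie_word_morph (f := s) (W := fun x => low_coef gcmA k x = 0) w _ _ Wa.
    - by move=> *; apply: low_coef_lie.
    - by move=> *; apply: sigma_lie.
  exists (fun t => simple_refl A k *m b t), (s \o a), N; split.
  - move=> t; have [l ln pl] := bp t; exists l.+1 => //; exact: root_pathS (bk t).
  - split=> [t|]; last by move/(can_inj (simple_reflK gcmA k)).
    by have [rt at0] := ra t; split; [apply: sigma_root|apply: sigma_neq0].
  - move=> t x; rewrite -mulmxBr => rx.
    (* If the reflected difference were alpha_k, the opposite difference of the old pair would also
       be alpha_k, and its root space would contain the nonzero vector e_k. *)
    have [sk|sk] := pselect (simple_refl A k *m (b t - b (~~ t)) = alpha_ k).
      have ek : root_space (b (~~ t) - b (~~ ~~ t)) (e k).
        rewrite negbK -opprB -[b t - _](simple_reflK gcmA k) sk.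
        by rewrite simple_refl_simple // opprK; apply: root_space_e.
      by move/bD/eqP: ek; rewrite (negPf (nplus_e_neq0 gcmA k)).
    have := sigmaV_root gcmA sk rx; rewrite simple_reflK // => /bD x0.
    by rewrite -[x](sigmaVK gcmA k) x0 sigma0.
  - by move=> w Nw; rewrite -word_s nilN // /s sigma0.
  - move=> x /preim[y /sp spy ->].
    apply: slin spy => //; [|exact: lspan0|exact: lspanD|exact: lspanZ].
    by move=> _ [w _ <-]; rewrite word_s; apply: lspan_in; exists w.
(* The second case. The vector [a t] is a multiple of e_k, and lowering kills the other vector
   because the difference of its root with alpha_k is not a root. *)
have [t bt] : exists t, b t = alpha_ k.
  by apply: contrapT => nb; apply: bk => t bt; apply: nb; exists t.
have bnt : b (~~ t) <> alpha_ k by rewrite -bt; case: (t) bTF => /= bTF; auto.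
have bE u : u <> t -> u = ~~ t by case: u t {bt bnt} => -[].
exists b, a, N; split=> //.
move=> x /preim[y /sp spy ->] {x}.
have [c atE] : exists c, a t = c *: e k.
  by have [rt _] := ra t; rewrite bt in rt; apply: root_space_simple.
have c0 : c != 0 by have [_] := ra t; rewrite atE scaler_eq0 negb_or => /andP[].
pose M := lspan (range (lie_word a)).
have ME x : M x -> M (lie (e k) x).
  have -> : e k = c^-1 *: a t by rewrite atE scalerA mulVf ?scale1r.
  apply: lspan_linear; try by [exact: lspan0|exact: lspanD|exact: lspanZ].
  move=> _ [w _ <-] /=; rewrite lieZl; apply/lspanZ/lspan_in.
  by exists (t, letters w) => //; rewrite /letters lie_wordS -surjective_pairing.
have Ma u x : M x -> M (lie (a u) x).
  apply: lspan_linear; try by [exact: lspan0|exact: lspanD|exact: lspanZ].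
  move=> _ [w _ <-]; apply: lspan_in.
  by exists (u, letters w) => //; rewrite /letters lie_wordS -surjective_pairing.
have Mw w : M (lie_word a w) by apply: lspan_in; exists w.
have Fa u : lowering gcmA k (a u) = 0.
  have [->|/eqP ut] := eqVneq u t; first by rewrite atE linearZ /= lowering_e scaler0.
  rewrite (bE _ ut); apply: (bD (~~ t)); rewrite negbK bt.
  by apply: lowering_root; case: (ra (~~ t)).
have ha u : exists d, coroot A k (a u) = d *: a u.
  by exists (pairing A k (b u)); apply: grading_der_root; case: (ra u).
have hw w : M (coroot A k (lie_word a w)).
  move: w; apply: word_ind => [u|u v q IH].
    by have [d ->] := ha u; apply/lspanZ/(Mw (u, [::])).
  rewrite lie_wordS /coroot grading_der_lie -/(coroot A k); apply: lspanD (Ma _ _ IH).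
  by have [d ->] := ha u; rewrite lieZl; apply/lspanZ/Ma/Mw.
have Fw w : M (lowering gcmA k (lie_word a w)).
  move: w; apply: word_ind => [u|u v q IH].
    by rewrite lie_word1 Fa; apply: lspan0.
  rewrite lie_wordS lowering_lie Fa lie0l addr0 -scaleNr.
  do 2?apply: lspanD; first exact: Ma.
    by apply: lspanZ; have [d ->] := ha u; apply/lspanZ/(Mw (u, [::])).
  exact/lspanZ/hw.
have MG x : M x -> M (lower_opp gcmA k x).
  apply: lspan_linear; try by [exact: lspan0|exact: lspanD|exact: lspanZ].
  by move=> _ [w _ <-] /=; apply: lspanN (Fw w).
have Me x : M x -> M (nexp (raising A k) x).
  apply: nexp_stable; [exact: raising_nil|exact: lspan0|exact: lspanD|exact: lspanZ|exact: ME].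
have Mg x : M x -> M (nexp (lower_opp gcmA k) x).
  apply: nexp_stable; [exact: lower_opp_nil|exact: lspan0|exact: lspanD|exact: lspanZ|exact: MG].
by rewrite /s /sigma /weyl_op; apply/Me/Mg/Me.
Qed.

Lemma root_path_spanned n alpha : root_path A n.+1 alpha -> rank2_spanned n alpha.
Proof.
elim: n alpha => [|n IHn] alpha pa; inversion_clear pa as [|m beta k pb bk].
  by inversion pb as [j e1 e2|]; subst; apply: rank2_spanned0.
exact: rank2_spannedS pb bk (IHn _ pb).
Qed.

End RealRootVectors.

(** * Finite rank 2 Weyl groups and nilpotency *)

Section TwoSpherical.
Variables (r : nat) (A : 'M[int]_r).
Hypothesis gcmA : gcm A.

Lemma simple_refl_sqr k : simple_refl A k *m simple_refl A k = 1%:M.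
Proof.
apply/matrixP => i j; have := simple_reflK gcmA k (delta_mx j 0).
by rewrite mulmxA -colE => /matrixP/(_ i 0); rewrite !mxE eqxx andbT.
Qed.

Definition refl_unit k : units 'M[int]_r := Units (simple_refl_sqr k) (simple_refl_sqr k).

Lemma refl_rank2 p q (x y : int) : p != q ->
  simple_refl A p *m (simple_refl A q *m (x *: simple_root p + y *: simple_root q)) =
  ((A p q * A q p - 1) * x + A p q * y) *: simple_root p + (- A q p * x - y) *: simple_root q.
Proof.
move=> pq; have ip u v : int_pairing A u (simple_root v) = A u v.
  rewrite /int_pairing (bigD1 v) //= mxE !eqxx mulr1 big1 ?addr0 // => l /negPf lv.
  by rewrite mxE lv mulr0.
have sr u v : simple_refl A u *m simple_root v = simple_root v - A u v *: simple_root u.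
  by rewrite simple_reflE ip.
rewrite !mulmxDr -!scalemxAr !sr !mulmxBr -!scalemxAr !sr.
by case: (gcmA) => Aii _ _; rewrite !Aii; module_over int.
Qed.

(** When the product is at least 4, the powers of s_p s_q send alpha_p to vectors whose p-coordinate
    strictly increases, so the Weyl group is infinite. *)
Lemma spherical_rank2 p q : spherical A -> p != q -> A p q * A q p <= 3.
Proof.
move=> finW pq; rewrite leNgt; apply/negP => bc.
case: (gcmA) => _ /(_ _ _ pq) b0 _.
have c0 : A q p <= 0 by case: (gcmA) => _ /(_ q p) + _; apply; rewrite eq_sym.
pose w n : units 'M[int]_r := ((refl_unit p * refl_unit q) ^+ n)%g.
have ww n : weyl A (w n).
  elim: n => [|n IHn]; first exact: gen_1.
  rewrite /w expgS; apply: gen_M => //; apply: gen_M; apply: gen_in.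
    by exists p.
  by exists q.
(* The bound 2y < -a_qp x is the invariant that closes the induction: since a_pq a_qp is at least 4,
   it is inherited by the next power and makes x grow. *)
have step n : exists x y : int, [/\ uval (w n) *m simple_root p = x *: simple_root p + y *: simple_root q,
    0 < x, 0 <= y & 2 * y < - A q p * x].
  elim: n => [|n [x [y [wn x0 y0 yx]]]].
    exists 1, 0; rewrite /w expg0 /= mul1mx scale1r scale0r addr0; split=> //.
    by nia.
  exists ((A p q * A q p - 1) * x + A p q * y), (- A q p * x - y).
  rewrite -refl_rank2 // -wn; split.
  - by rewrite /w expgS /= !mulmxA.
  - by nia.
  - by nia.
  - by nia.
pose X n := (uval (w n) *m simple_root p) p 0.
have XE (x y : int) : (x *: simple_root p + y *: simple_root q) p 0 = x.
  by rewrite !mxE !eqxx (negPf pq) mulr1 mulr0 addr0.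
have Xlt n : X n < X n.+1.
  have [x [y [wn x0 y0 yx]]] := step n; rewrite /X wn XE.
  rewrite /w expgS -[uval (_ * _)%g]/(simple_refl A p *m simple_refl A q *m uval (w n)).
  by rewrite -!mulmxA wn refl_rank2 // XE; nia.
have w_inj : injective w.
  have Xmono := homo_ltn (@lt_trans _ int) Xlt.
  move=> m n mn; have XX : X m = X n by rewrite /X mn.
  by case: (ltngtP m n) => // /Xmono; rewrite XX ltxx.
apply: infinite_nat; apply: sub_finite_set (finite_preimage (f := w) _ finW).
  by move=> n _; apply: ww.
by move=> m n _ _; apply: w_inj.
Qed.

End TwoSpherical.

Lemma two_spherical_rank2 (r : nat) (A : 'M[int]_r) (i j : 'I_r) :
  gcm A -> two_spherical A -> i != j -> A i j * A j i <= 3.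
Proof.
move=> [Aii Aneg A0] sph ij; pose J := [set i; j]%SET.
have cJ : #|J| = 2 by rewrite cards2 ij.
have Ji : i \in J by rewrite !inE eqxx.
have Jj : j \in J by rewrite !inE eqxx orbT.
have gB : gcm (principal_submx A J).
  split=> [k|k l kl|k l]; rewrite !mxE //.
  by apply: Aneg; rewrite (inj_eq enum_val_inj).
have := @spherical_rank2 _ _ gB (enum_rank_in Ji i) (enum_rank_in Ji j).
rewrite !mxE !enum_rankK_in //; apply; first by apply: sph; rewrite cJ.
by rewrite -(inj_eq enum_val_inj) !enum_rankK_in.
Qed.

Section G2Nilpotency.
Variables (K : numFieldType) (L : lieAlgType K) (X Y : L).
Hypotheses (XXY : lie X (lie X Y) = 0) (YYYYX : lie Y (lie Y (lie Y (lie Y X))) = 0).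

Let d2 := lie Y X.
Let d3 := lie Y d2.
Let d4 := lie Y d3.
Let d5 := lie X d4.

Let Xd2 : lie X d2 = 0. Proof. by rewrite /d2 [lie Y X]lieC lieNr XXY oppr0. Qed.
Let Xd3 : lie X d3 = 0.
Proof. by rewrite /d3 lie_der Xd2 lie0r addr0 [lie X Y]lieC lieNl liexx oppr0. Qed.
Let Yd4 : lie Y d4 = 0. Proof. exact: YYYYX. Qed.
Let d5E : d5 = - lie d2 d3.
Proof. by rewrite /d5 {1}/d4 lie_der Xd3 lie0r addr0 [lie X Y]lieC lieNl. Qed.
Let Xd5 : lie X d5 = 0.
Proof. by rewrite d5E lieNr lie_der Xd2 lie0l Xd3 lie0r addr0 oppr0. Qed.
(** Expanding d5 in its two forms gives two opposite values of [Y, d5], and 2 is invertible. *)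
Let Yd5 : lie Y d5 = 0.
Proof.
have Y1 : lie Y d5 = lie d2 d4 by rewrite /d5 lie_der Yd4 lie0r addr0.
have Y2 : lie Y d5 = - lie d2 d4.
  by rewrite {1}d5E lieNr lie_der -/d3 liexx add0r.
have /eqP : lie Y d5 + lie Y d5 = 0 by rewrite {1}Y1 Y2 addrN.
by rewrite -mulr2n -scaler_nat scaler_eq0 pnatr_eq0 => /eqP.
Qed.

(** The vectors d2, d3, d4, d5 correspond to the non-simple positive roots of G_2, of heights 2 to
    5. Words of those lengths are multiples of them, and both generators kill d5. *)
Lemma lie_word_G2 w : (5 <= size w.2)%N ->
  lie_word (fun t : bool => if t then X else Y) w = 0.
Proof.
pose line (x y : L) := exists c : K, y = c *: x.
have l0 x : line x 0 by exists 0; rewrite scale0r.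
have step x y y' z t : line y (lie X x) -> line y (lie Y x) ->
    y' = y -> line x z -> line y' (lie (if t then X else Y) z).
  move=> [a Xx] [b Yx] -> [c ->]; rewrite lieZr; case: t.
    by exists (c * a); rewrite Xx scalerA.
  by exists (c * b); rewrite Yx scalerA.
have l1 x : line x x by exists 1; rewrite scale1r.
case: w => t [//|t1 [//|t2 [//|t3 [//|t4 [//|t5 s]]]]].
suff: forall s t, [/\ size s = 1%N -> line d2 (lie_word (fun t : bool => if t then X else Y) (t, s)),
   size s = 2%N -> line d3 (lie_word (fun t : bool => if t then X else Y) (t, s)),
   size s = 3%N -> line d4 (lie_word (fun t : bool => if t then X else Y) (t, s)),
   size s = 4%N -> line d5 (lie_word (fun t : bool => if t then X else Y) (t, s)) &
   (5 <= size s)%N -> lie_word (fun t : bool => if t then X else Y) (t, s) = 0].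
  by move=> /(_ [:: t1, t2, t3, t4, t5 & s] t)[_ _ _ _ ->].
move=> {t1 t2 t3 t4 t5 t} q; elim: q => [|u q IHq] t; first by split.
have [I1 I2 I3 I4 I5] := IHq u; split=> [[qs]|[qs]|[qs]|[qs]|qs]; rewrite lie_wordS.
- case: (q) qs => // _; rewrite lie_word1; case: t u {IHq I1 I2 I3 I4 I5} => -[]; rewrite ?liexx //.
  by rewrite lieC; exists (-1); rewrite scaleN1r.
- by apply: (@step d2 d3); rewrite ?Xd2 //; apply: I1.
- by apply: (@step d3 d4); rewrite ?Xd3 //; apply: I2.
- by apply: (@step d4 d5); rewrite ?Yd4 //; apply: I3.
- have [qs4|] := eqVneq (size q) 4%N.
    by have [c ->] := I4 qs4; rewrite lieZr; case: t; rewrite ?Xd5 ?Yd5 scaler0.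
  by move=> q4; rewrite I5 ?lie0r //; move: qs q4; rewrite ltnS leq_eqVlt eq_sym => /orP[->|].
Qed.

End G2Nilpotency.

(** Both entries vanish together and have product at most 3, so up to exchanging i and j one is at
    least -1 and the other at least -3. The relations of G_2 therefore hold for every admissible
    pair. *)
Lemma two_spherical_nil (r : nat) (A : 'M[int]_r) (i j : 'I_r) :
  gcm A -> two_spherical A -> i != j ->
  forall w, (5 <= size w.2)%N -> lie_word (rank2 A i j) w = 0.
Proof.
move=> gA sA.
have half k l : k != l -> - 1 <= A k l -> - 3 <= A l k ->
    forall w, (5 <= size w.2)%N -> lie_word (rank2 A k l) w = 0.
  move=> kl Akl Alk w w5.
  have nil u v n : u != v -> - n%:Z <= A u v ->
      iter n.+1 (raising A u) (nplus_e A v) = 0.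
    move=> uv Auv; have [p _ Ap] := serre_exp gA uv.
    apply: (iter_nil_ge (N := p.+1)); last by rewrite ltnS -lez_nat -lerN2 -Ap.
    by rewrite iter_raising (serre_pi0 (serre_term_rel gA uv Ap)).
  rewrite -[LHS]/(lie_word _ _) (eq_lie_word (b := fun t : bool => if t then nplus_e A k else nplus_e A l)).
    apply: lie_word_G2 => //; first exact: (nil k l 1%N).
    by apply: (nil l k 3%N) => //; rewrite eq_sym.
  by move=> [] _.
move=> ij w w5; have prod := two_spherical_rank2 gA sA ij.
have ji : j != i by rewrite eq_sym.
have [p _ Ap] := serre_exp gA ij; have [q _ Aq] := serre_exp gA ji.
have pq0 : (p == 0%N) = (q == 0%N).
  case: gA => _ _ /(_ i j); rewrite Ap Aq => A0; apply/eqP/eqP => pq.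
    by have /A0.1/eqP : - p%:Z = 0 := congr1 (fun n : nat => - n%:Z) pq; rewrite oppr_eq0 => /eqP[].
  by have /A0.2/eqP : - q%:Z = 0 := congr1 (fun n : nat => - n%:Z) pq; rewrite oppr_eq0 => /eqP[].
have pq3 : (p * q <= 3)%N by move: prod; rewrite Ap Aq mulrNN -PoszM lez_nat.
have [p1|p1] := leqP p 1.
  by apply: half => //; rewrite ?Ap ?Aq; case: p q p1 pq0 pq3 {Ap Aq prod} => [|[|//]] [|[|[|[|]]]].
have -> : lie_word (rank2 A i j) w = lie_word (rank2 A j i) (~~ w.1, map negb w.2).
  rewrite lie_word_map; apply: eq_lie_word => t _ /=.
  by rewrite /rank2; case: t.
apply: half; rewrite ?size_map // ?Ap ?Aq;
  case: p q p1 pq0 pq3 {Ap Aq prod} => [|[|[|[|p]]]] // [|[|q]] // _ _; by rewrite ?mulnS //=; lia.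
Qed.

(** * Units of Lie type *)

Section LogarithmicDerivative.
Variables (K : numFieldType) (U : algType K) (G : pieces U).
Local Notation C := (completion G).
Implicit Types f g h : C.

Definition cdeg f : C := Completion (fun n => pieceZ n%:R (hcompP f n)).

Lemma hcompD f g n : (f + g) n = f n + g n. Proof. by []. Qed.

Lemma cdegE f n : cdeg f n = n%:R *: f n. Proof. by []. Qed.

Lemma cdegD f g : cdeg (f + g) = cdeg f + cdeg g.
Proof. by apply/completion_eq => n /=; rewrite scalerDr. Qed.

Lemma cdegZ a f : cdeg (a *: f) = a *: cdeg f.
Proof. by apply/completion_eq => n /=; rewrite !scalerA mulrC. Qed.

Lemma cdegN f : cdeg (- f) = - cdeg f.
Proof. by rewrite -!scaleN1r cdegZ. Qed.

Lemma cdeg1 : cdeg 1 = 0.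
Proof. by apply/completion_eq => -[|n] /=; rewrite ?scale0r ?scaler0. Qed.

Lemma cdegM f g : cdeg (f * g) = cdeg f * g + f * cdeg g.
Proof.
apply/completion_eq => n; rewrite hcompD cdegE !hcompM scaler_sumr -big_split /=.
apply: eq_bigr => i _; rewrite -scalerAl -scalerAr -scalerDl -natrD.
by rewrite subnKC // -ltnS.
Qed.

Lemma hcompN f n : (- f) n = - f n.
Proof. exact: scaleN1r. Qed.

Lemma hcompB f g n : (f - g) n = f n - g n.
Proof. by rewrite -hcompN. Qed.

Lemma hcomp1 n : (1 : C) n = (n == 0%N)%:R.
Proof. by rewrite /=; case: eqP. Qed.

Definition low (n : nat) f := forall i, (i < n)%N -> f i = 0.

Lemma low_add n f g : low n f -> low n g -> low n (f + g).
Proof. by move=> nf ng i ni /=; rewrite nf // ng // addr0. Qed.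

Lemma low_opp n f : low n f -> low n (- f).
Proof. by move=> nf i ni; rewrite hcompN nf // oppr0. Qed.

Lemma lowW m n f : (m <= n)%N -> low n f -> low m f.
Proof. by move=> mn nf i im; apply: nf; apply: leq_trans im mn. Qed.

Lemma low_mul m n f g : low m f -> low n g -> low (m + n) (f * g).
Proof.
move=> mf ng i imn; rewrite hcompM big1 // => j _.
case: (ltnP j m) => jm; first by rewrite mf // mul0r.
by rewrite ng ?mulr0 //; move: (ltn_ord j) imn jm; lia.
Qed.

Lemma low_mul_lead m n f g : low m f -> low n g -> (f * g) (m + n)%N = f m * g n.
Proof.
move=> mf ng; rewrite hcompM.
have lm : (m < (m + n).+1)%N by rewrite ltnS leq_addr.
rewrite (bigD1 (Ordinal lm)) //= addKn big1 ?addr0 // => j jm.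
case: (ltngtP j m) => [jl|jl|jE]; first by rewrite mf // mul0r.
  by rewrite ng ?mulr0 //; move: (ltn_ord j) jl; lia.
by case/eqP: jm; apply: val_inj.
Qed.

Lemma low0 f : low 0 f. Proof. by []. Qed.

Lemma low_all f : (forall n, low n f) -> f = 0.
Proof. by move=> lf; apply/completion_eq => n; apply: (lf n.+1). Qed.

Lemma low_mull n f g : low n f -> low n (g * f).
Proof. by move=> nf; apply: (low_mul (low0 g) nf). Qed.
Lemma low_mulr n f g : low n f -> low n (f * g).
Proof. by move=> nf; rewrite -[n]addn0; apply: (low_mul nf (low0 g)). Qed.

(** As l has no constant term, the equation expresses n times the component of degree n through
    components of lower degree. *)
Lemma cdeg_unique f g (l : C) : f 0%N = g 0%N -> l 0%N = 0 ->
  cdeg f = f * l -> cdeg g = g * l -> f = g.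
Proof.
move=> fg0 l0 fl gl; suff: f - g = 0 by move/eqP; rewrite subr_eq0 => /eqP.
apply: low_all; elim=> [//|n IHn] i; rewrite ltnS leq_eqVlt => /orP[/eqP ->|/IHn//].
have [->|n0] := posnP n; first by rewrite hcompB fg0 subrr.
have /(congr1 (fun h : C => h n)) : cdeg (f - g) = (f - g) * l.
  by rewrite cdegD cdegN fl gl mulrBl.
rewrite cdegE hcompM big1 => [/eqP|j _].
  by rewrite scaler_eq0 pnatr_eq0 -leqn0 leqNgt n0 => /eqP.
case: (ltnP j n) => jn; first by rewrite IHn // mul0r.
have -> : (n - j)%N = 0%N by apply/eqP; rewrite subn_eq0.
by rewrite l0 mulr0.
Qed.

Section Unit.
Variable g : units C.
Hypothesis g0 : uval g 0%N = 1.

Lemma uinv0 : uinv g 0%N = 1.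
Proof.
have /(congr1 (fun h : C => h 0%N)) := uvalV g.
by rewrite hcompM big_ord1 g0 mul1r.
Qed.

Definition ell := uinv g * cdeg (uval g).

Lemma ell0 : ell 0%N = 0.
Proof. by rewrite hcompM big_ord1 cdegE scale0r mulr0. Qed.

Lemma cdeg_ell : cdeg (uval g) = uval g * ell.
Proof. by rewrite mulrA uvalV mul1r. Qed.

Lemma cdeg_uinv : cdeg (uinv g) = - (ell * uinv g).
Proof.
have := cdegM (uinv g) (uval g); rewrite uVval cdeg1 => /esym/eqP.
rewrite addr_eq0 => /eqP /(congr1 (fun f => f * uinv g)).
by rewrite -mulrA uvalV mulr1 mulNr -/ell.
Qed.

Lemma cdeg_conj y : let u := uinv g * y * uval g in
  cdeg u = u * ell - ell * u + uinv g * cdeg y * uval g.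
Proof.
rewrite /= !cdegM cdeg_uinv cdeg_ell mulrDl !mulNr !mulrA.
by module_over K.
Qed.

Lemma low_conj n y : low n y -> low n (uinv g * y * uval g).
Proof. by move=> /(low_mull (uinv g)); apply: low_mulr. Qed.

Lemma conj_lead n y : low n y -> (uinv g * y * uval g) n = y n.
Proof.
move=> ny; rewrite -[n in LHS]addn0 (low_mul_lead (low_mull _ ny) (low0 _)) g0 mulr1.
by rewrite -[n in LHS]add0n (low_mul_lead (low0 _) ny) uinv0 mul1r.
Qed.

Lemma ell_lead n : (0 < n)%N -> low n (uval g - 1) -> ell n = n%:R *: uval g n.
Proof.
move=> n0 ng.
have cn : low n (cdeg (uval g)).
  move=> i ni; rewrite cdegE; case: i ni => [|i] ni; first by rewrite scale0r.
  by have := ng _ ni; rewrite hcompB hcomp1 subr0 => ->; rewrite scaler0.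
by rewrite -[n in LHS]add0n (low_mul_lead (low0 _) cn) uinv0 mul1r.
Qed.

End Unit.

Lemma ellM (g h : units C) : ell (g * h)%g = uinv h * ell g * uval h + ell h.
Proof. by rewrite /ell /= cdegM mulrDr !mulrA -[uinv h * uinv g * uval g]mulrA uVval mulr1. Qed.

Lemma ellV (g : units C) : ell g^-1%g = - (uval g * ell g * uinv g).
Proof. by rewrite /ell /= cdeg_uinv mulrN !mulrA. Qed.

(** From [g,h] - 1 = (hg)^-1 ((g-1)(h-1) - (h-1)(g-1)), where (hg)^-1 has constant term 1. *)
Lemma comm_low (g h : units C) m n : (0 < m)%N -> (0 < n)%N ->
  low m (uval g - 1) -> low n (uval h - 1) ->
  low (m + n) (uval [~ g, h]%g - 1) /\
  uval [~ g, h]%g (m + n)%N = uval g m * uval h n - uval h n * uval g m.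
Proof.
move=> m0 n0 mg nh; set g1 := uval g - 1 in mg *; set h1 := uval h - 1 in nh *.
have E : uval [~ g, h]%g - 1 = uinv (h * g)%g * (g1 * h1 - h1 * g1).
  have -> : g1 * h1 - h1 * g1 = uval g * uval h - uval h * uval g.
    by rewrite /g1 /h1 !mulrBl !mulrBr !mul1r !mulr1; module_over K.
  rewrite mulrBr -[uval h * uval g]/(uval (h * g)%g) uVval; congr (_ - _).
  by rewrite /commg /conjg /= !mulrA.
have lo : low (m + n) (g1 * h1 - h1 * g1).
  by apply/low_add/low_opp; [|rewrite addnC]; apply: low_mul.
have nz k : (0 < k)%N -> (1 : C) k = 0 by rewrite hcomp1; case: k.
rewrite E; split; first exact: low_mull.
have mn0 : (0 < m + n)%N by rewrite addn_gt0 m0.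
have g1m : g1 m = uval g m by rewrite /g1 hcompB nz ?subr0.
have h1n : h1 n = uval h n by rewrite /h1 hcompB nz ?subr0.
have hg0 : uval (h * g)%g 0%N = 1.
  have e0 k (u : units C) : (0 < k)%N -> low k (uval u - 1) -> uval u 0%N = 1.
    by move=> k0 /(_ 0%N k0)/eqP; rewrite hcompB subr_eq0 => /eqP ->; rewrite hcomp1.
  by rewrite /= big_ord1 (e0 n) // (e0 m) // mulr1.
have -> : uval [~ g, h]%g (m + n)%N = (uval [~ g, h]%g - 1) (m + n)%N.
  by rewrite hcompB nz ?subr0.
rewrite E -[in LHS](add0n (m + n)%N) (low_mul_lead (low0 _) lo) uinv0 // mul1r.
by rewrite hcompB (low_mul_lead mg nh) (addnC m n) (low_mul_lead nh mg) g1m h1n.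
Qed.

Lemma low_unitE (u : units C) k i : (0 < i < k)%N -> low k (uval u - 1) -> uval u i = 0.
Proof.
by move=> /andP[i0 ik] /(_ i ik); rewrite hcompB hcomp1 gtn_eqF // subr0.
Qed.

Lemma low_unitM (u v : units C) n : (0 < n)%N -> low n (uval u - 1) ->
  low n (uval v - 1) ->
  low n (uval (u * v)%g - 1) /\ uval (u * v)%g n = uval u n + uval v n.
Proof.
move=> n0 nu nv; pose u1 := uval u - 1; pose v1 := uval v - 1.
have E : uval (u * v)%g - 1 = u1 + v1 + u1 * v1.
  by rewrite /u1 /v1 /= mulrBl !mulrBr !mul1r !mulr1; module_over K.
have uv : low (n + n) (u1 * v1) by apply: low_mul.
rewrite E; split.
  by apply: low_add; [apply: low_add|apply: lowW uv; rewrite leq_addr].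
have -> : uval (u * v)%g n = (uval (u * v)%g - 1) n.
  by rewrite hcompB hcomp1 gtn_eqF // subr0.
rewrite E (hcompD (u1 + v1)) (hcompD u1) [X in _ + X]uv ?addr0; last by rewrite -[X in (X < _)%N]addn0 ltn_add2l.
by rewrite /u1 /v1 !hcompB hcomp1 gtn_eqF // !subr0.
Qed.

Lemma low_unitV (u : units C) n : (0 < n)%N -> low n (uval u - 1) ->
  low n (uval u^-1%g - 1) /\ uval u^-1%g n = - uval u n.
Proof.
move=> n0 nu; have E : uval u^-1%g - 1 = - (uinv u * (uval u - 1)).
  by rewrite mulrBr uVval mulr1 opprB.
have lo : low n (uval u^-1%g - 1) by rewrite E; apply/low_opp/low_mull.
split=> //; have [_] := low_unitM n0 nu lo.
by rewrite mulgV hcomp1 gtn_eqF // => /esym/eqP; rewrite addrC addr_eq0 => /eqP.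
Qed.

Definition texp N f : C := \sum_(k < N) (k`!%:R)^-1 *: f ^+ k.

Lemma cexp_texp f n N : f 0%N = 0 -> (n < N)%N -> cexp f n = texp N f n.
Proof.
move=> f0 nN; rewrite hcomp_sum [RHS](bigID (fun k : 'I_N => (k < n.+1)%N)) /=.
rewrite [X in _ + X]big1 ?addr0; last first.
  by move=> k; rewrite -leqNgt => nk; rewrite hcompX_small ?scaler0.
by rewrite (big_ord_narrow nN).
Qed.

Lemma cexp_comm f g : f 0%N = 0 -> g * f = f * g -> g * cexp f = cexp f * g.
Proof.
move=> f0 fg; apply/completion_eq => n.
transitivity ((g * texp n.+1 f) n).
  rewrite !hcompM; apply: eq_bigr => i _; congr (_ * _).
  by apply: cexp_texp; rewrite // ltnS leq_subr.
transitivity ((texp n.+1 f * g) n).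
  congr (hcomp _ n); rewrite /texp mulr_sumr mulr_suml; apply: eq_bigr => k _.
  by rewrite -scalerAl -scalerAr; congr (_ *: _); apply: commrX.
rewrite !hcompM; apply: eq_bigr => i _; congr (_ * _).
by apply/esym/cexp_texp; rewrite // ltn_ord.
Qed.

Lemma cdeg_cexp f d : (0 < d)%N -> cdeg f = d%:R *: f ->
  cdeg (cexp f) = cexp f * (d%:R *: f).
Proof.
move=> d0 df.
have f0 : f 0%N = 0.
  have /(congr1 (fun h : C => h 0%N)) := df; rewrite cdegE scale0r /= => /esym/eqP.
  by rewrite scaler_eq0 pnatr_eq0 -leqn0 leqNgt d0 => /eqP.
have dfX k : cdeg (f ^+ k) = (k * d)%:R *: f ^+ k.
  elim: k => [|k IHk]; first by rewrite expr0 cdeg1 scale0r.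
  by rewrite exprS cdegM IHk df -scalerAl -scalerAr -scalerDl -natrD mulSn.
apply/completion_eq => n; rewrite cdegE.
rewrite (cexp_texp f0 (ltnW (ltnSn n.+1))) -cdegE.
transitivity ((texp n.+1 f * (d%:R *: f)) n); last first.
  rewrite !hcompM; apply: eq_bigr => i _; congr (_ * _).
  by apply/esym/cexp_texp; rewrite // ltn_ord.
congr (hcomp _ n); rewrite /texp (big_morph cdeg cdegD (_ : cdeg 0 = 0)); last first.
  by apply/completion_eq => i; rewrite /= scaler0.
rewrite big_ord_recl cdegZ expr0 cdeg1 scaler0 add0r mulr_suml.
apply: eq_bigr => k _; rewrite cdegZ dfX lift0 exprSr -scalerAl -scalerAr !scalerA.
congr (_ *: _); rewrite factS !natrM invfM mulrA; congr (_ * _).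
by rewrite mulrAC mulVf ?mul1r // pnatr_eq0.
Qed.

Lemma ell_cexp (u : units C) f d : (0 < d)%N -> cdeg f = d%:R *: f ->
  uval u = cexp f -> uval u 0%N = 1 /\ ell u = d%:R *: f.
Proof.
move=> d0 df uf; split.
  by rewrite uf /= big_ord1 fact0 invr1 scale1r.
by rewrite /ell uf (cdeg_cexp d0 df) -uf mulrA uVval mul1r.
Qed.

Lemma cdeg_homog d x (hx : G d x) : cdeg (homog hx) = d%:R *: homog hx.
Proof. by apply/completion_eq => n /=; case: eqP => [->|_] //; rewrite !scaler0. Qed.

Lemma cexp_homog_low d x (hx : G d x) (u : units C) : (0 < d)%N ->
  uval u = cexp (homog hx) -> low d (uval u - 1) /\ uval u d = x.
Proof.
move=> d0 ux; have [u0 ue] := ell_cexp d0 (cdeg_homog hx) ux.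
have lo : low d (uval u - 1).
  suff : forall n, (n <= d)%N -> low n (uval u - 1) by apply.
  elim=> [//|n IHn] nd i; rewrite ltnS leq_eqVlt => /orP[/eqP ->|]; last exact/IHn/ltnW.
  have [->|n0] := posnP n; first by rewrite hcompB u0 hcomp1 subrr.
  have un0 : n%:R *: uval u n = 0.
    by rewrite -(ell_lead u0 n0 (IHn (ltnW nd))) ue /= (ltn_eqF nd) scaler0.
  move/eqP: un0; rewrite scaler_eq0 pnatr_eq0 gtn_eqF // orFb => /eqP un0.
  by rewrite hcompB un0 hcomp1 gtn_eqF // subr0.
split=> //; have := ell_lead u0 d0 lo; rewrite ue /= eqxx => /scalerI -> //.
by rewrite pnatr_eq0 gtn_eqF.
Qed.

(** Both sides have constant term 1 and the same logarithmic derivative, so [cdeg_unique]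
    applies. *)
Lemma cexp_homogD d x y (hx : G d x) (hy : G d y) (hxy : G d (x + y))
    (u v w : units C) : (0 < d)%N -> x * y = y * x -> uval u = cexp (homog hx) ->
  uval v = cexp (homog hy) -> uval w = cexp (homog hxy) -> (u * v)%g = w.
Proof.
move=> d0 xy ux vy wxy; apply: units_eq.
have [u0 ue] := ell_cexp d0 (cdeg_homog hx) ux.
have [v0 ve] := ell_cexp d0 (cdeg_homog hy) vy.
have [w0 we] := ell_cexp d0 (cdeg_homog hxy) wxy.
have hD : homog hxy = homog hx + homog hy.
  by apply/completion_eq => n /=; case: eqP => _ //; rewrite addr0.
have hC : homog hx * homog hy = homog hy * homog hx.
  apply/completion_eq => n; rewrite !hcompM [RHS](reindex_inj rev_ord_inj).
  apply: eq_bigr => i _; have iN : (i <= n)%N by rewrite -ltnS.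
  rewrite /= subSS subKn //.
  by case: eqP => _; case: eqP => _ //; rewrite ?mul0r ?mulr0.
apply: (cdeg_unique (l := ell w)).
- by rewrite /= big_ord1 u0 v0 w0 mulr1.
- exact: ell0.
- rewrite -[LHS]/(cdeg (uval (u * v)%g)) cdeg_ell ellM ue ve we hD scalerDr.
  congr (_ * (_ + _)); rewrite -scalerAr -scalerAl -mulrA; congr (_ *: _).
  have hy0 : homog hy 0%N = 0 by rewrite /= ltn_eqF.
  by rewrite vy (cexp_comm hy0 hC) -vy mulrA uVval mul1r.
- exact: cdeg_ell.
Qed.

End LogarithmicDerivative.

Section LieTypeUnits.
Variables (K : numFieldType) (U : algType K) (G : pieces U) (L : lieAlgType K).
Variable io : {linear L -> U}.
Hypothesis io_lie : forall x y, io (lie x y) = io x * io y - io y * io x.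
Variable M : nat -> L -> Prop.
Hypothesis M0 : forall n, M n 0.
Hypothesis MD : forall n x y, M n x -> M n y -> M n (x + y).
Hypothesis MZ : forall n a x, M n x -> M n (a *: x).
Hypothesis ML : forall m n x y, M m x -> M n y -> M (m + n) (lie x y).
Local Notation C := (completion G).
Implicit Types (f y : C) (g h : units C).

Definition lie_comp n (u : U) := exists2 x, M n x & u = io x.

Lemma lie_comp0 n : lie_comp n 0.
Proof. by exists 0; rewrite ?linear0. Qed.
Lemma lie_compD n u v : lie_comp n u -> lie_comp n v -> lie_comp n (u + v).
Proof. by move=> [x Mx ->] [y My ->]; exists (x + y); rewrite ?linearD; auto. Qed.
Lemma lie_compZ n a u : lie_comp n u -> lie_comp n (a *: u).
Proof. by move=> [x Mx ->]; exists (a *: x); rewrite ?linearZ; auto. Qed.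
Lemma lie_compN n u : lie_comp n u -> lie_comp n (- u).
Proof. by rewrite -scaleN1r; apply: lie_compZ. Qed.
Lemma lie_compL m n u v : lie_comp m u -> lie_comp n v -> lie_comp (m + n) (u * v - v * u).
Proof. by move=> [x Mx ->] [y My ->]; exists (lie x y); rewrite ?io_lie; auto. Qed.

(** Conjugation by g preserves Lie type, with a count of how much of [ell g] is used: N degrees
    above the order e of y, only the components of [ell g] up to degree N matter. The precise count
    is what lets [lie_unitV] avoid circularity. *)
Lemma conj_upto g N : uval g 0%N = 1 -> (forall j, (j <= N)%N -> lie_comp j (ell g j)) ->
  forall e y, (forall n, lie_comp n (y n)) -> low e y ->
    lie_comp (e + N) ((uinv g * y * uval g) (e + N)%N).
Proof.
move=> g0; elim/ltn_ind: N => -[|N] IHN lg e y My ey.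
  by rewrite addn0 conj_lead.
set u := _ * _ * _.
have lu : low e u by apply: low_conj.
have uM i : (i <= N)%N -> lie_comp (e + i) (u (e + i)%N).
  by move=> iN; apply: IHN => // j ji; apply: lg; apply: (leq_trans ji); rewrite leqW.
(* Subtracting e y removes the component of degree e, so z has order e + 1 and the induction
   hypothesis applies to its conjugate with one degree fewer. The rest of the component of degree n
   is a commutator of earlier components of u with [ell g]. *)
pose z := cdeg y - e%:R *: y.
have zM n : lie_comp n (z n).
  by apply: lie_compD; [apply: lie_compZ|apply/lie_compZ/lie_compZ].
have ez : low e.+1 z.
  move=> i; rewrite ltnS leq_eqVlt => /orP[/eqP ->|ie].
    by rewrite hcompB cdegE subrr.
  by rewrite hcompB cdegE [X in _ - X]/= ey // !scaler0 subrr.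
set n := (e + N.+1)%N.
have un : N.+1%:R *: u n = (u * ell g) n - (ell g * u) n + (uinv g * z * uval g) n.
  have := cdeg_conj g y; rewrite -/u => /(congr1 (fun f : C => f n)).
  have -> : uinv g * cdeg y * uval g = uinv g * z * uval g + e%:R *: u.
    by rewrite /z mulrBr mulrBl -scalerAr -scalerAl subrK.
  rewrite cdegE {1}/n natrD scalerDl !hcompD hcompN => /eqP.
  by rewrite addrC !addrA [X in _ + X]/= (inj_eq (addIr _)) => /eqP.
have -> : u n = N.+1%:R^-1 *: (N.+1%:R *: u n).
  by rewrite scalerA mulVf ?scale1r // pnatr_eq0.
apply: lie_compZ; rewrite un; apply: lie_compD; last first.
  rewrite /n addnS -addSn; apply: IHN => // j jN; apply: lg; exact: leqW.
rewrite hcompM [(ell g * u) n](cmul_rev (ell g) u) -sumrB.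
apply: (big_ind (lie_comp n)) => [||i _]; [exact: lie_comp0|exact: lie_compD|].
have [ie|ei] := ltnP i e.
  by rewrite lu // mul0r mulr0 subrr; apply: lie_comp0.
have ni : (i <= n)%N by rewrite -ltnS.
have [iN|iN] := leqP i (e + N).
  suff: lie_comp (i + (n - i)) (u i * ell g (n - i)%N - ell g (n - i)%N * u i).
    by rewrite subnKC.
  apply: lie_compL; first by rewrite -(subnKC ei); apply: uM; rewrite leq_subLR.
  by apply: lg; rewrite leq_subLR -[X in (X <= _)%N]/(e + N.+1)%N leq_add2r.
have -> : (n - i)%N = 0%N by apply/eqP; rewrite subn_eq0 -[X in (X <= _)%N]/(e + N.+1)%N addnS.
by rewrite ell0 // mulr0 mul0r subrr; apply: lie_comp0.
Qed.

Definition lie_unit g := uval g 0%N = 1 /\ forall n, lie_comp n (ell g n).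

Lemma conj_lie g y : lie_unit g -> (forall n, lie_comp n (y n)) ->
  forall n, lie_comp n ((uinv g * y * uval g) n).
Proof. by move=> [g0 lg] My n; apply: (@conj_upto g n g0 _ 0%N). Qed.

(** Up to sign, [ell] of the inverse is a conjugate of [ell g] by g^-1. As [ell g] starts in degree
    1, its component of degree n + 1 requires [ell] of the inverse only up to degree n. *)
Lemma lie_unitV g : lie_unit g -> lie_unit g^-1%g.
Proof.
move=> [g0 lg]; have gV0 : uval g^-1%g 0%N = 1 by apply: uinv0.
split=> //; elim/ltn_ind => -[|n] IHn; first by rewrite ell0 //; apply: lie_comp0.
rewrite ellV hcompN; apply: lie_compN.
apply: (@conj_upto g^-1%g n gV0 _ 1%N (ell g)) => //.
by case=> // _; apply: ell0.
Qed.

Lemma lie_unitM g h : lie_unit g -> lie_unit h -> lie_unit (g * h)%g.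
Proof.
move=> lg lh; split=> [|n]; first by rewrite /= big_ord1 lg.1 lh.1 mulr1.
rewrite ellM hcompD; apply: lie_compD (lh.2 n).
by apply: conj_lie => //; apply: lg.2.
Qed.

Lemma lie_unit_comm g h : lie_unit g -> lie_unit h -> lie_unit [~ g, h]%g.
Proof.
move=> lg lh; apply: lie_unitM; first exact: lie_unitV.
by apply: lie_unitM; [exact: lie_unitV|exact: lie_unitM].
Qed.

Lemma lie_unit_lead g n : lie_unit g -> (0 < n)%N -> low n (uval g - 1) ->
  lie_comp n (uval g n).
Proof.
move=> [g0 lg] n0 ng.
have -> : uval g n = n%:R^-1 *: ell g n.
  by rewrite ell_lead // scalerA mulVf ?scale1r // pnatr_eq0 gtn_eqF.
exact: lie_compZ.
Qed.

Lemma lie_unit_cexp d x (hx : G d (io x)) g : (0 < d)%N -> M d x ->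
  uval g = cexp (homog hx) -> lie_unit g.
Proof.
move=> d0 Mx gx; have [g0 ge] := ell_cexp d0 (cdeg_homog hx) gx.
split=> // n; rewrite ge; apply: lie_compZ => /=.
by case: eqP => [->|_]; [exists x|apply: lie_comp0].
Qed.

(* If M vanishes in large degrees, a group of units of Lie type is exhausted *)
(* by successively dividing out leading terms.                               *)
Lemma lie_unit_exhaust (Q : nat -> units C -> Prop) N :
  (forall n x, (N <= n)%N -> M n x -> x = 0) ->
  (forall n, Q n 1%g) -> (forall n g h, Q n g -> Q n h -> Q n (g * h)%g) ->
  (forall n g, Q n.+1 g -> Q n g) ->
  (forall n x, (0 < n)%N -> M n x -> exists h, [/\ Q n h, lie_unit h,
     low n (uval h - 1) & uval h n = io x]) ->
  forall n g, (0 < n)%N -> lie_unit g -> low n (uval g - 1) -> Q n g.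
Proof.
move=> MN Q1 QM QS Qlead n g n0 lg ng.
(* Induction on the number m of degrees left before M vanishes. At m = 0 every further leading term
   is zero, so g = 1; otherwise division by h raises the order of g by one. *)
have [m nm] : exists m, (N <= n + m)%N by exists N; rewrite leq_addl.
elim: m n n0 nm g lg ng => [|m IHm] n n0 nm g lg ng.
  have -> : g = 1%g; last exact: Q1.
  apply: units_eq; apply/eqP; rewrite -subr_eq0; apply/eqP/low_all => k.
  have [kn|/ltnW nk] := leqP k n; first exact: lowW ng.
  rewrite -(subnKC nk); elim: (k - n)%N => [|j IHj]; first by rewrite addn0.
  move=> i; rewrite addnS ltnS leq_eqVlt => /orP[/eqP ->|]; last exact: IHj.
  have nj0 : (0 < n + j)%N by rewrite addn_gt0 n0.
  have [x Mx gx] := lie_unit_lead lg nj0 IHj.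
  rewrite hcompB gx (MN _ _ _ Mx) ?linear0 ?hcomp1 ?gtn_eqF ?subr0 //.
  by move: nm; rewrite addn0 => /leq_trans; apply; apply: leq_addr.
have [x Mx gx] := lie_unit_lead lg n0 ng.
have [h [Qh lh nh hx]] := Qlead n x n0 Mx.
rewrite -(mulgVK h g); apply: (QM) => //; apply: QS; apply: IHm => //.
- by rewrite addSnnS.
- by apply: lie_unitM => //; apply: lie_unitV.
have [nV hV] := low_unitV n0 nh; have [ngh gh] := low_unitM n0 ng nV.
move=> i; rewrite ltnS leq_eqVlt => /orP[/eqP ->|]; last exact: ngh.
by rewrite hcompB gh hV gx hx subrr hcomp1 gtn_eqF // subr0.
Qed.

Section WordCommutators.
Variables (T : eqType) (x : T -> L) (b : T -> nat) (c : T -> K -> units C).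
Hypothesis b0 : forall t, (0 < b t)%N.
Hypothesis c_low : forall t a, low (b t) (uval (c t a) - 1) /\
  uval (c t a) (b t) = io (a *: x t).
Hypothesis c_lie : forall t a, lie_unit (c t a).

Definition word_comm (w : T * seq T) a : units C :=
  rnormed commg (c w.1 a) (map (c^~ 1) w.2).

Definition word_height (w : T * seq T) : nat := \sum_(t <- letters w) b t.

Lemma word_height_gt0 w : (0 < word_height w)%N.
Proof. by rewrite /word_height big_cons addn_gt0 b0. Qed.

(** By [comm_low], leading terms of iterated commutators are iterated brackets; the parameter a
    enters only through the outermost letter, hence as a scalar. *)
Lemma word_comm_lead w a : [/\ lie_unit (word_comm w a),
  low (word_height w) (uval (word_comm w a) - 1) &
  uval (word_comm w a) (word_height w) = io (a *: lie_word x w)].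
Proof.
case: w => t s; elim: s t a => [|u s IHs] t a.
  by rewrite /word_height big_seq1; have [] := c_low t a; split; first exact: c_lie.
have [lw lo le] := IHs u 1; rewrite /word_height big_cons -/(word_height (u, s)).
have [ct cte] := c_low t a.
have [cl ce] := comm_low (b0 t) (word_height_gt0 (u, s)) ct lo.
split=> //; first by apply: lie_unit_comm.
by rewrite [LHS]ce cte le scale1r -io_lie lieZl.
Qed.

End WordCommutators.

End LieTypeUnits.

(** * Lower central series *)

Section LowerCentralSeriesTheory.
Local Open Scope group_scope.
Variable H : groupType.
Implicit Types x y z u v : H.

Lemma lcs1 n : lcs n (1 : H).
Proof. by case: n => [|[|n]] //; apply: gen_1. Qed.

Lemma lcsM n x y : lcs n x -> lcs n y -> lcs n (x * y).
Proof. by case: n => [|[|n]] //; apply: gen_M. Qed.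

Lemma lcsV n x : lcs n x -> lcs n x^-1.
Proof. by case: n => [|[|n]] //; apply: gen_V. Qed.

Lemma lcs_le m n : (m <= n)%N -> (lcs n `<=` (lcs m : set H))%classic.
Proof.
move=> /subnK <-; elim: (n - m)%N => [|k IHk] x //.
by rewrite addSn => /lcs_sub/IHk.
Qed.

Lemma lcs_conj n x y : lcs n x -> lcs n (x ^ y).
Proof.
case: n => [|n] //; elim: n x y => [|n IHn] x y //.
rewrite lcsS; elim=> {x} [_ [u _ [v nv ->]]||u v _ IHu _ IHv|u _ IHu].
- by rewrite conjRg; apply: gen_in; exists (u ^ y) => //; exists (v ^ y) => //; apply: IHn.
- by rewrite conj1g; apply: gen_1.
- by rewrite conjMg; apply: gen_M.
- by rewrite conjVg; apply: gen_V.
Qed.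

Lemma commMgR x y z : [~ x * y, z] = [~ x, z] ^ y * [~ y, z].
Proof. by rewrite /commg !conjgE !invgM !mulgA !mulgK. Qed.

Lemma commgMR x y z : [~ x, y * z] = [~ x, z] * [~ x, y] ^ z.
Proof. by rewrite /commg !conjgE !invgM !mulgA !(mulgK, mulgVK). Qed.

Lemma commVgR x y : [~ x^-1, y] = ([~ x, y] ^ x^-1)^-1.
Proof. by rewrite /commg !conjgE !invgM !invgK !mulgA !(mulgK, mulgVK). Qed.

Lemma commgVR x y : [~ x, y^-1] = ([~ x, y] ^ y^-1)^-1.
Proof. by rewrite /commg !conjgE !invgM !invgK !mulgA mulgV mul1g. Qed.

Lemma hall_witt x y z :
  [~ [~ x, y^-1], z] ^ y * [~ [~ y, z^-1], x] ^ z * [~ [~ z, x^-1], y] ^ x = 1.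
Proof.
by rewrite /commg !conjgE !(invgM, invgK) !mulgA !(mulgK, mulgVK) mulVg.
Qed.

(** The three subgroups argument: for a generator [u,v] in place of x, the Hall-Witt identity
    expresses its commutator with y through two others, which the induction on m, for all n at once,
    places in the required term. *)
Lemma lcs_comm m n x y : lcs m.+1 x -> lcs n.+1 y -> lcs (m + n).+2 [~ x, y].
Proof.
elim: m n x y => [|m IHm] n x y.
  by move=> _ ny; apply: gen_in; exists x => //; exists y.
rewrite lcsS => + ny; elim=> {x} [_ [u _ [v mv ->]]||u v _ IHu _ IHv|u _ IHu].
- have mn1 : lcs (m + n).+3 ([~ [~ v^-1, y^-1], u] ^ y).
    apply: lcs_conj; rewrite -invgR; apply: lcsV; apply: gen_in; exists u => //.
    by exists [~ v^-1, y^-1] => //; apply: IHm; apply: lcsV.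
  have mn2 : lcs (m + n).+3 ([~ [~ y, u^-1], v^-1] ^ u).
    apply: lcs_conj; rewrite -invgR -addnS; apply: lcsV; apply: IHm; first exact: lcsV.
    by rewrite -invgR; apply: lcsV; apply: gen_in; exists u^-1 => //; exists y.
  rewrite -[[~ _, y]](conjgKV v) addSn; apply: lcs_conj.
  have /eqP := hall_witt u v^-1 y; rewrite invgK -mulgA mulg_eq1 => /eqP ->.
  exact/lcsV/lcsM.
- by rewrite commgEl conj1g invg1 mulg1; apply: lcs1.
- by rewrite commMgR; apply: lcsM => //; apply: lcs_conj.
- by rewrite commVgR; apply/lcsV/lcs_conj.
Qed.

End LowerCentralSeriesTheory.

(** * The Lie ring of the lower central series *)

Section GradedQuotient.
Variable H : groupType.
Implicit Types x y z : H.

(* gamma_(n+1) / gamma_(n+2), as a quotient of the whole group: elements *)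
(* outside gamma_(n+1) are sent to the trivial class.                    *)
Variable n : nat.

Definition lcs_part x : H := if `[< lcs n.+1 x >] then x else 1%g.

Definition lcs_eqb x y := `[< lcs n.+2 ((lcs_part x)^-1 * lcs_part y)%g >].

Lemma lcs_partP x : lcs n.+1 (lcs_part x).
Proof. by rewrite /lcs_part; case: asboolP => // _; apply: lcs1. Qed.

Lemma lcs_part_id x : lcs n.+1 x -> lcs_part x = x.
Proof. by rewrite /lcs_part; case: asboolP. Qed.

Fact lcs_eqb_refl : reflexive lcs_eqb.
Proof. by move=> x; apply/asboolP; rewrite mulVg; apply: lcs1. Qed.
Fact lcs_eqb_sym : symmetric lcs_eqb.
Proof.
by move=> x y; apply/asboolP/asboolP => /lcsV; rewrite invgM invgK.
Qed.
Fact lcs_eqb_trans : transitive lcs_eqb.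
Proof.
move=> y x z /asboolP xy /asboolP yz; apply/asboolP.
by have := lcsM xy yz; rewrite !mulgA mulgK.
Qed.

Canonical lcs_equiv := EquivRel lcs_eqb lcs_eqb_refl lcs_eqb_sym lcs_eqb_trans.

Definition lcs_gr := {eq_quot lcs_equiv}%qT.
HB.instance Definition _ := Choice.on lcs_gr.

Definition gr_class x : lcs_gr := (\pi_({eq_quot lcs_equiv}) x)%qT.
Definition gr_repr (a : lcs_gr) : H := lcs_part (repr a).

Lemma gr_reprP a : lcs n.+1 (gr_repr a).
Proof. exact: lcs_partP. Qed.

Lemma gr_classP x y : lcs n.+1 x -> lcs n.+1 y ->
  gr_class x = gr_class y <-> lcs n.+2 (x^-1 * y)%g.
Proof.
move=> nx ny; have E : lcs_eqb x y = `[< lcs n.+2 (x^-1 * y)%g >].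
  by rewrite /lcs_eqb !lcs_part_id.
split=> [/eqmodP xy|xy]; last by apply/eqmodP; rewrite /= E; apply/asboolP.
by apply/asboolP; rewrite -E.
Qed.

Lemma gr_reprK a : gr_class (gr_repr a) = a.
Proof.
rewrite -{2}[a]reprK; apply/eqmodP => /=; apply/asboolP; rewrite /gr_repr.
by rewrite (lcs_part_id (lcs_partP _)) mulVg; apply: lcs1.
Qed.

Lemma gr_class_congr x y x' y' : lcs n.+1 x -> lcs n.+1 y -> lcs n.+1 x' -> lcs n.+1 y' ->
  gr_class x = gr_class x' -> gr_class y = gr_class y' ->
  gr_class (x * y)%g = gr_class (x' * y')%g.
Proof.
move=> nx ny nx' ny' /(gr_classP nx nx') xx /(gr_classP ny ny') yy.
apply/gr_classP; [exact: lcsM|exact: lcsM|].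
have -> : ((x * y)^-1 * (x' * y') = (y^-1 * y') * ((x^-1 * x') ^ y'))%g.
  by rewrite conjgE invgM !mulgA mulgK.
by apply: lcsM => //; apply: lcs_conj.
Qed.

Definition gr_add (a b : lcs_gr) := gr_class (gr_repr a * gr_repr b)%g.
Definition gr_opp (a : lcs_gr) := gr_class (gr_repr a)^-1%g.

Lemma gr_addE x y : lcs n.+1 x -> lcs n.+1 y ->
  gr_add (gr_class x) (gr_class y) = gr_class (x * y)%g.
Proof.
by move=> nx ny; apply: gr_class_congr; rewrite ?gr_reprK //; apply: gr_reprP.
Qed.

Lemma gr_ind (P : lcs_gr -> Prop) :
  (forall x, lcs n.+1 x -> P (gr_class x)) -> forall a, P a.
Proof. by move=> PC a; rewrite -[a]gr_reprK; apply/PC/gr_reprP. Qed.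

Fact gr_addA : associative gr_add.
Proof.
elim/gr_ind => x nx; elim/gr_ind => y ny; elim/gr_ind => z nz.
by rewrite !gr_addE ?mulgA //; apply: lcsM.
Qed.
Fact gr_addC : commutative gr_add.
Proof.
elim/gr_ind => x nx; elim/gr_ind => y ny; rewrite !gr_addE //.
apply/gr_classP; [exact: lcsM|exact: lcsM|].
have -> : ((x * y)^-1 * (y * x) = [~ y, x])%g.
  by rewrite /commg conjgE invgM !mulgA.
by apply: gen_in; exists y => //; exists x.
Qed.
Fact gr_add0 : left_id (gr_class 1%g) gr_add.
Proof.
by elim/gr_ind => x nx; rewrite gr_addE ?mul1g //; apply: lcs1.
Qed.
Fact gr_addN : left_inverse (gr_class 1%g) gr_opp gr_add.
Proof.
move=> a; rewrite -{2}[a]gr_reprK /gr_opp gr_addE ?mulVg //; last exact: gr_reprP.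
exact/lcsV/gr_reprP.
Qed.

HB.instance Definition _ := GRing.isZmodule.Build lcs_gr gr_addA gr_addC gr_add0 gr_addN.

Lemma gr_classM x y : lcs n.+1 x -> lcs n.+1 y ->
  gr_class (x * y)%g = gr_class x + gr_class y.
Proof. by move=> nx ny; rewrite -gr_addE. Qed.

Lemma gr_class1 : gr_class 1%g = 0. Proof. by []. Qed.

Lemma gr_classV x : lcs n.+1 x -> gr_class x^-1%g = - gr_class x.
Proof.
move=> nx; apply/eqP; rewrite -addr_eq0 -gr_classM ?mulVg //; exact: lcsV.
Qed.

Lemma gr_class0P x : lcs n.+1 x -> gr_class x = 0 <-> lcs n.+2 x.
Proof.
move=> nx; rewrite -gr_class1; split=> [/esym|x0].
  by move/(gr_classP (lcs1 H n.+1) nx); rewrite invg1 mul1g.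
by apply/esym/(gr_classP (lcs1 H n.+1) nx); rewrite invg1 mul1g.
Qed.

Lemma gr_class_conj x y : lcs n.+1 x -> gr_class (x ^ y)%g = gr_class x.
Proof.
move=> nx; apply/gr_classP => //; first exact: lcs_conj.
have -> : ((x ^ y)^-1 * x = [~ y, x])%g by rewrite commgEr conjVg.
by apply: gen_in; exists y => //; exists x.
Qed.

End GradedQuotient.

Arguments gr_class {H} n x.

Section GradedCommutators.
Variable H : groupType.
Implicit Types x y z : H.

Lemma lcs_comm_eq m n k x y : k = (m + n).+1 -> lcs m.+1 x -> lcs n.+1 y ->
  lcs k.+1 [~ x, y]%g.
Proof. by move=> ->; apply: lcs_comm. Qed.

Lemma gr_commMl m n k x x' y : k = (m + n).+1 ->
  lcs m.+1 x -> lcs m.+1 x' -> lcs n.+1 y ->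
  gr_class k [~ x * x', y]%g = gr_class k [~ x, y]%g + gr_class k [~ x', y]%g.
Proof.
move=> kE mx mx' ny; have h := lcs_comm_eq kE mx ny; have h' := lcs_comm_eq kE mx' ny.
by rewrite commMgR gr_classM ?gr_class_conj //; apply: lcs_conj.
Qed.

Lemma gr_commMr m n k x y y' : k = (m + n).+1 ->
  lcs m.+1 x -> lcs n.+1 y -> lcs n.+1 y' ->
  gr_class k [~ x, y * y']%g = gr_class k [~ x, y]%g + gr_class k [~ x, y']%g.
Proof.
move=> kE mx ny ny'; have h := lcs_comm_eq kE mx ny; have h' := lcs_comm_eq kE mx ny'.
by rewrite commgMR gr_classM ?gr_class_conj 1?addrC //; apply: lcs_conj.
Qed.

Lemma gr_commVl m n k x y : k = (m + n).+1 -> lcs m.+1 x -> lcs n.+1 y ->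
  gr_class k [~ x^-1, y]%g = - gr_class k [~ x, y]%g.
Proof.
move=> kE mx ny; have h := lcs_comm_eq kE mx ny.
by rewrite commVgR gr_classV ?gr_class_conj //; apply: lcs_conj.
Qed.

Lemma gr_commVr m n k x y : k = (m + n).+1 -> lcs m.+1 x -> lcs n.+1 y ->
  gr_class k [~ x, y^-1]%g = - gr_class k [~ x, y]%g.
Proof.
move=> kE mx ny; have h := lcs_comm_eq kE mx ny.
by rewrite commgVR gr_classV ?gr_class_conj //; apply: lcs_conj.
Qed.

Lemma gr_commC m n k x y : k = (m + n).+1 -> lcs m.+1 x -> lcs n.+1 y ->
  gr_class k [~ x, y]%g = - gr_class k [~ y, x]%g.
Proof.
move=> kE mx ny; rewrite -invgR gr_classV //.
by apply: (lcs_comm_eq _ ny mx); rewrite addnC.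
Qed.

Lemma gr_comm_congr m n k x y y' : k = (m + n).+1 -> lcs m.+1 x ->
  lcs n.+1 y -> lcs n.+1 y' -> gr_class n y = gr_class n y' ->
  gr_class k [~ x, y]%g = gr_class k [~ x, y']%g.
Proof.
move=> kE mx ny ny' /(gr_classP ny ny') yy.
have nyy : lcs n.+1 (y^-1 * y')%g by apply: lcsM => //; apply: lcsV.
rewrite -[y'](mulVKg y) (gr_commMr kE) // -[LHS]addr0; congr (_ + _); apply/esym.
apply/gr_class0P; first exact: (lcs_comm_eq kE).
by apply: (lcs_comm_eq _ mx yy); rewrite kE addnS.
Qed.

(** The Hall-Witt identity read modulo the next term of the series, where conjugation is invisible
    and each inverse contributes a sign. *)
Lemma gr_jacobi a b c k x y z : k = (a + b + c).+2 ->
  lcs a.+1 x -> lcs b.+1 y -> lcs c.+1 z ->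
  gr_class k [~ [~ x, y], z]%g + gr_class k [~ [~ y, z], x]%g
    + gr_class k [~ [~ z, x], y]%g = 0.
Proof.
move=> kE ax bx cz.
have half a' b' c' (u v w : H) : k = (a' + b' + c').+2 ->
    lcs a'.+1 u -> lcs b'.+1 v -> lcs c'.+1 w ->
    lcs k.+1 [~ [~ u, v^-1], w]%g /\
    gr_class k [~ [~ u, v^-1], w]%g = - gr_class k [~ [~ u, v], w]%g.
  move=> kE' au bv cw; have bV := lcsV bv.
  have uv := lcs_comm_eq (erefl (a' + b').+1) au bv.
  have uV := lcs_comm_eq (erefl (a' + b').+1) au bV.
  have kE2 : k = ((a' + b').+1 + c').+1 by rewrite kE' addSn.
  split; first exact: (lcs_comm_eq kE2).
  rewrite -(gr_commVl kE2) // (gr_commC kE2) // [RHS](gr_commC kE2) //; last exact: lcsV.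
  congr (- _); apply: (gr_comm_congr (m := c') (n := (a' + b').+1)) => //; first by rewrite kE2 addnC.
    exact: lcsV.
  by rewrite gr_classV // (gr_commVr (erefl _)).
have kE1 : k = (b + c + a).+2 by rewrite kE; congr _.+2; lia.
have kE2 : k = (c + a + b).+2 by rewrite kE; congr _.+2; lia.
have [l1 e1] := half _ _ _ _ _ _ kE ax bx cz.
have [l2 e2] := half _ _ _ _ _ _ kE1 bx cz ax.
have [l3 e3] := half _ _ _ _ _ _ kE2 cz ax bx.
have := congr1 (gr_class k) (hall_witt x y z).
rewrite gr_classM; [|by apply: lcsM; apply: lcs_conj|exact: lcs_conj].
rewrite gr_classM; [|exact: lcs_conj|exact: lcs_conj].
rewrite !gr_class_conj // e1 e2 e3 gr_class1 -!opprD => /eqP.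
by rewrite oppr_eq0 => /eqP.
Qed.

End GradedCommutators.

Section RationalAdditive.
Variable V : zmodType.

Definition rat_additive (f : rat -> V) := forall a b, f (a + b) = f a + f b.

Lemma rat_additive0 f : rat_additive f -> f 0 = 0.
Proof. by move=> fD; apply: (addrI (f 0)); rewrite -fD !addr0. Qed.

Lemma rat_additiveN f a : rat_additive f -> f (- a) = - f a.
Proof. by move=> fD; apply/eqP; rewrite -addr_eq0 -fD addNr rat_additive0. Qed.

Lemma rat_additiveMn f a n : rat_additive f -> f (a *+ n) = f a *+ n.
Proof.
by move=> fD; elim: n => [|n IHn]; rewrite ?mulr0n ?rat_additive0 // !mulrS fD IHn.
Qed.

Lemma rat_additiveMz f a z : rat_additive f -> f (a * z%:~R) = f a *~ z.
Proof.
move=> fD; rewrite mulrzr; case: z => n; first exact: rat_additiveMn.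
by rewrite NegzE !mulrNz rat_additiveN // -!pmulrn rat_additiveMn.
Qed.

(* Bi-additive maps on rationals are balanced: rat is its own tensor square. *)
Lemma rat_biadditive (f : rat -> rat -> V) : (forall b, rat_additive (f^~ b)) ->
  (forall a, rat_additive (f a)) -> forall a b, f a b = f 1 (a * b).
Proof.
move=> fl fr a b; rewrite -[a]divq_num_den; set p := numq a; set q := denq a.
have q0 : q%:~R != 0 :> rat by rewrite intr_eq0 denq_neq0.
have -> : p%:~R / q%:~R = q%:~R^-1 * p%:~R :> rat by rewrite mulrC.
rewrite (rat_additiveMz _ _ (fl b)) -{1}[b](mulfVK q0) (rat_additiveMz _ _ (fr _)).
rewrite -(rat_additiveMz _ _ (fl _)) mulVf // -(rat_additiveMz _ _ (fr _)).
by congr (f 1 _); field.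
Qed.

End RationalAdditive.

(** The Jacobi identity for commutators of operators, once expanded: a to f are the six products of
    three operators. *)
Lemma commutator_cycle (V : zmodType) (a b c d e f : V) :
  a - b - (c - d) + (c - e - (f - b)) + (f - d - (a - e)) = 0.
Proof.
suff modZ (W : lmodType int) (a' b' c' d' e' f' : W) :
    a' - b' - (c' - d') + (c' - e' - (f' - b')) + (f' - d' - (a' - e')) = 0.
  exact: (modZ (zmodule V)).
by module_over int.
Qed.

(** * Transfer of Lie relations to group commutators *)

Section DynkinOperators.
Variables (H : groupType) (I : eqType) (x : I -> rat -> H).
Hypothesis xD : forall i a b, x i (a + b) = (x i a * x i b)%g.
Implicit Types (w : I * seq I).

Definition word_commg w a : H := rnormed commg (x w.1 a) (map (x^~ 1) w.2).

Lemma word_commg_lcs w a : lcs (size w.2).+1 (word_commg w a).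
Proof.
case: w => i s; elim: s i a => [|j s IHs] i a //.
by apply: gen_in; exists (x i a) => //; exists (word_commg (j, s) 1) => //; apply: IHs.
Qed.

Lemma x_class_additive i : rat_additive (fun a => gr_class 0 (x i a)).
Proof. by move=> a b; rewrite xD gr_classM. Qed.

Lemma word_commg_additive w :
  rat_additive (fun a => gr_class (size w.2) (word_commg w a)).
Proof.
case: w => i [|j s]; first exact: x_class_additive.
move=> a b; rewrite /word_commg /= xD.
by apply: (gr_commMl (m := 0) (n := size s)) => //; apply: (word_commg_lcs (j, s)).
Qed.

Definition gr_ad n g (z : lcs_gr H n) : lcs_gr H n.+1 :=
  gr_class n.+1 [~ g, gr_repr z]%g.

Lemma gr_adE n g y : lcs n.+1 y -> gr_ad g (gr_class n y) = gr_class n.+1 [~ g, y]%g.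
Proof.
move=> ny; apply: (gr_comm_congr (m := 0) (n := n)) => //; first exact: gr_reprP.
by rewrite gr_reprK.
Qed.

Lemma gr_adD n g : {morph @gr_ad n g : y z / y + z}.
Proof.
elim/gr_ind => y ny; elim/gr_ind => z nz; rewrite -gr_classM // !gr_adE //; last exact: lcsM.
exact: (gr_commMr (m := 0) (n := n)).
Qed.

Lemma gr_ad0 n g : @gr_ad n g 0 = 0.
Proof. by apply: (addrI (gr_ad g 0)); rewrite -gr_adD !addr0. Qed.

Lemma gr_adMn n g z m : @gr_ad n g (z *+ m) = gr_ad g z *+ m.
Proof. by elim: m => [|m IHm]; rewrite ?mulr0n ?gr_ad0 // !mulrS gr_adD IHm. Qed.

(** The class is bi-additive in the parameters of the two factors, so a rational scalar can move
    from one to the other by [rat_biadditive]. *)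
Lemma word_commg_move i w a :
  gr_class (size w.2).+1 [~ x i a, word_commg w 1]%g =
  gr_class (size w.2).+1 [~ x i 1, word_commg w a]%g.
Proof.
pose f a b := gr_class (size w.2).+1 [~ x i a, word_commg w b]%g.
have h b := word_commg_lcs w b.
rewrite -/(f a 1) -/(f 1 a) -[in RHS](mulr1 a); apply: rat_biadditive => [b|b] a1 a2.
  by rewrite /f xD; apply: (gr_commMl (m := 0) (n := size w.2)).
rewrite /f -(gr_commMr (m := 0) (n := size w.2)) //.
apply: (gr_comm_congr (m := 0) (n := size w.2)) => //; first exact: lcsM.
by rewrite gr_classM // word_commg_additive.
Qed.

(** Scalars act on the argument of the functions instead of on the graded quotients, which carry no
    rational structure at this stage. *)
Definition family := forall n, rat -> lcs_gr H n.
Definition family_additive (v : family) := forall n, rat_additive (v n).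

Lemma eq_family (v v' : family) : (forall n a, v n a = v' n a) -> v = v'.
Proof.
by move=> vv; apply: functional_extensionality_dep => n; apply/funext => a.
Qed.

(* A generator acts on rat x (product of the Hom(rat, gr_n)) as in Dynkin's *)
(* proof: (1, 0) is sent to the generator, and (0, v) to its bracket with v. *)
Definition gen_act i (c : rat) (v : family) : family := fun n =>
  match n with
  | 0 => fun a => gr_class 0 (x i (c * a))
  | n'.+1 => fun a => gr_ad (x i 1) (v n' a)
  end.

(** A term sends the pair (c, v) to a pair with first component 0; hence the 0 given to the outer
    action in the clause for [LLie]. *)
Fixpoint term_act (t : lie_term rat I) c (v : family) : family :=
  match t with
  | LGen i => gen_act i c v
  | LZero => fun n a => 0
  | LAdd s t => fun n a => term_act s c v n a + term_act t c v n a
  | LScale b t => fun n a => term_act t c v n (b * a)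
  | LLie s t => fun n a => term_act s 0 (term_act t c v) n a
                           - term_act t 0 (term_act s c v) n a
  end.

Lemma term_act_additive t c v : family_additive v -> family_additive (term_act t c v).
Proof.
elim: t c v => [i||s IHs t IHt|b t IHt|s IHs t IHt] c v av [|n] a a' //=.
- by rewrite mulrDr x_class_additive.
- by rewrite av gr_adD.
- by rewrite addr0.
- by rewrite addr0.
- by rewrite IHs ?IHt // addrACA.
- by rewrite IHs ?IHt // addrACA.
- by rewrite mulrDr IHt.
- by rewrite mulrDr IHt.
- by rewrite IHs ?(IHt 0) ?opprD 1?addrACA // => *; auto.
- by rewrite IHs ?(IHt 0) ?opprD 1?addrACA // => *; auto.
Qed.

Lemma term_actD t c c' v v' n a :
  term_act t (c + c') (fun n a => v n a + v' n a) n a =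
  term_act t c v n a + term_act t c' v' n a.
Proof.
elim: t c c' v v' n a => [i||s IHs t IHt|b t IHt|s IHs t IHt] c c' v v' n a /=.
- by case: n => [|n] /=; rewrite ?mulrDl ?x_class_additive ?gr_adD.
- by rewrite addr0.
- by rewrite IHs IHt addrACA.
- exact: IHt.
- rewrite (eq_family (IHt c c' v v')) (eq_family (IHs c c' v v')).
  have IHs0 u u' : term_act s 0 (fun n a => u n a + u' n a) n a =
    term_act s 0 u n a + term_act s 0 u' n a by rewrite -IHs addr0.
  have IHt0 u u' : term_act t 0 (fun n a => u n a + u' n a) n a =
    term_act t 0 u n a + term_act t 0 u' n a by rewrite -IHt addr0.
  by rewrite IHs0 IHt0 opprD addrACA.
Qed.

Lemma term_actD0 t v v' n a : term_act t 0 (fun n a => v n a + v' n a) n a =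
  term_act t 0 v n a + term_act t 0 v' n a.
Proof. by rewrite -term_actD addr0. Qed.

Lemma term_actZ t b c v n a :
  term_act t (b * c) (fun n a => v n (b * a)) n a = term_act t c v n (b * a).
Proof.
elim: t c v n a => [i||s IHs t IHt|d t IHt|s IHs t IHt] c v n a //=.
- by case: n => [|n] //=; rewrite [c * _]mulrCA mulrA.
- by rewrite IHs IHt.
- by rewrite IHt mulrCA.
- rewrite (eq_family (IHt c v)) (eq_family (IHs c v)).
  have IHs0 u : term_act s 0 (fun n a => u n (b * a)) n a = term_act s 0 u n (b * a).
    by rewrite -IHs mulr0.
  have IHt0 u : term_act t 0 (fun n a => u n (b * a)) n a = term_act t 0 u n (b * a).
    by rewrite -IHt mulr0.
  by rewrite IHs0 IHt0.
Qed.

Lemma term_actZ0 t b v n a :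
  term_act t 0 (fun n a => v n (b * a)) n a = term_act t 0 v n (b * a).
Proof. by rewrite -term_actZ mulr0. Qed.

Lemma term_act0 t n a : term_act t 0 (fun n a => 0) n a = 0.
Proof.
apply: (addrI (term_act t 0 (fun n a => 0) n a)); rewrite -term_actD !addr0.
by congr (term_act t 0 _ n a); apply: eq_family => *; rewrite addr0.
Qed.

Lemma term_actN t c v n a :
  term_act t (- c) (fun n a => - v n a) n a = - term_act t c v n a.
Proof.
apply/eqP; rewrite -addr_eq0 -term_actD addNr.
rewrite (_ : (fun n a => - v n a + v n a) = fun n a => 0) ?term_act0 //.
by apply: eq_family => *; rewrite addNr.
Qed.

Lemma term_actB t v v' n a :
  term_act t 0 (fun n a => v n a - v' n a) n a =
  term_act t 0 v n a - term_act t 0 v' n a.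
Proof. by rewrite -term_actN oppr0 -term_actD addr0. Qed.

Definition word_term w : lie_term rat I := rnormed (@LLie rat I) (LGen w.1) (map LGen w.2).

Lemma lie_pi_word (rel : set (lie_term rat I)) w :
  lie_pi rel (word_term w) = lie_word (lie_gen rel) w.
Proof.
case: w => i s; elim: s i => [|j s IHs] i //.
by rewrite lie_wordS -IHs -lie_piL.
Qed.

Lemma gr_x0 i : gr_class 0 (x i 0) = 0.
Proof. exact: rat_additive0 (x_class_additive i). Qed.

(** The Dynkin-Specht-Wever computation. On (1, 0) a word of length l gives l times its own class:
    for [e_i, W] the term e_i W contributes the length of W, and the term -W e_i contributes one
    more. In higher degrees a word acts as the bracket with its group commutator, by the Jacobi
    identity. *)
Lemma word_term_act w c v : family_additive v ->
  [/\ forall n a, (n < size w.2)%N -> term_act (word_term w) c v n a = 0,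
      forall a, term_act (word_term w) c v (size w.2) a =
        gr_class (size w.2) (word_commg w (c * a)) *+ (size w.2).+1 &
      forall m n a, n = (m + size w.2).+1 -> term_act (word_term w) c v n a =
        gr_class n [~ word_commg w 1, gr_repr (v m a)]%g].
Proof.
case: w => i s; elim: s i c v => [|j s IHs] i c v av; split=> //.
- by move=> m n a ->; rewrite addn0.
- move=> n a; rewrite ltnS => /= ns.
  have [|I1 I2 _] := IHs j 0 (gen_act i c v); first exact: (@term_act_additive (LGen i)).
  have [J1 _ _] := IHs j c v av.
  rewrite -[rnormed _ _ _]/(word_term (j, s)).
  have -> : term_act (word_term (j, s)) 0 (gen_act i c v) n a = 0.
    move: ns; rewrite leq_eqVlt => /orP[/eqP ->|/I1 //].
    by rewrite I2 mul0r (rat_additive0 (word_commg_additive (j, s))) mul0rn.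
  by case: n ns => [|n] ns /=; rewrite ?mul0r ?gr_x0 ?J1 ?gr_ad0 ?subrr.
- move=> a /=; have [|_ _ I3] := IHs j 0 (gen_act i c v); first exact: (@term_act_additive (LGen i)).
  have [_ J2 _] := IHs j c v av.
  rewrite -[rnormed _ _ _]/(word_term (j, s)) J2 /= (I3 0%N) //=.
  have lw b : lcs (size s).+1 (word_commg (j, s) b) := word_commg_lcs (j, s) b.
  rewrite gr_adMn (gr_adE _ (lw _)) -(word_commg_move i (j, s)).
  have -> : gr_class (size s).+1 [~ word_commg (j, s) 1, gr_repr (gr_class 0 (x i (c * a)))]%g =
      - gr_class (size s).+1 [~ x i (c * a), word_commg (j, s) 1]%g.
    have kE : (size s).+1 = (size s + 0).+1 by rewrite addn0.
    rewrite -(gr_commC kE (lw 1)) //; apply: (gr_comm_congr kE (lw 1)); rewrite ?gr_reprK //.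
  by rewrite opprK -mulrSr.
- move=> m n a nE /=; have [|_ _ I3] := IHs j 0 (gen_act i c v); first exact: (@term_act_additive (LGen i)).
  have [_ _ J3] := IHs j c v av.
  rewrite -[rnormed _ _ _]/(word_term (j, s)).
  case: n nE => // n [nE]; rewrite /= addnS in nE; subst n.
  rewrite (I3 m.+1) /= ?addSn // (J3 m) //.
  have lw := word_commg_lcs (j, s) 1; have lv := gr_reprP (v m a).
  set W := word_commg (j, s) 1 in lw *; set V := gr_repr _ in lv *; rewrite /= in lw.
  have lWV : lcs (m + size s).+2 [~ W, V]%g by apply: (lcs_comm_eq _ lw lv); rewrite addnC.
  have lxV : lcs m.+2 [~ x i 1, V]%g by apply: (lcs_comm_eq (m := 0) _ _ lv).
  have lxW : lcs (size s).+2 [~ x i 1, W]%g by apply: (lcs_comm_eq (m := 0) _ _ lw).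
  rewrite (gr_adE _ lWV).
  have -> : gr_class (m + size s).+2 [~ W, gr_repr (gr_ad (x i 1) (v m a))]%g =
      gr_class (m + size s).+2 [~ W, [~ x i 1, V]]%g.
    apply: (gr_comm_congr (m := size s) (n := m.+1)) => //; first by rewrite addnS addnC.
      exact: gr_reprP.
    by rewrite gr_reprK.
  have kJ : (m + size s).+2 = (0 + size s + m).+2 by rewrite add0n addnC.
  have lx : lcs 1 (x i 1) by [].
  have /eqP := gr_jacobi kJ lx lw lv.
  have kW : (m + size s).+2 = ((m + size s).+1 + 0).+1 by rewrite addn0.
  rewrite (gr_commC kW lWV lx).
  have -> : gr_class (m + size s).+2 [~ [~ V, x i 1], W]%g =
      gr_class (m + size s).+2 [~ W, [~ x i 1, V]]%g.
    have kV : (m + size s).+2 = (m.+1 + size s).+1 by rewrite addSn.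
    by rewrite -[[~ V, _]%g]invgR (gr_commVl kV) // (gr_commC kV) // opprK.
  by rewrite -addrA addr_eq0 opprD opprK => /eqP ->; rewrite addrC.
Qed.

Variable rel : set (lie_term rat I).
Hypothesis relP : forall t, rel t ->
  exists2 w, t = word_term w & forall a, lcs (size w.2).+2 (word_commg w a).

(** A relator acts by the class of its group commutator or by bracketing with it; both vanish
    because that commutator lies one step deeper in the series. *)
Lemma term_act_rel t c v n a : rel t -> family_additive v -> term_act t c v n a = 0.
Proof.
move=> /relP[w -> lw] av; have [W1 W2 W3] := word_term_act w c av.
case: (ltngtP n (size w.2)) => [/W1->|nw|->] //; last first.
  by rewrite W2 (gr_class0P (word_commg_lcs w _)).2 ?mul0rn.
rewrite (W3 (n - (size w.2).+1)%N) ?subnK -?addnS ?subnK //.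
have lc : lcs n.+2 [~ word_commg w 1, gr_repr (v (n - (size w.2).+1)%N a)]%g.
  by apply: (lcs_comm_eq (m := (size w.2).+1) _ (lw 1) (gr_reprP _)); rewrite subnKC.
by apply/gr_class0P => //; apply: lcs_sub.
Qed.

Lemma term_act_eq s t : lie_eq rel s t -> forall c v, family_additive v ->
  term_act s c v = term_act t c v.
Proof.
elim=> {s t} [t rt|//|s t _ IH|s t u _ IH1 _ IH2|s s' t t' _ IHs _ IHt|b t t' _ IHt
  |s s' t t' _ IHs _ IHt|s t u|s t|t|t|a b t|t|a s t|a b t|s t u|s t u|a s t|a s t|t|s t u] c v av;
  apply: eq_family => n q /=.
- exact: term_act_rel.
- by rewrite IH.
- by rewrite IH1 // IH2.
- by rewrite IHs // IHt.
- by rewrite IHt.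
- by rewrite (IHs c v) // (IHt c v) // (IHs 0) ?(IHt 0) //; apply: term_act_additive.
- by rewrite addrA.
- by rewrite addrC.
- by rewrite add0r.
- by rewrite mulN1r (rat_additiveN _ (term_act_additive t c av n)) addNr.
- by rewrite mulrCA mulrA.
- by rewrite mul1r.
- by [].
- by rewrite mulrDl (term_act_additive t c av n).
- by rewrite term_actD0 opprD addrACA.
- by rewrite term_actD0 opprD addrACA.
- by rewrite term_actZ0.
- by rewrite term_actZ0.
- by rewrite subrr.
- by rewrite !term_actB; apply: commutator_cycle.
Qed.

(** The relation is applied to the pair (1, 0) and evaluated at 1/(l+1), which cancels the factor
    l+1 produced by each word. *)
Theorem word_commg_relation l (s : seq (rat * (I * seq I))) :
  {in s, forall p, size p.2.2 = l} ->
  \sum_(p <- s) p.1 *: lie_word (lie_gen rel) p.2 = 0 ->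
  \sum_(p <- s) gr_class l (word_commg p.2 p.1) = 0.
Proof.
move=> sl s0.
pose t := foldr (fun (p : rat * (I * seq I)) t => LAdd (LScale p.1 (word_term p.2)) t) LZero s.
have /lie_piP tE : lie_pi rel t = lie_pi rel LZero.
  rewrite -[RHS]s0 {s0 sl}/t; elim: s => [|p s IHs]; first by rewrite big_nil.
  by rewrite big_cons -IHs /= lie_piD lie_piZ lie_pi_word.
have z0 : family_additive (fun n a => 0) by move=> n a b; rewrite addr0.
have := term_act_eq tE 1 z0 => /(congr1 (fun v : family => v l (l.+1%:R^-1))) /= E.
rewrite -[RHS]E {E}.
rewrite {s0 tE}/t; elim: s sl => [|p s IHs] sl; first by rewrite big_nil.
rewrite big_cons /= IHs => [|q qs]; last by apply: sl; rewrite inE qs orbT.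
congr (_ + _); have pl := sl p (mem_head _ _).
have [_ + _] := word_term_act p.2 1 z0; rewrite pl => ->.
have wa := word_commg_additive p.2; rewrite pl in wa.
rewrite -(rat_additiveMn _ _ wa) mul1r; congr (gr_class _ (word_commg _ _)).
by rewrite -[(_ / _) *+ _]mulr_natr mulfVK // pnatr_eq0.
Qed.

End DynkinOperators.

(** * Generation and Serre relations in the group *)

Section EnvelopingEmbedding.
Variables (K : fieldType) (L : lieAlgType K).

Fact env_in_is_linear : linear (@env_in K L).
Proof.
move=> a x y; rewrite -[RHS]/(env_add (env_scale a (env_in x)) (env_in y)).
rewrite env_scaleE env_addE; apply/env_piP.
apply: env_eq_trans (env_eq_genD _ _) _; apply: env_eq_add; last exact: env_eq_refl.
exact: env_eq_genZ.
Qed.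
HB.instance Definition _ :=
  GRing.isLinear.Build K L (env L) _ (@env_in K L) env_in_is_linear.

Lemma env_in_lie (x y : L) :
  env_in (lie x y) = env_in x * env_in y - env_in y * env_in x.
Proof.
rewrite -scaleN1r.
rewrite -[RHS]/(env_add (env_mul (env_in x) (env_in y))
  (env_scale (-1) (env_mul (env_in y) (env_in x)))).
by rewrite !env_mulE env_scaleE env_addE; apply/env_piP/env_eq_lie.
Qed.

Variable D : {linear L -> L}.
Hypothesis derD : forall x y, D (lie x y) = lie (D x) y + lie x (D y).

(* L acts on K x L through the adjoint action twisted by the cocycle D. *)
Fixpoint env_act (t : env_term K L) (v : K * L) : K * L :=
  match t with
  | EGen x => (0, v.1 *: D x + lie x v.2)
  | EZero => (0, 0)
  | EOne => v
  | EAdd s t => ((env_act s v).1 + (env_act t v).1, (env_act s v).2 + (env_act t v).2)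
  | EScale a t => (a * (env_act t v).1, a *: (env_act t v).2)
  | EMul s t => env_act s (env_act t v)
  end.

Lemma env_actD t a b m n : env_act t (a + b, m + n) =
  ((env_act t (a, m)).1 + (env_act t (b, n)).1, (env_act t (a, m)).2 + (env_act t (b, n)).2).
Proof.
elim: t a b m n => [x|||s IHs t IHt|c t IHt|s IHs t IHt] a b m n //=.
- by rewrite addr0 linearD /= scalerDl addrACA.
- by rewrite !addr0.
- by rewrite IHs IHt /=; congr pair; rewrite addrACA.
- by rewrite IHt /= mulrDr scalerDr.
- by rewrite IHt IHs -!surjective_pairing.
Qed.

Lemma env_actZ t c a m : env_act t (c * a, c *: m) =
  (c * (env_act t (a, m)).1, c *: (env_act t (a, m)).2).
Proof.
elim: t a m => [x|||s IHs t IHt|d t IHt|s IHs t IHt] a m //=.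
- by rewrite mulr0 linearZ scalerDr scalerA.
- by rewrite mulr0 scaler0.
- by rewrite IHs IHt /= mulrDr scalerDr.
- by rewrite IHt /= mulrCA !scalerA [d * c]mulrC.
- by rewrite IHt IHs -!surjective_pairing.
Qed.

Lemma env_act_eq s t : env_eq s t -> env_act s =1 env_act t.
Proof.
elim=> {s t} /=.
- move=> x y v; congr pair; first by rewrite addr0.
  by rewrite [D _]linearD lieDl; module_over K.
- move=> a x v; congr pair; first by rewrite mulr0.
  by rewrite [D _]linearZ lieZl /=; module_over K.
- move=> x y v; rewrite !mulr0 addr0 !scale0r !add0r derD; congr pair.
  rewrite !lieDr !lieZr [lie (D x) y]lieC [lie x (lie y v.2)]lie_der.
  by module_over K.
- by [].
- by move=> s t _ st v; rewrite st.
- by move=> s t u _ st _ tu v; rewrite st tu.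
- by move=> s s' t t' _ ss _ tt v; rewrite ss tt.
- by move=> a t t' _ tt v; rewrite tt.
- by move=> s s' t t' _ ss _ tt v; rewrite tt ss.
- by move=> s t u v; rewrite !addrA.
- by move=> s t v; rewrite [X in (X, _)]addrC [X in (_, X)]addrC.
- by move=> t v; rewrite !add0r -surjective_pairing.
- by move=> t v; rewrite mulN1r scaleN1r !addNr.
- by move=> a b t v; rewrite mulrA scalerA.
- by move=> t v; rewrite mul1r scale1r -surjective_pairing.
- by move=> a s t v; rewrite mulrDr scalerDr.
- by move=> a b t v; rewrite mulrDl scalerDl.
- by [].
- by [].
- by [].
- by [].
- by move=> s t u v; rewrite env_actD -!surjective_pairing.
- by [].
- by move=> a s t v; rewrite env_actZ -surjective_pairing.
Qed.

(** Acting on (1, 0) recovers D x from the image of x in the enveloping algebra. For the height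
    derivation, which is multiplication by n in degree n > 0, this gives injectivity on graded
    pieces, as the Poincare-Birkhoff-Witt theorem would. *)
Lemma env_in_der x y : env_in x = env_in y -> D x = D y.
Proof.
move=> /env_piP/env_act_eq /(_ (1, 0)) /=.
by rewrite !scale1r !lie0r !addr0 => -[].
Qed.

End EnvelopingEmbedding.

Section KacMoodyUnits.
Variables (r : nat) (A : 'M[int]_r).
Hypothesis gcmA : gcm A.
Local Notation L := (nplus A).
Local Notation e := (nplus_e A).
Local Notation C := (env_hat A).
Local Notation io := (@env_in rat (nplus A)).

Definition height_der : {linear L -> L} := grading_der A (fun=> 1).

Lemma height_der_lie x y : height_der (lie x y) = lie (height_der x) y + lie x (height_der y).
Proof. exact: grading_der_lie. Qed.

Lemma height_der_root alpha (x : L) : root_space alpha x -> height_der x = (ht alpha)%:~R *: x.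
Proof.
move=> /grading_der_root ->; congr (_ *: _); rewrite /ht rmorph_sum.
by apply: eq_bigr => i _; rewrite mul1r.
Qed.

Section HomogeneousWords.
Variables (T : eqType) (a : T -> L) (b : T -> nat).
Hypothesis da : forall t, height_der (a t) = (b t)%:R *: a t.

Definition words_of_height n : set L :=
  lspan (lie_word a @` [set w | word_height b w = n])%classic.

Lemma height_der_words n x : words_of_height n x -> height_der x = n%:R *: x.
Proof.
have dw w : height_der (lie_word a w) = (word_height b w)%:R *: lie_word a w.
  move: w; apply: word_ind => [t|t u s IHs].
    by rewrite lie_word1 da /word_height big_seq1.
  rewrite lie_wordS height_der_lie da IHs lieZl lieZr -scalerDl -natrD.
  by rewrite [in RHS]/word_height big_cons.
elim=> {x} [_ [w wn <-]||x y _ IHx _ IHy|c x _ IHx].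
- by rewrite dw wn.
- by rewrite linear0 scaler0.
- by rewrite linearD /= IHx IHy scalerDr.
- by rewrite linearZ /= IHx !scalerA mulrC.
Qed.

Lemma words_of_heightL m n x y : words_of_height m x -> words_of_height n y ->
  words_of_height (m + n) (lie x y).
Proof.
apply: lie_span_lie => u v w <- <- uvw /=.
by rewrite /word_height (perm_big _ uvw) big_cat.
Qed.

Lemma words_of_height_in x n : lspan (range (lie_word a)) x ->
  height_der x = n%:R *: x -> words_of_height n x.
Proof.
move=> sx dx.
apply: (@eigen_in _ _ height_der _ (fun n : nat => n%:R) words_of_height) dx.
- by move=> i j /eqP; rewrite eqr_nat => /eqP.
- by move=> j; apply: lspan0.
- by move=> j u v; apply: lspanD.
- by move=> j c u; apply: lspanZ.
- exact: height_der_words.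
apply: lspan_mono sx => _ [w _ <-]; exists (word_height b w).
by apply: lspan_in; exists w.
Qed.

Lemma words_of_height_inj n x y : (0 < n)%N -> words_of_height n x ->
  words_of_height n y -> io x = io y -> x = y.
Proof.
move=> n0 nx ny /(env_in_der height_der_lie).
rewrite (height_der_words nx) (height_der_words ny) => /scalerI; apply.
by rewrite pnatr_eq0 gtn_eqF.
Qed.

(** With letters of height at most B, a word of height above (N+1)B has too many letters to be
    nonzero. *)
Lemma words_nilpotent N B : (forall t, (b t <= B)%N) ->
  (forall w, (N <= size w.2)%N -> lie_word a w = 0) ->
  forall n x, (N.+1 * B < n)%N -> words_of_height n x -> x = 0.
Proof.
move=> bB nilN n x Nn.
apply: (@lspan_sub _ _ _ (fun x => x = 0)) => [_ [w wn <-]|//|u v -> ->|c u ->].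
- apply: nilN; rewrite leqNgt; apply/negP => wN; move: Nn; rewrite -wn ltnNge.
  suff -> : (word_height b w <= N.+1 * B)%N by [].
  have : (word_height b w <= (size w.2).+1 * B)%N.
    rewrite /word_height -[(size w.2).+1]/(size (letters w)).
    elim: (letters w) => [|t s IHs]; first by rewrite big_nil.
    by rewrite big_cons mulSn leq_add.
  by move/leq_trans; apply; rewrite leq_mul2r ltnS (ltnW wN) orbT.
- by rewrite addr0.
- by rewrite scaler0.
Qed.

Variable c : T -> rat -> units C.
Hypothesis b0 : forall t, (0 < b t)%N.
Hypothesis c_exp : forall t q, exists hx : height_pieces A (b t) (io (q *: a t)),
  uval (c t q) = cexp (homog hx).

Lemma exp_family_low t q : low (b t) (uval (c t q) - 1) /\ uval (c t q) (b t) = io (q *: a t).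
Proof. by have [hx cx] := c_exp t q; apply: cexp_homog_low cx. Qed.

Definition word_unit := lie_unit (G := height_pieces A) io words_of_height.

Lemma exp_family_lie t q : word_unit (c t q).
Proof.
have [hx cx] := c_exp t q.
apply: (@lie_unit_cexp _ _ _ _ io words_of_height) cx => //.
- by move=> n; apply: lspan0.
- by move=> n k x; apply: lspanZ.
- apply/lspanZ/lspan_in; exists (t, [::]) => //=.
  by rewrite /word_height big_seq1.
Qed.

Lemma words_exhaust (Q : nat -> units C -> Prop) N :
  (forall n x, (N <= n)%N -> words_of_height n x -> x = 0) ->
  (forall n, Q n 1%g) -> (forall n g h, Q n g -> Q n h -> Q n (g * h)%g) ->
  (forall n g, Q n.+1 g -> Q n g) ->
  (forall w q, Q (word_height b w) (word_comm c w q)) ->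
  forall n g, (0 < n)%N -> word_unit g -> low n (uval g - 1) -> Q n g.
Proof.
move=> MN Q1 QM QS Qw; have M0 n : words_of_height n 0 := lspan0 _.
have MD n x y : words_of_height n x -> words_of_height n y -> words_of_height n (x + y) := @lspanD _ _ _ x y.
have MZ n q x : words_of_height n x -> words_of_height n (q *: x) := @lspanZ _ _ _ q x.
apply: (@lie_unit_exhaust _ _ _ _ io (@env_in_lie _ _) words_of_height M0 MD MZ words_of_heightL Q N) => //.
(* A unit with leading term q x is sought for every scalar q: words absorb q in their parameter,
   sums become products, and the case of a scalar multiple is immediate. *)
move=> n x n0 nx; rewrite -[x]scale1r; move: (1 : rat).
elim: nx => {x} [_ [w <- <-]||x y _ IHx _ IHy|d x _ IHx] q.
- exists (word_comm c w q).
  have [lw wl we] := @word_comm_lead _ _ _ _ io (@env_in_lie _ _) words_of_height M0 MD MZ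
    words_of_heightL _ a b c b0 exp_family_low exp_family_lie w q.
  by split.
- exists 1%g; split=> //.
  + split=> [|k]; [exact: hcomp1|].
    rewrite /ell -[uval 1%g]/(1 : C) cdeg1 mulr0; exists 0; [exact: lspan0|].
    by rewrite linear0.
  + by move=> i _; rewrite hcompB subrr.
  + by rewrite scaler0 linear0 hcomp1 gtn_eqF.
- have [g [Qg lg ng gx]] := IHx q; have [h [Qh lh nh hx]] := IHy q.
  have [ngh ghx] := low_unitM n0 ng nh.
  exists (g * h)%g; split=> //; first exact: QM.
    exact: (lie_unitM (@env_in_lie _ _) M0 MD MZ words_of_heightL).
  by rewrite ghx gx hx scalerDr linearD.
- by rewrite scalerA; apply: IHx.
Qed.

End HomogeneousWords.

End KacMoodyUnits.

Section Generation.
Variables (r : nat) (A : 'M[int]_r).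
Hypothesis gcmA : gcm A.
Hypothesis sphA : two_spherical A.
Local Notation L := (nplus A).
Local Notation e := (nplus_e A).
Local Notation C := (env_hat A).
Local Notation io := (@env_in rat (nplus A)).
Local Notation alpha_ := (@simple_root r).

Lemma exp_unit_exists d x (hx : height_pieces A d x) : (0 < d)%N ->
  exists u : units C, uval u = cexp (homog hx).
Proof.
move=> d0; have f0 : homog hx 0%N = 0 by rewrite /= ltn_eqF.
have E2 : cexp (- homog hx) * cexp (homog hx) = 1.
  by rewrite -{2}[homog hx]opprK cexpxN // hcompN f0 oppr0.
by exists (Units (cexpxN f0) E2).
Qed.

Definition simple_units : set (units C) :=
  [set u | exists i a, u = simple_exp A i a]%classic.

Lemma gen_comm (G : groupType) (S : set G) (g h : G) :
  gen S g -> gen S h -> gen S [~ g, h]%g.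
Proof. by move=> Sg Sh; do ?apply: gen_M => //; apply: gen_V. Qed.

Lemma homog_eq d x y (hx : height_pieces A d x) (hy : height_pieces A d y) :
  x = y -> homog hx = homog hy.
Proof. by move=> xy; apply/completion_eq => n /=; rewrite xy. Qed.

(** For a non-simple root, exp x is of Lie type for the nilpotent algebra of [root_path_spanned],
    hence a product of iterated commutators of exponentials of two real root vectors. Their paths
    are shorter, so induction applies. *)
Lemma root_path_gen n alpha u : root_path A n alpha -> root_group alpha u ->
  gen simple_units u.
Proof.
elim/ltn_ind: n alpha u => -[|n] IHn alpha u pa [d [x [hx [rx hd ux]]]].
  inversion pa as [i e1 e2|]; subst alpha.
  have d1 : d = 1%N by move: hd; rewrite ht_simple_root => -[].
  subst d; have [c xc] := root_space_simple rx.
  apply: gen_in; exists i, c; apply: units_eq; rewrite ux.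
  by congr cexp; apply: homog_eq; rewrite xc.
have rank2_nil (i j : 'I_r) : i != j ->
    exists N, forall w, (N <= size w.2)%N -> lie_word (rank2 A i j) w = 0.
  by move=> ij; exists 5%N; apply: two_spherical_nil.
have [b [a [N [bp [ra _] _ nilN sp]]]] := root_path_spanned gcmA rank2_nil pa.
pose h t := `|ht (b t)|%N.
have hE t : ht (b t) = (h t)%:Z.
  by have [m _ /(root_path_pos gcmA)[_ h1]] := bp t; rewrite /h; lia.
have h0 t : (0 < h t)%N.
  by have [m _ /(root_path_pos gcmA)[_ h1]] := bp t; rewrite /h; lia.
have da t : height_der A (a t) = (h t)%:R *: a t.
  by rewrite (height_der_root (ra t).1) hE.
have hq t q : height_pieces A (h t) (io (q *: a t)).
  by apply: env_height_in (root_spaceZ q (ra t).1) (hE t).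
have ex t q := exp_unit_exists (hq t q) (h0 t).
pose c t q := projT1 (cid (ex t q)).
have cE t q : uval (c t q) = cexp (homog (hq t q)) := projT2 (cid (ex t q)).
have d0 : (0 < d)%N.
  by have [_ h1] := root_path_pos gcmA pa; move: h1; rewrite hd.
have ce t q : exists hx : height_pieces A (h t) (io (q *: a t)), uval (c t q) = cexp (homog hx).
  by exists (hq t q).
have bB t : (h t <= h true + h false)%N by case: t; rewrite ?leq_addr ?leq_addl.
have nilw := words_nilpotent bB nilN.
apply: (words_exhaust (a := a) (b := h) h0 ce (Q := fun=> gen simple_units)
  (N := (N.+1 * (h true + h false)).+1) _ _ _ _ _ d0) => //.
- move=> _; exact: (@gen_1 _ simple_units).
- by move=> _ g g'; apply: gen_M.
- move=> w q; have cS t q' : gen simple_units (c t q').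
    have [m mn pm] := bp t; apply: (IHn m _ (b t)) => //.
    by exists (h t), (q' *: a t), (hq t q'); split=> //; apply/root_spaceZ/(ra t).1.
  case: w => t s; rewrite /word_comm; elim: s t q => [|t' s IHs] t q /=; first exact: cS.
  by apply: gen_comm => //; apply: IHs.
- apply: (@lie_unit_cexp _ _ _ _ io (words_of_height a h)) ux => //.
  + by move=> m; apply: lspan0.
  + by move=> m q y; apply: lspanZ.
  + apply: words_of_height_in => //; first exact: sp.
    by rewrite (height_der_root rx) hd.
- by have [] := cexp_homog_low d0 ux.
Qed.

Definition simple_elements : set (uplus A) :=
  [set g | exists i a, g = uplus_x A i a]%classic.

Lemma uplus_val_inj (g h : uplus A) : gen_val g = gen_val h -> g = h.
Proof. exact: val_inj. Qed.

Lemma uplus_gen (g : uplus A) : gen simple_elements g.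
Proof.
have lift u : gen simple_units u -> exists2 h : uplus A, gen_val h = u & gen simple_elements h.
  elim=> {u} [_ [i [a ->]]||u v _ [h <- Sh] _ [k <- Sk]|u _ [h <- Sh]].
  - by exists (uplus_x A i a) => //; apply: gen_in; exists i, a.
  - by exists 1%g => //; apply: gen_1.
  - by exists (h * k)%g => //; apply: gen_M.
  - by exists h^-1%g => //; apply: gen_V.
have [h hg Sh] : exists2 h : uplus A, gen_val h = gen_val g & gen simple_elements h.
  apply: lift; have /asboolP := gen_valP g.
  elim=> {g} [u [alpha /(real_root_path gcmA)[n pa] ru]||u v _ Su _ Sv|u _ Su].
  - exact: root_path_gen pa ru.
  - exact: gen_1.
  - exact: gen_M.
  - exact: gen_V.
by rewrite -(uplus_val_inj hg).
Qed.

Lemma uplus_xD i a b : uplus_x A i (a + b) = (uplus_x A i a * uplus_x A i b)%g.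
Proof.
apply: uplus_val_inj; apply/esym.
have E : io ((a + b) *: e i) = io (a *: e i) + io (b *: e i).
  by rewrite scalerDl linearD.
have hab : height_pieces A 1 (io (a *: e i) + io (b *: e i)).
  by rewrite -E; apply: simple_height.
apply: (cexp_homogD (hx := simple_height A i a) (hy := simple_height A i b) (hxy := hab)) => //.
- by rewrite !linearZ /= -!scalerAl -!scalerAr !scalerA mulrC.
- by congr cexp; apply: homog_eq.
Qed.

Lemma val_word_commg (T : eqType) (x : T -> rat -> uplus A) w a :
  gen_val (word_commg x w a) = word_comm (fun t q => gen_val (x t q)) w a.
Proof.
case: w => t s; elim: s t a => [|u s IHs] t a //.
transitivity [~ gen_val (x t a), gen_val (word_commg x (u, s) 1)]%g => //.
by rewrite IHs.
Qed.

Lemma serre_word (i j : 'I_r) p :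
  word_term (i, nseq p i ++ [:: j]) = serre_term i j p.+1.
Proof. by elim: p => // p IHp; rewrite -[RHS]/(LLie (LGen i) (serre_term i j p.+1)) -IHp. Qed.

(** The leading term of the group commutator is the Serre element, which is zero. Being of Lie type
    for the nilpotent algebra of e_i and e_j, the commutator is then a finite product of commutators
    of words with at least one more letter. *)
Lemma serre_relation t : serre A t -> exists2 w, t = word_term w &
  forall a, lcs (size w.2).+2 (word_commg (uplus_x A) w a).
Proof.
move=> rt; have := rt; case=> i [j [ij tE]]; have [p kE Aij] := serre_exp gcmA ij.
exists (i, nseq p i ++ [:: j]); first by rewrite serre_word tE kE.
move=> a; set w := (i, _); pose w' := (true, nseq p true ++ [:: false]).
pose f (u : bool) := if u then i else j.
have ww' : w = (f w'.1, map f w'.2) by rewrite /w /w' /= map_cat map_nseq.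
pose x u q := uplus_x A (f u) q.
have xw (v : bool * seq bool) q :
    word_commg (uplus_x A) (f v.1, map f v.2) q = word_commg x v q.
  by rewrite /word_commg /= -map_comp.
have sw : word_height (fun=> 1%N) w' = p.+2.
  by rewrite /word_height sum1_size /= size_cat size_nseq addn1.
have sz : size w.2 = p.+1 by rewrite size_cat size_nseq addn1.
have ce u q : exists hx : height_pieces A 1 (io (q *: rank2 A i j u)),
    uval (gen_val (x u q)) = cexp (homog hx).
  by exists (simple_height A (f u) q).
have b0 (u : bool) : (0 < 1)%N by [].
pose b := fun _ : bool => 1%N.
have MD n y z : words_of_height (rank2 A i j) b n y -> words_of_height (rank2 A i j) b n z ->
   words_of_height (rank2 A i j) b n (y + z) := @lspanD _ _ _ y z.
have MZ n q y : words_of_height (rank2 A i j) b n y ->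
   words_of_height (rank2 A i j) b n (q *: y) := @lspanZ _ _ _ q y.
have [lu wl wt] := @word_comm_lead _ _ _ _ io (@env_in_lie _ _)
  (words_of_height (rank2 A i j) b) (fun _ => lspan0 _) MD MZ
  (@words_of_heightL _ _ _ (rank2 A i j) b) _ (rank2 A i j) b _ b0
  (exp_family_low b0 ce) (exp_family_lie b0 ce) w' a.
have w0 : lie_word (rank2 A i j) w' = 0.
  rewrite -(lie_word_map f e) -ww'.
  rewrite -[LHS]/(lie_word (lie_gen (serre A)) w) -lie_pi_word.
  by rewrite serre_word; apply/serre_pi0/serre_term_rel.
rewrite w0 scaler0 linear0 sw in wt; rewrite sw in wl.
have wl' : low p.+3 (uval (word_comm (fun t q => gen_val (x t q)) w' a) - 1).
  move=> k; rewrite ltnS leq_eqVlt => /orP[/eqP ->|]; last exact: wl.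
  by rewrite hcompB wt hcomp1 subr0.
pose Q n (u : units C) := exists2 g : uplus A, gen_val g = u & lcs n g.
suff : Q p.+3 (word_comm (fun t q => gen_val (x t q)) w' a).
  rewrite -val_word_commg => -[g /uplus_val_inj gE].
  by rewrite sz ww' xw -gE.
have nilw := words_nilpotent (a := rank2 A i j) (b := b) (B := 1) (fun=> leqnn _)
  (two_spherical_nil gcmA sphA ij).
(* The value 7 is the first height beyond the bound (5+1) * 1 of [words_nilpotent], all letters
   having height 1. *)
apply: (words_exhaust (a := rank2 A i j) (b := b) b0 ce (N := 7) _ _ _ _ _ _ lu wl') => //.
- by move=> n; exists 1%g => //; apply: lcs1.
- by move=> n _ _ [g <- ng] [h <- nh]; exists (g * h)%g => //; apply: lcsM.
- by move=> n _ [g <- ng]; exists g => //; apply: lcs_sub.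
- move=> v q; exists (word_commg x v q); first exact: val_word_commg.
  by rewrite /word_height sum1_size; apply: word_commg_lcs.
Qed.

Lemma word_commg_balance (G : groupType) (I : eqType) (x : I -> rat -> G)
    (xD : forall i a b, x i (a + b) = (x i a * x i b)%g) i a w q :
  gr_class (size w.2).+1 [~ x i a, word_commg x w q]%g =
  gr_class (size w.2).+1 (word_commg x (i, letters w) (a * q)).
Proof.
pose f a b := gr_class (size w.2).+1 [~ x i a, word_commg x w b]%g.
have h b := word_commg_lcs x w b.
have -> : word_commg x (i, letters w) (a * q) = [~ x i (a * q)%R, word_commg x w 1]%g.
  by case: (w).
rewrite -/(f a q) -/(f _ 1) /f (word_commg_move xD) -!/(f _ _).
apply: rat_biadditive => [b|b] a1 a2.
  by rewrite /f xD; apply: (gr_commMl (m := 0) (n := size w.2)).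
rewrite /f -(gr_commMr (m := 0) (n := size w.2)) //.
apply: (gr_comm_congr (m := 0) (n := size w.2)) => //; first exact: lcsM.
by rewrite gr_classM // (word_commg_additive xD).
Qed.

Section GradedSpan.
Variables (G : groupType) (I : eqType) (x : I -> rat -> G).
Hypothesis xD : forall i a b, x i (a + b) = (x i a * x i b)%g.
Hypothesis x_gen : forall g : G, gen [set h | exists i a, h = x i a]%classic g.

Definition class_span n (z : lcs_gr G n) := exists2 s : seq (rat * (I * seq I)),
  {in s, forall p, size p.2.2 = n} &
  z = \sum_(p <- s) gr_class n (word_commg x p.2 p.1).

Lemma class_span0 n : class_span (0 : lcs_gr G n).
Proof. by exists [::]; rewrite ?big_nil. Qed.

Lemma class_spanD n (y z : lcs_gr G n) : class_span y -> class_span z -> class_span (y + z).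
Proof.
move=> [s sn ->] [t tn ->]; exists (s ++ t); last by rewrite big_cat.
by move=> p; rewrite mem_cat => /orP[/sn|/tn].
Qed.

Lemma class_spanN n (z : lcs_gr G n) : class_span z -> class_span (- z).
Proof.
move=> [s sn ->]; exists [seq (- p.1, p.2) | p <- s].
  by move=> p /mapP[q /sn qn ->].
rewrite big_map -sumrN big_seq [RHS]big_seq; apply: eq_bigr => p /sn <-.
by rewrite (rat_additiveN _ (word_commg_additive xD _)).
Qed.

(** Induction on n by bi-additivity of the commutator and generation by the x i a;
    [word_commg_balance] merges the parameter of a new outer letter with that of the word inside. *)
Lemma gr_class_span n g : lcs n.+1 g -> class_span (gr_class n g).
Proof.
elim: n g => [|n IHn] g.
  move=> _; elim: (x_gen g) => {g} [_ [i [a ->]]||g h _ IHg _ IHh|g _ IHg].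
  - by exists [:: (a, (i, [::]))]; rewrite ?big_seq1 // => p; rewrite inE => /eqP ->.
  - by rewrite gr_class1; apply: class_span0.
  - by rewrite gr_classM //; apply: class_spanD.
  - by rewrite gr_classV //; apply: class_spanN.
rewrite lcsS; elim=> {g} [_ [u _ [v nv ->]]||g h Sg IHg Sh IHh|g Sg IHg].
- elim: (x_gen u) => {u} [_ [i [a ->]]||g h _ IHg _ IHh|g _ IHg].
  + rewrite -gr_adE //; have [s sn ->] := IHn v nv.
    rewrite (big_morph (gr_ad (x i a)) (@gr_adD _ n _) (gr_ad0 _ _)).
    exists [seq (a * p.1, (i, letters p.2)) | p <- s].
      by move=> p /mapP[q /sn qn ->] /=; rewrite qn.
    rewrite big_map big_seq [RHS]big_seq; apply: eq_bigr => p /sn pn.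
    rewrite -pn gr_adE; first exact: word_commg_balance.
    exact: word_commg_lcs.
  + by rewrite commgEl conj1g mulg1 invg1 gr_class1; apply: class_span0.
  + by rewrite (gr_commMl (m := 0) (n := n)) //; apply: class_spanD.
  + by rewrite (gr_commVl (m := 0) (n := n)) //; apply: class_spanN.
- by rewrite gr_class1; apply: class_span0.
- by rewrite gr_classM //; apply: class_spanD.
- by rewrite gr_classV //; apply: class_spanN.
Qed.

End GradedSpan.

End Generation.

(** * The normal form *)

Section NormalForm.
Variables (r : nat) (A : 'M[int]_r) (d : Order.disp_t) (B : orderType d).
Variable word : B -> 'I_r * seq 'I_r.
Hypothesis gcmA : gcm A.
Hypothesis sphA : two_spherical A.
Hypothesis basis : is_basis (fun x : B => nested_lie A (word x)).
Hypothesis word_lt : forall x y : B,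
  (word_length (word x) < word_length (word y))%N -> (x < y)%O.
Local Notation L := (nplus A).
Local Notation e := (nplus_e A).
Local Notation G := (uplus A).
Local Notation io := (@env_in rat (nplus A)).
Local Notation len x := (word_length (word x)).
Local Notation wc := (word_commg (uplus_x A)).

Lemma word_inj : injective word.
Proof.
move=> x y xy; apply/eqP; apply: contraT => nxy.
pose c z : rat := if z == x then 1 else -1.
have := basis.1 [:: x; y] c; rewrite /= inE nxy !big_cons big_nil /c eqxx eq_sym (negPf nxy).
rewrite xy scale1r scaleN1r addr0 subrr => /(_ erefl erefl x).
by rewrite inE eqxx => /(_ isT)/eqP; rewrite oner_eq0.
Qed.

Lemma len_le x y : (x <= y)%O -> (len x <= len y)%N.
Proof. by apply: contraTT; rewrite -ltnNge -ltNge; apply: word_lt. Qed.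

(** Finite because the alphabet is, and because distinct basis elements have distinct words. *)
Lemma level_exists n : exists s : seq B, sorted <%O s /\ forall x, (x \in s) = (len x == n).
Proof.
pose f (t : n.-tuple 'I_r) : option B :=
  if pselect (exists x, letters (word x) = t) is left H then Some (projT1 (cid H)) else None.
pose s0 := pmap f (enum {: n.-tuple 'I_r}).
exists (sort <=%O (undup s0)); split; first by rewrite sort_lt_sorted undup_uniq.
move=> x; rewrite mem_sort mem_undup mem_pmap; apply/mapP/eqP => [[t _]|xn].
  rewrite /f; case: pselect => // H [->]; case: cid => y /= yt.
  by have := size_tuple t; rewrite -yt.
have szx : size (letters (word x)) == n by rewrite -xn.
exists (Tuple szx); first by rewrite mem_enum.
rewrite /f; case: pselect => [H|[]]; last by exists x.
case: cid => y /= yx; congr Some; apply: word_inj.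
by case: (word x) (word y) yx => [i s] [j t] [-> ->].
Qed.

Definition level n : seq B := projT1 (cid (level_exists n)).
Lemma level_sorted n : sorted <%O (level n).
Proof. exact: (projT2 (cid (level_exists n))).1. Qed.
Lemma mem_level n x : (x \in level n) = (len x == n).
Proof. exact: (projT2 (cid (level_exists n))).2. Qed.
Lemma level_uniq n : uniq (level n).
Proof. exact: lt_sorted_uniq (level_sorted n). Qed.

Definition above n : pred B := fun x => (n < len x)%N.

Lemma initial_segment_exists n k : exists2 s : seq B, initial_segment (above n) s &
  forall x, (n < len x <= n + k)%N -> x \in s.
Proof.
pose s0 := flatten [seq level i | i <- iota n.+1 k].
have ms x : (x \in s0) = (n < len x <= n + k)%N.
  apply/flattenP/idP => [[_ /mapP[i ik ->]]|xn].
    by rewrite mem_level => /eqP ->; move: ik; rewrite mem_iota addSn ltnS.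
  exists (level (len x)); last by rewrite mem_level.
  by apply: map_f; rewrite mem_iota addSn ltnS.
exists (sort <=%O (undup s0)) => [|x]; last by rewrite mem_sort mem_undup ms.
split; first by rewrite sort_lt_sorted undup_uniq.
  by apply/allP => x; rewrite mem_sort mem_undup ms => /andP[].
move=> x y; rewrite !mem_sort !mem_undup !ms => /andP[_ xk] yn /len_le yx.
by rewrite [(n < _)%N]yn (leq_trans yx).
Qed.

(** Since shorter words come first, the elements of length n+1 form a prefix. *)
Lemma initial_segment_split n s : initial_segment (above n) s ->
  {subset level n.+1 <= s} ->
  exists2 t, s = level n.+1 ++ t & initial_segment (above n.+1) t.
Proof.
move=> [ss /allP as_ ds] ls; pose t := [seq x <- s | above n.+1 x].
exists t; last first.
  split; first exact: (sorted_filter (@lt_trans _ B)).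
    exact: filter_all.
  move=> x y; rewrite !mem_filter => /andP[_ xs] yn yx; rewrite yn.
  by apply: (ds x) => //; apply: ltnW.
apply: lt_sorted_eq => //.
  rewrite (sorted_pairwise (@lt_trans _ B)) pairwise_cat -!(sorted_pairwise (@lt_trans _ B)).
  rewrite level_sorted (sorted_filter (@lt_trans _ B)) // !andbT.
  apply/allrelP => x y; rewrite mem_level mem_filter => /eqP xn /andP[yn _].
  by apply: word_lt; rewrite xn.
move=> x; rewrite mem_cat mem_filter mem_level.
case xs: (x \in s); last first.
  rewrite andbF orbF; apply/esym/negP => /eqP xn.
  by move: xs; rewrite ls // mem_level xn.
by have := as_ x xs; rewrite andbT /above leq_eqVlt eq_sym.
Qed.

Lemma initial_segment_total s t :
  initial_segment (xpredT : pred B) s -> initial_segment (xpredT : pred B) t ->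
  {subset s <= t} \/ {subset t <= s}.
Proof.
move=> [_ _ ds] [_ _ dt]; case: (pselect {subset s <= t}) => [|st]; first by left.
right=> y yt; have [x xs xt] : exists2 x, x \in s & x \notin t.
  apply: contrapT => nx; apply: st => x xs; apply: contrapT => /negP xt.
  by apply: nx; exists x.
apply: (ds x) => //; rewrite leNgt; apply/negP => /ltW xy.
by move/negP: xt; apply; apply: (dt y).
Qed.

Let da (i : 'I_r) : height_der A (e i) = 1%N%:R *: e i.
Proof. by rewrite (height_der_root (root_space_e A _)) ht_simple_root. Qed.

Let one_gt0 (i : 'I_r) : (0 < 1)%N. Proof. by []. Qed.

Let x_exp (i : 'I_r) q : exists hx : height_pieces A 1 (io (q *: e i)),
  uval (gen_val (uplus_x A i q)) = cexp (homog hx).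
Proof. by exists (simple_height A i q). Qed.

Lemma words_of_length n (w : 'I_r * seq 'I_r) : size w.2 = n -> word_height (fun=> 1%N) w = n.+1 :> nat.
Proof. by rewrite /word_height sum1_size => <-. Qed.

Lemma word_commg_lead w q n : size w.2 = n ->
  uval (gen_val (wc w q)) n.+1 = io (q *: nested_lie A w).
Proof.
move=> wn; pose M := words_of_height e (fun=> 1%N).
have M0 k : M k 0 := lspan0 _.
have MD k y z : M k y -> M k z -> M k (y + z) := @lspanD _ _ _ y z.
have MZ k a y : M k y -> M k (a *: y) := @lspanZ _ _ _ a y.
have [_ _] := @word_comm_lead _ _ _ _ io (@env_in_lie _ _) M M0 MD MZ
  (@words_of_heightL _ _ _ e (fun=> 1%N)) _ e (fun=> 1%N) _ one_gt0
  (exp_family_low one_gt0 x_exp) (exp_family_lie one_gt0 x_exp) w q.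
by rewrite (words_of_length wn) val_word_commg.
Qed.

Lemma uplus_low1 (g : G) : low 1 (uval (gen_val g) - 1).
Proof.
elim: (uplus_gen gcmA sphA g) => {g} [_ [i [a ->]]||g h _ lg _ lh|g _ lg].
- by have [] := exp_family_low one_gt0 x_exp i a.
- by move=> i _; rewrite hcompB subrr.
- by have [] := low_unitM (ltn0Sn 0) lg lh.
- by have [] := low_unitV (ltn0Sn 0) lg.
Qed.

Lemma lcs_low n (g : G) : lcs n.+1 g -> low n.+1 (uval (gen_val g) - 1).
Proof.
elim: n g => [|n IHn] g; first by move=> _; apply: uplus_low1.
rewrite lcsS; elim=> {g} [_ [g _ [h nh ->]]||g h _ lg _ lh|g _ lg].
- by have [] := comm_low (ltn0Sn 0) (ltn0Sn n) (uplus_low1 g) (IHn h nh).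
- by move=> i _; rewrite hcompB subrr.
- by have [] := low_unitM (ltn0Sn n.+1) lg lh.
- by have [] := low_unitV (ltn0Sn n.+1) lg.
Qed.

Lemma lead_prod n (s : seq B) (lam : B -> rat) : {in s, forall x, len x = n.+1} ->
  lcs n.+1 (\prod_(x <- s) wc (word x) (lam x))%g /\
  uval (gen_val (\prod_(x <- s) wc (word x) (lam x))%g) n.+1 =
    io (\sum_(x <- s) lam x *: nested_lie A (word x)).
Proof.
elim: s => [|x s IHs] sn.
  by rewrite !big_nil linear0; split; [apply: lcs1|apply: hcomp1].
have [|l1 l2] := IHs; first by move=> y ys; apply: sn; rewrite inE ys orbT.
have [xn] := sn x (mem_head _ _).
have lx : lcs n.+1 (wc (word x) (lam x)).
  by rewrite -xn; apply: word_commg_lcs.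
rewrite !big_cons; split; first exact: lcsM.
have [_] := low_unitM (ltn0Sn n) (lcs_low lx) (lcs_low l1).
by rewrite l2 (word_commg_lead _ xn) linearD.
Qed.

(** The hypothesis forces equal components of degree n+1, that is, equal images of two linear
    combinations of basis words in the enveloping algebra; injectivity there and independence of the
    basis give equal coefficients. *)
Lemma level_unique n (lam mu : B -> rat) :
  lcs n.+2 ((\prod_(x <- level n.+1) wc (word x) (lam x))^-1 *
            \prod_(x <- level n.+1) wc (word x) (mu x))%g ->
  {in level n.+1, lam =1 mu}.
Proof.
have ln : {in level n.+1, forall x, len x = n.+1} by move=> x; rewrite mem_level => /eqP.
have [l1 l2] := lead_prod lam ln; have [m1 m2] := lead_prod mu ln.
set P := (\prod_(x <- _) _)%g in l1 l2 *; set Q := (\prod_(x <- _) _)%g in m1 m2 *.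
move=> /lcs_low PQ.
have : uval (gen_val (P^-1 * Q)%g) n.+1 = 0 by apply: low_unitE PQ; rewrite ltnS leqnn.
have [loV eV] := low_unitV (ltn0Sn n) (lcs_low l1).
have [_ ->] := low_unitM (ltn0Sn n) loV (lcs_low m1).
rewrite eV l2 m2 addrC -linearB /= => io0.
have s0 : \sum_(x <- level n.+1) (mu x - lam x) *: nested_lie A (word x) = 0.
  rewrite -[RHS](subrr (0 : L)); set S := \sum_(x <- _) _.
  have SE : S = \sum_(x <- level n.+1) mu x *: nested_lie A (word x) -
      \sum_(x <- level n.+1) lam x *: nested_lie A (word x).
    by rewrite -sumrB; apply: eq_bigr => x _; rewrite scalerBl.
  rewrite subrr; apply: (words_of_height_inj da (n := n.+1)) => //.
  - apply: lspan_sum => x /ln [xn] _; apply/lspanZ/lspan_in.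
    by exists (word x) => //=; apply: words_of_length.
  - exact: lspan0.
  - by rewrite SE io0 linear0.
move=> x xl; have := basis.1 (level n.+1) (fun x => mu x - lam x) (level_uniq _) s0 x xl.
by move/eqP; rewrite subr_eq0 => /eqP.
Qed.

Lemma lspan_finite (s : seq B) (b : B -> L) x : uniq s ->
  lspan (b @` [set t | t \in s])%classic x ->
  exists lam : B -> rat, x = \sum_(t <- s) lam t *: b t.
Proof.
move=> us; elim=> {x} [_ [t ts <-]||y z _ [l ->] _ [m ->]|a y _ [l ->]].
- exists (fun t' => if t' == t then 1 else 0).
  rewrite (bigD1_seq t) //= eqxx scale1r big1 ?addr0 // => t' /negPf ->.
  by rewrite scale0r.
- by exists (fun=> 0); rewrite big1 // => t _; rewrite scale0r.
- exists (fun t => l t + m t); rewrite -big_split; apply: eq_bigr => t _.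
  by rewrite scalerDl.
- exists (fun t => a * l t); rewrite scaler_sumr; apply: eq_bigr => t _.
  by rewrite scalerA.
Qed.

(** The basis consists of eigenvectors of the height derivation, so an element of height n+1
    involves only the basis words of that length. *)
Lemma basis_height n (x : L) : words_of_height e (fun=> 1%N) n.+1 x ->
  exists lam : B -> rat, x = \sum_(t <- level n.+1) lam t *: nested_lie A (word t).
Proof.
move=> nx; apply: (lspan_finite (level_uniq _)).
pose S k := lspan ((fun t => nested_lie A (word t)) @` [set t | t \in level k])%classic.
apply: (@eigen_in _ _ (height_der A) _ (fun n : nat => n%:R) S) (height_der_words da nx).
- by move=> i j /eqP; rewrite eqr_nat => /eqP.
- by move=> j; apply: lspan0.
- by move=> j u v; apply: lspanD.
- by move=> j c u; apply: lspanZ.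
- move=> j u; elim=> {u} [_ [t tj <-]||u v _ IHu _ IHv|c u _ IHu].
  + rewrite (height_der_root (nested_lie_root A _)) ht_content.
    by move: tj; rewrite /= mem_level => /eqP ->.
  + by rewrite linear0 scaler0.
  + by rewrite linearD /= IHu IHv scalerDr.
  + by rewrite linearZ /= IHu !scalerA mulrC.
have [s [c ->]] := basis.2 x.
apply: lspan_sum => t _ _; apply/lspanZ/lspan_in; exists (len t).
by apply: lspan_in; exists t; rewrite //= mem_level.
Qed.

(** The class of g is a sum of classes of word commutators. The corresponding sum of Lie words is
    expanded in the basis, and [word_commg_relation] carries this expansion back to the graded
    quotient. *)
Lemma level_exists_coef n (g : G) : lcs n.+1 g -> exists lam : B -> rat,
  lcs n.+2 ((\prod_(x <- level n.+1) wc (word x) (lam x))^-1 * g)%g.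
Proof.
move=> ng; have [s sn gE] := gr_class_span (uplus_xD A) (uplus_gen gcmA sphA) ng.
pose x := \sum_(p <- s) p.1 *: lie_word e p.2.
have nx : words_of_height e (fun=> 1%N) n.+1 x.
  apply: lspan_sum => p /sn pn _; apply/lspanZ/lspan_in.
  by exists p.2 => //=; apply: words_of_length.
have [lam xE] := basis_height nx; exists lam.
have ln : {in level n.+1, forall x, len x = n.+1} by move=> y; rewrite mem_level => /eqP.
have [lP _] := lead_prod lam ln; set P := (\prod_(y <- _) _)%g in lP *.
apply/(gr_classP lP ng); rewrite gE.
pose t := s ++ [seq (- lam y, word y) | y <- level n.+1].
have tn : {in t, forall p, size p.2.2 = n}.
  move=> p; rewrite mem_cat => /orP[/sn //|/mapP[y /ln [yn] ->]] //.
have t0 : \sum_(p <- t) p.1 *: lie_word (lie_gen (serre A)) p.2 = 0.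
  rewrite big_cat big_map /= -[X in X + _]/x xE -big_split big1 // => y _ /=.
  by rewrite scaleNr subrr.
have := word_commg_relation (uplus_xD A) (serre_relation gcmA sphA) tn t0.
rewrite big_cat big_map /= => /eqP; rewrite addr_eq0 => /eqP ->.
have -> : gr_class n P = \sum_(y <- level n.+1) gr_class n (wc (word y) (lam y)).
  rewrite /P; elim: (level n.+1) ln => [|y q IHq] ln; first by rewrite !big_nil.
  have [yn] := ln y (mem_head _ _).
  have qn : {in q, forall x, len x = n.+1} by move=> z zq; apply: ln; rewrite inE zq orbT.
  rewrite !big_cons gr_classM; [by rewrite IHq| |by case: (lead_prod lam qn)].
  by rewrite -yn; apply: word_commg_lcs.
rewrite -sumrN big_seq [RHS]big_seq; apply: eq_bigr => y /ln [<-].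
by rewrite (rat_additiveN _ (word_commg_additive (uplus_xD A) _)) opprK.
Qed.

Lemma above_lcs n (lam : B -> rat) s : all (above n) s ->
  lcs n.+1 (\prod_(x <- s) wc (word x) (lam x))%g.
Proof.
elim: s => [|x s IHs] /=; first by rewrite big_nil => _; apply: lcs1.
move=> /andP[xn /IHs sn]; rewrite big_cons; apply: lcsM => //.
by apply: (lcs_le xn); apply: word_commg_lcs.
Qed.

Lemma coset_eq n (g h : G) : lcs_coset n g = lcs_coset n h <-> lcs n (g^-1 * h)%g.
Proof.
split=> [gh|gh].
  have : lcs_coset n h h by rewrite /lcs_coset /= mulVg; apply: lcs1.
  by rewrite -gh.
apply/seteqP; split=> k /=; rewrite /lcs_coset /=.
  move=> /(lcsM (lcsV gh)); rewrite invgM invgK -mulgA.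
  by rewrite mulVKg.
by move=> /(lcsM gh); rewrite -mulgA mulVKg.
Qed.

Section Existence.
Variable g : G.

(** The default 0 is for h outside the domain of [level_exists_coef]; by [remainder_lcs] it does not
    arise for remainders. *)
Definition level_coef n (h : G) : B -> rat :=
  if pselect (lcs n.+1 h) is left H then projT1 (cid (level_exists_coef H)) else fun=> 0.

Fixpoint remainder n : G :=
  if n is n'.+1 then
    ((\prod_(x <- level n'.+1) wc (word x) (level_coef n' (remainder n') x))^-1
     * remainder n')%g
  else g.

(** A word of length n+1 has n letters after the first, and its level is divided out of [remainder]
    n. *)
Definition coef (x : B) : rat := level_coef (size (word x).2) (remainder (size (word x).2)) x.

Lemma remainder_lcs n : lcs n.+1 (remainder n).
Proof.
elim: n => [|n IHn] //; rewrite -[remainder _]/(_ * _)%g /level_coef.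
by case: pselect => // H; case: cid.
Qed.

Lemma remainderS n : remainder n =
  (\prod_(x <- level n.+1) wc (word x) (coef x) * remainder n.+1)%g.
Proof.
rewrite [remainder n.+1]/= mulgA.
have -> : (\prod_(x <- level n.+1) wc (word x) (coef x) =
    \prod_(x <- level n.+1) wc (word x) (level_coef n (remainder n) x))%g.
  rewrite big_seq [RHS]big_seq; apply: eq_bigr => x; rewrite mem_level => /eqP [xn].
  by rewrite /coef xn.
by rewrite mulgV mul1g.
Qed.

(** Each of the next k levels heads the segment and cancels against the factor by which consecutive
    remainders differ. *)
Lemma prod_remainder k n s : initial_segment (above n) s ->
  (forall x, (n < len x <= n + k)%N -> x \in s) ->
  lcs (n + k).+1 ((\prod_(x <- s) wc (word x) (coef x))^-1 * remainder n)%g.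
Proof.
elim: k n s => [|k IHk] n s is_s sk.
  rewrite addn0; apply: lcsM; last exact: remainder_lcs.
  by apply: lcsV; apply: above_lcs; case: is_s.
have [|t st is_t] := initial_segment_split is_s.
  by move=> x; rewrite mem_level => /eqP xn; apply: sk; rewrite xn leqnn addnS ltnS leq_addr.
rewrite st big_cat remainderS invgM -mulgA mulKg addnS -addSn; apply: IHk => // x /andP[nx xk].
have : x \in s by apply: sk; rewrite (ltnW nx) -addSnnS.
rewrite st mem_cat mem_level => /orP[/eqP xn|//].
by move: nx; rewrite xn ltnn.
Qed.

Lemma above_remainder n : ordered_prod_is (above n) (fun x => wc (word x) (coef x))
  (to_completion (remainder n)).
Proof.
move=> N; have [s0 is0 s0k] := initial_segment_exists n N.
exists s0 => // s is_s s0s; apply/coset_eq.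
have lN := prod_remainder is_s (k := N) (fun x xk => s0s _ (s0k x xk)).
by apply: lcs_le lN; rewrite -addnS ltnW // addnS ltnS leq_addl.
Qed.

End Existence.

(** The shortest level is determined modulo the next term of the series; once its two products agree
    they cancel, and the argument repeats one level higher. *)
Lemma strip_unique (lam mu : B -> rat) k n s : initial_segment (above n) s ->
  (forall x, (n < len x <= n + k)%N -> x \in s) ->
  lcs (n + k).+1 ((\prod_(x <- s) wc (word x) (lam x))^-1 *
                  \prod_(x <- s) wc (word x) (mu x))%g ->
  forall x, (n < len x <= n + k)%N -> lam x = mu x.
Proof.
elim: k n s => [|k IHk] n s is_s sk lm x /andP[nx xk].
  by move: (leq_trans nx xk); rewrite addn0 ltnn.
have [|t st is_t] := initial_segment_split is_s.
  by move=> y; rewrite mem_level => /eqP yn; apply: sk; rewrite yn leqnn addnS ltnS leq_addr.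
have at_ : all (above n.+1) t by case: is_t.
rewrite st !big_cat /= in lm.
set P := (\prod_(y <- level _) _)%g in lm; set Q := (\prod_(y <- level _) _)%g in lm.
(* The products over the longer words already lie in this term, so they can be cancelled from both
   sides. *)
have PQ : lcs n.+2 (P^-1 * Q)%g.
  have lR := above_lcs lam at_; have mR := above_lcs mu at_.
  have := lcsM (lcsM lR (lcs_le _ lm)) (lcsV mR).
  by rewrite invgM !mulgA mulgV mul1g mulgK; apply; rewrite addnS ltnS ltnS leq_addr.
have lmE := level_unique PQ.
move: nx; rewrite leq_eqVlt => /orP[/eqP xn|nx].
  by apply: lmE; rewrite mem_level -xn.
apply: (IHk n.+1 t) => //; last by rewrite nx addSnnS.
  move=> y /andP[ny yk]; have : y \in s by apply: sk; rewrite (ltnW ny) -addSnnS.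
  by rewrite st mem_cat mem_level => /orP[/eqP yn|//]; move: ny; rewrite yn ltnn.
have PQe : P = Q.
  by rewrite /P /Q big_seq [RHS]big_seq; apply: eq_bigr => y yl; rewrite lmE.
by move: lm; rewrite PQe invgM -!mulgA mulKg addnS addSn.
Qed.

Lemma ordered_prod_unique (lam mu : B -> rat) (l : hausdorff_completion G) :
  ordered_prod_is xpredT (fun x => wc (word x) (lam x)) l ->
  ordered_prod_is xpredT (fun x => wc (word x) (mu x)) l -> lam = mu.
Proof.
move=> hl hm; apply/funext => x.
have [s is_s sl] := hl (len x).+1; have [t is_t tm] := hm (len x).+1.
have [q is_q qk] := initial_segment_exists 0 (len x).
have join (u v : seq B) : initial_segment (xpredT : pred B) u -> initial_segment (xpredT : pred B) v ->
    exists2 w, initial_segment (xpredT : pred B) w & {subset u <= w} /\ {subset v <= w}.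
  move=> iu iv; case: (initial_segment_total iu iv) => [uv|vu].
    by exists v; last by split.
  by exists u; last by split.
have [u iu [su tu]] := join s t is_s is_t; have [v iv [uv qv]] := join u q iu is_q.
have vl := sl v iv (fun y ys => uv _ (su _ ys)); have vm := tm v iv (fun y ys => uv _ (tu _ ys)).
apply: (@strip_unique lam mu (len x) 0 v) => //; last by rewrite add0n leqnn.
  by move=> y /qk /qv.
by apply/coset_eq; apply: etrans vl (esym vm).
Qed.

End NormalForm.

Theorem corollary7 (r : nat) (A : 'M[int]_r) (d : Order.disp_t)
    (B : orderType d) (word : B -> 'I_r * seq 'I_r) :
  gcm A ->
  two_spherical A ->
  is_basis (fun x : B => nested_lie A (word x)) ->
  (forall x y : B, (word_length (word x) < word_length (word y))%N ->
     (x < y)%O) ->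
  forall g : uplus A,
  exists! lam : B -> rat,
    ordered_prod_is xpredT (fun x => nested_comm A (word x) (lam x))
      (to_completion g) /\
    (forall n : nat, (1 <= n)%N ->
       exists2 h : uplus A, lcs n h &
         ordered_prod_is (fun x => (n <= word_length (word x))%N)
           (fun x => nested_comm A (word x) (lam x)) (to_completion h)).
Proof.
move=> gA sA bA wA g; exists (coef gA sA bA g); split; [split|].
(* [remainder] at 0 is g, and [above 0] is convertible to [xpredT] because a word length is a
   successor. *)
- exact: (above_remainder gA sA bA wA g 0).
- case=> // n _; exists (remainder gA sA bA g n); first exact: remainder_lcs.
  exact: above_remainder.
- by move=> mu [hm _]; apply: (ordered_prod_unique gA sA bA wA (above_remainder gA sA bA wA g 0) hm).
Qed.
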